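(* Let $n\ge 0$ be an integer and let $W$ be an interaction potential satisfying the standing assumptions below. Suppose that $W$ is $\frac{1}{n+1}$-periodic, that $2\widehat W(n+1)=1$, and that $$2\widehat W(k)\le \frac{n+1}{k}\qquad\text{for all integers } k\ge 1.$$ Then a phase transition occurs at the critical coupling strength $K_c=1=K_\#$, and this phase transition is continuous. Furthermore, if $K\le \frac12$, then the uniform distribution $q_u\equiv 1$ is the unique critical point of $\mathcal F_K$.
   Context: $\mathbb T=[-\frac12,\frac12)$ with periodic boundary conditions; $\mathcal P(\mathbb T)$ denotes Borel probability measures on $\mathbb T$, identified with their Lebesgue densities when absolutely continuous; $q_u\equiv 1$ is the uniform distribution. Fourier coefficients are $\widehat f(k)=\int_{\mathbb T} f(\theta)e^{-2\pi i k\theta}\,d\theta$. Standing assumptions on $W$: $W:\mathbb T\to\mathbb R$ is Borel measurable, even, with zero average, so that $W(\theta)=\sum_{k\ge1}2\widehat W(k)\cos(2\pi k\theta)$ with real $\widehat W(k)$. Let $\mathcal I_\pm=\{k\in\mathbb N:\pm\widehat W(k)>0\}$ and $W^{+}(\theta)=2\sum_{k\in\mathcal I_+}\widehat W(k)\cos(2\pi k\theta)$, $W^-=W^+-W$. Write $W^+=W^+_+-W^+_-$ with $W^+_\pm\ge0$ its positive and negative parts. It is assumed that for every $K\ge0$ there is $C_K\ge0$ with $\int\log q\,dq-K\iint W^+_+(\theta-\theta')\,dq(\theta)dq(\theta')\ge -C_K$ for all $q\in\mathcal P(\mathbb T)$, and that the interaction energy $q\mapsto\iint W(\theta-\theta')\,dq(\theta)dq(\theta')$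 is upper semicontinuous. Free energy: for $K\ge0$, $\mathcal F_K(q)=\int_{\mathbb T}\log q\,dq-K\iint_{\mathbb T\times\mathbb T}W(\theta-\theta')\,dq(\theta)dq(\theta')$ (equal to $+\infty$ if $q$ is not absolutely continuous), extended as the lower semicontinuous functional on $\mathcal P(\mathbb T)$. A critical point of $\mathcal F_K$ is a probability density $q$ solving the Kirkwood--Monroe equation $q=e^{2K(W*q)}/\int_{\mathbb T}e^{2K(W*q)}d\theta$. Phase transition: a number $K_c\ge0$ is the critical coupling if for $K<K_c$, $q_u$ is the unique global minimizer of $\mathcal F_K$; at $K=K_c$, $q_u$ is a global minimizer; for $K>K_c$ there is a global minimizer $q\neq q_u$. The phase transition is continuous if at $K=K_c$ the global minimizer is unique and for every family $\{q_K:K>K_c\}$ of global minimizers of $\mathcal F_K$, $\limsup_{K\to K_c^+}\|q_K-q_u\|_{L^1}=0$; otherwise it is discontinuous. The linear stability threshold of $q_u$ is $K_\#=\big(2\max_{k\in\mathcal I_+}\widehat W(k)\big)^{-1}$. *)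

(* Defs.v *)
From HB Require Import structures.
From mathcomp Require Import all_boot all_order all_algebra.
From mathcomp Require Import all_classical all_reals all_analysis.
Set Implicit Arguments. Unset Strict Implicit. Unset Printing Implicit Defensive.
Import Order.TTheory GRing.Theory Num.Theory numFieldNormedType.Exports.
Local Open Scope classical_set_scope.
Local Open Scope ring_scope.

Section Defs.
Variable R : realType.
Local Notation leb := (@lebesgue_measure R).

(* The torus T = [-1/2, 1/2), realised as a subset of R; functions on the
   torus are functions on R (1-periodic where relevant). *)
Definition Tor : set R := `[(- (2%:R)^-1), (2%:R)^-1[.

(* Real Fourier (cosine) coefficient; for an even f it equals \hat f(k). *)
Definition fhat (f : R -> R) (k : nat) : R :=
  \int[leb]_(x in Tor) (f x * cos (2 * pi * k%:R * x)).

Definition periodic1 (f : R -> R) := forall x, f (x + 1) = f x.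

Definition is_density (q : R -> R) :=
  measurable_fun setT q /\ (forall x, Tor x -> 0 <= q x) /\
  leb.-integrable Tor (fun x => (q x)%:E) /\
  \int[leb]_(x in Tor) q x = 1.

(* equality as measures on T, i.e. a.e. equality on T *)
Definition dens_eq (q1 q2 : R -> R) :=
  {ae leb, forall x, Tor x -> q1 x = q2 x}.

Definition qu : R -> R := fun _ => 1.

(* entropy  \int log q dq  (integrand >= -1/e, value in (-oo, +oo]) *)
Definition entropy (q : R -> R) : \bar R :=
  (\int[leb]_(x in Tor) (q x * ln (q x))%:E)%E.

Definition inter (V : R -> R) (q : R -> R) : \bar R :=
  (\int[leb \x leb]_(z in Tor `*` Tor) (V (z.1 - z.2) * q z.1 * q z.2)%:E)%E.

Definition inter_meas (mu : probability R R) (V : R -> R) : \bar R :=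
  (\int[mu \x mu]_(z in Tor `*` Tor) (V (z.1 - z.2))%:E)%E.

Definition prob_on_T (mu : probability R R) := mu Tor = 1%E.

Definition weak_cvg (mu_ : nat -> probability R R) (mu : probability R R) :=
  forall f : R -> R, continuous f -> periodic1 f ->
    (fun n => \int[mu_ n]_(x in Tor) f x) @ \oo --> \int[mu]_(x in Tor) f x.

(* upper semicontinuity of the interaction energy on P(T) (the weak topology
   on P(T) is metrizable, so sequential usc is usc) *)
Definition inter_usc (V : R -> R) :=
  forall (mu_ : nat -> probability R R) (mu : probability R R),
    (forall n, prob_on_T (mu_ n)) -> prob_on_T mu -> weak_cvg mu_ mu ->
    (limn_esup (fun n => inter_meas (mu_ n) V) <= inter_meas mu V)%E.

(* free energy  int log q dq - K iint V q q ; +oo whenever the entropy is +oo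
   (lower semicontinuous convention) *)
Definition energy (V : R -> R) (K : R) (q : R -> R) : \bar R :=
  if entropy q == +oo%E then +oo%E else (entropy q - K%:E * inter V q)%E.

Definition is_global_min (W : R -> R) (K : R) (q : R -> R) :=
  is_density q /\ forall p, is_density p -> (energy W K q <= energy W K p)%E.

Definition conv (W q : R -> R) (x : R) : R :=
  \int[leb]_(y in Tor) (W (x - y) * q y).

(* critical point: solution of the Kirkwood--Monroe equation *)
Definition is_critical (W : R -> R) (K : R) (q : R -> R) :=
  is_density q /\
  {ae leb, forall x, Tor x -> leb.-integrable Tor (fun y => (W (x - y) * q y)%:E)} /\
  leb.-integrable Tor (fun x => (expR (2 * K * conv W q x))%:E) /\
  dens_eq q (fun x => expR (2 * K * conv W q x) /
                    \int[leb]_(y in Tor) expR (2 * K * conv W q y)).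

Definition is_critical_coupling (W : R -> R) (Kc : R) :=
  0 <= Kc /\
  (forall K, 0 <= K < Kc -> is_global_min W K qu /\
       forall q, is_global_min W K q -> dens_eq q qu) /\
  is_global_min W Kc qu /\
  (forall K, Kc < K -> exists q, is_global_min W K q /\ ~ dens_eq q qu).

Definition L1dist (p q : R -> R) : \bar R :=
  (\int[leb]_(x in Tor) `|p x - q x|%:E)%E.

Definition continuous_transition (W : R -> R) (Kc : R) :=
  (forall q, is_global_min W Kc q -> dens_eq q qu) /\
  forall qK : R -> R -> R,
    (forall K, Kc < K -> is_global_min W K (qK K)) ->
    forall e : R, 0 < e -> exists2 delta : R, 0 < delta &
      forall K, Kc < K < Kc + delta -> (L1dist (qK K) qu < e%:E)%E.

Definition Ksharp (W : R -> R) : R :=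
  (2 * sup [set fhat W k | k in [set k : nat | (0 < k)%N /\ 0 < fhat W k]])^-1.

End Defs.

(* Main.v *)
(** Write [u m] for the Fourier coefficient of a density [q] at the frequency
    [m (n + 1)]. Testing the variational formula of the entropy with the potential
    [2 Re (sum_m conj (u m) z^m / m)], whose exponential has integral at most
    [exp (sum_m |u m|^2 / m)] by the Lebedev-Milin inequality, shows that the
    entropy of [q] is at least [sum_m |u m|^2 / m]. Since [W] only has frequencies
    [m (n + 1)], where [2 What <= 1 / m], this sum dominates the interaction
    energy: hence [F_1 >= 0]. Equality in Lebedev-Milin forces [u m = u 1 ^ m], and
    one of the inequalities [2 What <= 1 / m] is strict because upper
    semicontinuity makes [W] bounded above; so [q] is uniform when [F_1 q = 0].
    For [K > 1] a small cosine perturbation has negative energy, and minimizers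
    exist by semicontinuity; the limits of such minimizers as [K] decreases to [1]
    have [F_1 <= 0], and convexity of the entropy upgrades the convergence to L1.
    A critical point for [K] satisfies [F_(2K) <= 0], whence the claim for
    [K <= 1/2]. *)
Require Import Defs.
From HB Require Import structures.
From mathcomp Require Import all_boot all_order all_algebra.
From mathcomp Require Import complex.
From mathcomp Require Import all_classical all_reals all_analysis.
From mathcomp Require Import measurable_realfun.
From mathcomp Require Import ring lra.
Set Implicit Arguments. Unset Strict Implicit. Unset Printing Implicit Defensive.
Import Order.TTheory GRing.Theory Num.Theory numFieldNormedType.Exports.
Local Open Scope classical_set_scope.
Local Open Scope ring_scope.

(** * Exponentials of polynomials and the Lebedev-Milin inequality *)

(** The potential is only integrable and bounded above, and its Fourier coefficients are not assumed
    summable; the interaction energy may be [-oo] and has no usable Fourier series. This shapes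
    three steps. For bounded densities the energy is obtained as a limit of finite sums with Fejer
    weights in [[0, 1]], and it is compared with the entropy at a finite cut-off only. Equality in
    Lebedev-Milin is then reached merely in the limit, so the inequality is carried with an explicit
    Cauchy-Schwarz remainder whose effect is bounded below uniformly in the cut-off. Unbounded
    densities are truncated at a level tuned so that the entropy lost outweighs the interaction lost
    by at least the removed mass; this linear gain makes equality force the density to be bounded.
    For compactness the limit density is not extracted from the sequence itself: it is rebuilt from
    the limits of the trigonometric moments, by minimising the entropy under these constraints. *)

Section TruncatedExp.
Variable F : numFieldType.

(** Taylor polynomials instead of exponential series keep Lebedev-Milin a statement about
    polynomials with finitely many coefficients; the order [M] is sent to infinity only in
    [I_exp_fpot]. *)
Definition expT (M : nat) (x : F) : F := \sum_(m < M.+1) m`!%:R^-1 * x ^+ m.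
Definition pexp (M : nat) (p : {poly F}) : {poly F} :=
  \sum_(m < M.+1) m`!%:R^-1 *: p ^+ m.

Lemma fact_neq0R m : (m`!%:R : F) != 0.
Proof. by rewrite pnatr_eq0 -lt0n fact_gt0. Qed.

Lemma horner_pexp M p x : (pexp M p).[x] = expT M p.[x].
Proof.
rewrite /pexp /expT horner_sum; apply: eq_bigr => m _.
by rewrite hornerZ horner_exp.
Qed.

Lemma deriv_pexp M p : (pexp M.+1 p)^`() = p^`() * pexp M p.
Proof.
rewrite /pexp big_ord_recl /= expr0 derivD derivZ derivC scaler0 add0r.
rewrite raddf_sum mulr_sumr; apply: eq_bigr => m _ /=.
rewrite /bump /= add1n derivZ deriv_exp /= -mulrnAr -(scaler_nat m.+1) -!scalerAr scalerA.
congr (_ *: _); rewrite factS natrM invfM mulrAC mulVf ?mul1r //.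
Qed.

(** Coefficients of [(exp p)' = p' exp p]. The truncation order drops by one because the derivative
    of a Taylor polynomial of [exp] is the previous one; this recursion drives the induction of
    Lebedev-Milin. *)
Lemma pexp_coefS M p k : k.+1%:R * (pexp M.+1 p)`_k.+1 =
  \sum_(j < k.+1) j.+1%:R * p`_j.+1 * (pexp M p)`_(k - j).
Proof.
have := congr1 (fun q : {poly F} => q`_k) (deriv_pexp M p).
rewrite coef_deriv coefM mulr_natl => ->.
by apply: eq_bigr => j _; rewrite coef_deriv mulr_natl.
Qed.

Lemma pexp_coef0 M (p : {poly F}) : p`_0 = 0 -> (pexp M p)`_0 = 1.
Proof.
move=> p0; rewrite /pexp big_ord_recl /= expr0 coefD coefZ coef1 /=.
rewrite fact0 invr1 mul1r coef_sum big1 ?addr0 // => m _.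
by rewrite coefZ exprS coefM big_ord1 p0 mul0r mulr0.
Qed.

Let P M (z : F) : {poly F} := \poly_(a < M.+1) (a`!%:R^-1 * z ^+ a).

Let hornerP1 M z : (P M z).[1] = expT M z.
Proof.
rewrite /P horner_poly /expT; apply: eq_bigr => m _.
by rewrite expr1n mulr1.
Qed.

Lemma horner1_wide (p : {poly F}) n :
  (size p <= n)%N -> p.[1] = \sum_(m < n) p`_m.
Proof.
move=> sp; rewrite (horner_coef_wide _ sp); apply: eq_bigr => m _.
by rewrite expr1n mulr1.
Qed.

Let coefPP M z z' m : (m <= M)%N ->
  (P M z * P M z')`_m = m`!%:R^-1 * (z + z') ^+ m.
Proof.
move=> mM; rewrite coefMr exprDn mulr_sumr; apply: eq_bigr => j _.
have jm : (j <= m)%N by rewrite -ltnS.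
rewrite /P !coef_poly ltnS (leq_trans (leq_subr _ _) mM) ltnS (leq_trans jm mM).
rewrite -mulr_natr -(bin_fact jm) !natrM.
have := fact_neq0R m; rewrite -(bin_fact jm) !natrM !mulf_eq0 !negb_or.
move=> /andP[b0 /andP[f1 f2]]; field.
by rewrite b0 f1 f2.
Qed.

Let sizePP M z z' : (size (P M z * P M z')%R <= M.+1 + M.+1)%N.
Proof.
by rewrite (leq_trans (size_polyMleq _ _)) // (leq_trans (leq_pred _)) //
  leq_add // size_poly.
Qed.

(** Up to degree [M] the coefficients of the product are those of [exp (z + z')] by the binomial
    theorem, so the defect of the functional equation consists of the upper coefficients. *)
Lemma expT_mulB M z z' : expT M z * expT M z' - expT M (z + z') =
  \sum_(i < M.+1) (P M z * P M z')`_(M.+1 + i).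
Proof.
rewrite -!hornerP1 -hornerM (horner1_wide (sizePP M z z')) big_split_ord /=.
rewrite [X in X + _ - _](_ : _ = (P M (z + z')).[1]); last first.
  rewrite hornerP1 /expT; apply: eq_bigr => i _; rewrite coefPP //.
  by rewrite -ltnS.
by rewrite addrC addKr.
Qed.

(** The upper coefficients are polynomials in [|z|] and [|z'|] with nonnegative coefficients once
    norms are taken, hence largest at [z = z' = r]. *)
Lemma expT_mulB_norm M (z z' r : F) : `|z| <= r -> `|z'| <= r ->
  `|expT M z * expT M z' - expT M (z + z')| <=
    expT M r * expT M r - expT M (r + r).
Proof.
move=> zr z'r; rewrite !expT_mulB (le_trans (ler_norm_sum _ _ _)) //.
apply: ler_sum => i _; rewrite !coefM (le_trans (ler_norm_sum _ _ _)) //.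
apply: ler_sum => j _; rewrite normrM.
have PB (w : F) l : `|w| <= r -> `|(P M w)`_l| <= (P M r)`_l.
  move=> wr; rewrite /P !coef_poly; case: ifP => _; last by rewrite normr0.
  rewrite normrM normrX ger0_norm ?invr_ge0 ?ler0n // ler_wpM2l //.
  by rewrite lerXn2r // nnegrE (le_trans (normr_ge0 w)).
by rewrite ler_pM // PB.
Qed.

End TruncatedExp.

Lemma expT_rmorph (F G : numFieldType) (f : {rmorphism F -> G}) M x :
  f (expT M x) = expT M (f x).
Proof.
rewrite /expT rmorph_sum; apply: eq_bigr => m _.
by rewrite rmorphM rmorphXn fmorphV rmorph_nat.
Qed.

Section RealExp.
Variable R : realType.

Lemma expT_series M (x : R) : expT M x = series (exp_coeff x) M.+1.
Proof.
rewrite /expT /series /= big_mkord; apply: eq_bigr => m _.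
by rewrite /exp_coeff /= mulrC.
Qed.

Lemma cvg_expT (x : R) : expT M x @[M --> \oo] --> expR x.
Proof.
have -> : (fun M => expT M x) = (fun M => series (exp_coeff x) (M + 1)%N).
  by apply/funext => M; rewrite expT_series addn1.
by rewrite cvg_shiftn; exact: is_cvg_series_exp_coeff.
Qed.

(** The tail of the series at [y] is dominated term by term by the tail at [s]. *)
Lemma expR_expT (M : nat) (y s : R) : `|y| <= s ->
  expR y <= expT M y + (expR s - expT M s).
Proof.
move=> ys.
suff H : expR y - expR s <= expT M y - expT M s by lra.
have cv : (fun L => expT L y - expT L s) @ \oo --> expR y - expR s.
  by apply: cvgB; exact: cvg_expT.
rewrite -(cvg_lim _ cv) //; apply: limr_le; first by apply/cvg_ex; exists (expR y - expR s).
exists M => // L /= ML.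
suff H : expT L y - expT M y <= expT L s - expT M s by lra.
rewrite !expT_series !sub_series_geq //; apply: ler_sum => k _.
rewrite /exp_coeff /= ler_wpM2r ?invr_ge0 ?ler0n //.
by rewrite (le_trans (ler_norm _)) // normrX lerXn2r // nnegrE ?(le_trans _ ys).
Qed.

Lemma expT_le_expR (M : nat) (s : R) : 0 <= s -> expT M s <= expR s.
Proof.
move=> s0; have cv := @cvg_expT s; rewrite -(cvg_lim _ cv) //; apply: limr_ge.
  by apply/cvg_ex; exists (expR s); exact: cvg_expT.
exists M => // L /= ML; rewrite -subr_ge0 !expT_series !sub_series_geq //.
by apply: sumr_ge0 => k _; rewrite exp_coeff_ge0.
Qed.

End RealExp.

(** * Squared moduli and truncated complex exponentials *)

Section ComplexSq.
Variable R : realType.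
Local Notation C := (R[i]).
Implicit Types z w : C.

(** The norm of [R[i]] takes its values in [R[i]]; this squared modulus is real and can be
    integrated. *)
Definition nsq (z : C) : R := complex.Re z ^+ 2 + complex.Im z ^+ 2.

Lemma nsqM z w : nsq (z * w) = nsq z * nsq w.
Proof. by case: z => a b; case: w => c d; rewrite /nsq /=; ring. Qed.

Lemma nsq_ge0 z : 0 <= nsq z.
Proof. by rewrite /nsq addr_ge0 // sqr_ge0. Qed.

Lemma nsq_real (a : R) : nsq (a%:C)%C = a ^+ 2.
Proof. by rewrite /nsq /= expr0n addr0. Qed.

Lemma nsq_nat (k : nat) : nsq k%:R = k%:R ^+ 2.
Proof. by rewrite -nsq_real; congr nsq; rewrite /= rmorph_nat. Qed.

Lemma nsq_eq0 z : nsq z = 0 -> z = 0.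
Proof.
case: z => a b; rewrite /nsq /= => /eqP; rewrite paddr_eq0 ?sqr_ge0 //.
by rewrite !sqrf_eq0 => /andP[/eqP -> /eqP ->].
Qed.

Lemma normc_nsq z : `|z| ^+ 2 = ((nsq z)%:C)%C.
Proof.
rewrite normCK; case: z => a b; rewrite /nsq; simpc.
by congr (_ +i* _)%C; ring.
Qed.

Lemma nsq_norm z (r : R) : 0 <= r -> nsq z <= r ^+ 2 -> `|z| <= (r%:C)%C.
Proof.
move=> r0 zr; rewrite -(@ler_pXn2r _ 2) ?nnegrE ?ler0c ?sqrtr_ge0 //.
  2: by case: z {zr} => a b; exact: sqrtr_ge0.
by rewrite normc_nsq -rmorphXn lecR.
Qed.

(** This is [exp (2 Re z) = |exp z|^2], read off from [z + conj z = 2 Re z], with a truncation error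
    that is uniform on the disc of radius [r] and tends to [0] with [M]. *)
Lemma expR_nsq_expT M z (r : R) : 0 <= r -> nsq z <= r ^+ 2 ->
  expR (2 * complex.Re z) <= nsq (expT M z) +
    (expT M r * expT M r - expT M (2 * r) + (expR (2 * r) - expT M (2 * r))).
Proof.
move=> r0 zr; have zr' := nsq_norm r0 zr.
have Rer : `|complex.Re z| <= r.
  rewrite -(@ler_pXn2r _ 2) ?nnegrE // real_normK ?num_real //.
  by rewrite (le_trans _ zr) // /nsq lerDl sqr_ge0.
have := @expR_expT R M (2 * complex.Re z) (2 * r).
rewrite normrM ger0_norm // ler_pM2l // => /(_ Rer) /le_trans; apply.
suff : expT M (2 * complex.Re z) <= nsq (expT M z) +
   (expT M r * expT M r - expT M (2 * r)) by lra.
have zc : `|z^*%C| <= (r%:C)%C by rewrite norm_conjC.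
have := @expT_mulB_norm C M z (z^*)%C (r%:C)%C zr' zc.
have -> : z + (z^*)%C = ((2 * complex.Re z)%:C)%C.
  by apply/eqP; case: z {zr zr' zc Rer} => a b; rewrite eq_complex /= subrr mulr_natl mulr2n !eqxx.
have -> : (r%:C)%C + (r%:C)%C = ((2 * r)%:C)%C :> C by rewrite -rmorphD; congr (_%:C)%C; ring.
have -> : expT M (z^*)%C = ((expT M z)^*)%C.
  by rewrite (expT_rmorph (@conjc R)).
rewrite -!(expT_rmorph (real_complex R)) -normCK normc_nsq -rmorphM -!rmorphB /=.
rewrite -normrN -rmorphN opprB => /(le_trans (real_ler_norm _)).
by rewrite complex_real eqxx lecR => /(_ isT); lra.
Qed.

End ComplexSq.

(** * The Lebedev-Milin inequality with a remainder *)

Section LebedevMilin.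
Variable R : realType.
Local Notation C := (R[i]).

(** Lagrange's identity for Cauchy-Schwarz, keeping from the double sum only the pairs [(a, b)] and
    [(b, a)]. The kept term is what later detects the case of equality. *)
Lemma sum_sq_defect n (x : 'I_n -> R) (a b : 'I_n) :
  (\sum_i x i) ^+ 2 + (x a - x b) ^+ 2 <= n%:R * \sum_i x i ^+ 2.
Proof.
have E : \sum_i \sum_j (x i - x j) ^+ 2 = 2 * (n%:R * \sum_i x i ^+ 2 - (\sum_i x i) ^+ 2).
  have sqB u v : (u - v) ^+ 2 = u ^+ 2 + v ^+ 2 - 2 * (u * v) :> R by ring.
  under eq_bigr => i _ do under eq_bigr => j _ do rewrite sqB.
  have sc c : \sum_(j < n) c = n%:R * c :> R by rewrite sumr_const card_ord mulr_natl.
  under eq_bigr => i _ do rewrite sumrB big_split /= sc -mulr_sumr -mulr_sumr.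
  rewrite sumrB big_split /= sc -mulr_sumr -mulr_sumr -mulr_suml.
  by ring.
suff : 2 * (x a - x b) ^+ 2 <= \sum_i \sum_j (x i - x j) ^+ 2 by rewrite E; lra.
have nn i : 0 <= \sum_j (x i - x j) ^+ 2 by apply: sumr_ge0 => j _; exact: sqr_ge0.
have [->|ab] := eqVneq a b.
  by rewrite subrr expr0n mulr0; apply: sumr_ge0.
rewrite (bigD1 a) //= [X in _ <= _ + X](bigD1 b) 1?eq_sym //=.
have h1 : (x a - x b) ^+ 2 <= \sum_j (x a - x j) ^+ 2.
  by rewrite (bigD1 b) //= lerDl; apply: sumr_ge0 => j _; exact: sqr_ge0.
have h2 : (x b - x a) ^+ 2 <= \sum_j (x b - x j) ^+ 2.
  by rewrite (bigD1 a) //= lerDl; apply: sumr_ge0 => j _; exact: sqr_ge0.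
have h3 : 0 <= \sum_(i | (i != a) && (i != b)) \sum_j (x i - x j) ^+ 2.
  by apply: sumr_ge0.
have h4 : (x b - x a) ^+ 2 = (x a - x b) ^+ 2 by ring.
lra.
Qed.

Lemma nsq_sum_defect n (x : 'I_n -> C) (a b : 'I_n) :
  nsq (\sum_i x i) + nsq (x a - x b) <= n%:R * \sum_i nsq (x i).
Proof.
have h1 := sum_sq_defect (fun i => complex.Re (x i)) a b.
have h2 := sum_sq_defect (fun i => complex.Im (x i)) a b.
rewrite /nsq big_split /= mulrDr.
by rewrite !raddf_sum !raddfB /=; lra.
Qed.

Variable h : {poly C}.
Hypothesis h0 : h`_0 = 0.

(** The exponential of this polynomial majorises the squared coefficients of [exp h]; its value at
    [1] is the exponent in Lebedev-Milin. *)
Definition energy_poly : {poly R} := \poly_(j < size h) (j%:R * nsq h`_j).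

Lemma coef_energy_poly j : energy_poly`_j = j%:R * nsq h`_j.
Proof.
rewrite coef_poly; case: ltnP => // hj.
by rewrite nth_default // /nsq /= expr0n addr0 mulr0.
Qed.

(** The summands of the recursion [pexp_coefS] for [h], to which Cauchy-Schwarz is applied. *)
Definition milin_term M k j : C := j.+1%:R * h`_j.+1 * (pexp M h)`_(k - j).

(** Cauchy-Schwarz on the [k+1] terms of the recursion produces [j^2 |h_j|^2 = j * (j |h_j|^2)];
    after the induction hypothesis the sum is exactly the recursion for the exponential of
    [energy_poly]. *)
Lemma lebedev_milin_step M k (a b : 'I_k.+1) :
  (forall j, nsq (pexp M h)`_j <= (pexp M energy_poly)`_j) ->
  nsq (pexp M.+1 h)`_k.+1 +
    nsq (milin_term M k a - milin_term M k b) / k.+1%:R ^+ 2 <=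
    (pexp M.+1 energy_poly)`_k.+1.
Proof.
move=> IH; set x := milin_term M k.
have K0 : 0 < k.+1%:R :> R by rewrite ltr0n.
have K20 : 0 < k.+1%:R ^+ 2 :> R by rewrite exprn_gt0.
rewrite -(ler_pM2l K20) mulrDr mulrCA mulfV ?gt_eqF // mulr1.
rewrite -nsq_nat -nsqM pexp_coefS nsq_nat expr2 -mulrA pexp_coefS.
apply: le_trans (nsq_sum_defect (fun j : 'I_k.+1 => x j) a b) _.
rewrite ler_pM2l //; apply: ler_sum => j _.
rewrite !nsqM coef_energy_poly nsq_nat mulrA.
rewrite (_ : j.+1%:R ^+ 2 * nsq h`_j.+1 = j.+1%:R * (j.+1%:R * nsq h`_j.+1)); last by ring.
by apply: ler_wpM2l; [rewrite !mulr_ge0 ?ler0n ?nsq_ge0|exact: IH].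
Qed.

(** Induction on the truncation order, since the recursion at order [M+1] refers to order [M].
    Choosing [a = b] discards the remainder. *)
Lemma lebedev_milin_coef M k :
  nsq (pexp M h)`_k <= (pexp M energy_poly)`_k.
Proof.
elim: M k => [|M IH] k.
  rewrite /pexp !big_ord1 !expr0 fact0 !invr1 !scale1r !coef1.
  by rewrite nsq_nat; case: eqP => _; rewrite ?expr1n ?expr0n.
case: k => [|k].
  rewrite !pexp_coef0 // ?coef_energy_poly ?mul0r //.
  by rewrite (nsq_nat _ 1) expr1n.
have := @lebedev_milin_step M k ord0 ord0 IH.
by rewrite /= subrr /nsq /= expr0n addr0 mul0r addr0.
Qed.

(** The coefficientwise bounds are summed; the remainder is retained at the single coefficient
    [k+1], which is why [L] must exceed it. *)
Lemma lebedev_milin M k (a b : 'I_k.+1) L : (k.+1 < L)%N ->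
  \sum_(i < L) nsq (pexp M.+1 h)`_i +
    nsq (milin_term M k a - milin_term M k b) / k.+1%:R ^+ 2 <=
    expR (\sum_(j < size h) j%:R * nsq h`_j).
Proof.
move=> kL.
have -> : \sum_(j < size h) j%:R * nsq h`_j = energy_poly.[1].
  rewrite horner_poly; apply: eq_bigr => j _; by rewrite expr1n mulr1.
have e0 : 0 <= energy_poly.[1].
  rewrite horner_poly sumr_ge0 // => j _.
  by rewrite expr1n mulr1 mulr_ge0 ?ler0n ?nsq_ge0.
apply: le_trans (expT_le_expR M.+1 e0).
rewrite -horner_pexp.
pose q := pexp M.+1 energy_poly.
have q0 j : 0 <= q`_j by apply: le_trans (lebedev_milin_coef _ _); exact: nsq_ge0.
have -> : q.[1] = \sum_(i < maxn L (size q)) q`_i.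
  rewrite (@horner_coef_wide _ (maxn L (size q))) ?leq_maxr //.
  by apply: eq_bigr => j _; rewrite expr1n mulr1.
rewrite -(subnKC (leq_maxl L (size q))) big_split_ord /=.
apply: (@le_trans _ _ (\sum_(i < L) q`_i)); last first.
  by rewrite lerDl sumr_ge0.
rewrite (bigD1 (Ordinal kL)) //= [leRHS](bigD1 (Ordinal kL)) //=.
have := lebedev_milin_step a b (lebedev_milin_coef M).
have : \sum_(i < L | i != Ordinal kL) nsq (pexp M.+1 h)`_i <=
    \sum_(i < L | i != Ordinal kL) q`_i.
  by apply: ler_sum => i _; exact: lebedev_milin_coef.
by move=> H1 H2; rewrite addrAC; exact: lerD.
Qed.

End LebedevMilin.

(** * Integration on the torus *)

Section TorusIntegral.
Variable R : realType.
Local Notation mu := (@lebesgue_measure R).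
Local Notation T := (@Tor R).
Implicit Types (f g : R -> R) (a c : R).

Definition L1 f := mu.-integrable T (EFin \o f).
Definition I f : R := \int[mu]_(x in T) f x.

Lemma measurable_Tor : measurable (T : set (measurableTypeR R)).
Proof. exact: measurable_itv. Qed.
Lemma measurable_Tor' : measurable (T : set R).
Proof. exact: measurable_itv. Qed.
Hint Resolve measurable_Tor measurable_Tor' : core.

Lemma TorP x : T x <-> - 2^-1 <= x < 2^-1.
Proof. by rewrite /Tor /= in_itv. Qed.

Lemma mu_Tor : mu T = 1%E.
Proof.
rewrite /Tor lebesgue_measure_itv /= lte_fin.
rewrite (_ : - 2^-1 < 2^-1); last lra.
by rewrite -EFinD; congr (_%:E); lra.
Qed.

Lemma mu_Tor_lty : (mu T < +oo)%E.
Proof. by rewrite mu_Tor ltry. Qed.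

Lemma L1_meas f : L1 f -> measurable_fun T f.
Proof. by move=> /measurable_int /measurable_EFinP. Qed.

Lemma L1_bounded f M : measurable_fun T f -> (forall x, T x -> `|f x| <= M) -> L1 f.
Proof.
move=> mf fM; apply: measurable_bounded_integrable => //; first exact: mu_Tor_lty.
exists M; split; first exact: num_real.
by move=> N MN x /= Tx; rewrite (le_trans (fM _ Tx)) // ltW.
Qed.

Lemma L1_cst c : L1 (fun=> c).
Proof. by apply: (@L1_bounded _ `|c|). Qed.

Lemma eq_L1 f g : (forall x, T x -> f x = g x) -> L1 f -> L1 g.
Proof.
by move=> fg; apply: eq_integrable => // x /set_mem Tx /=; rewrite fg.
Qed.

Lemma L1D f g : L1 f -> L1 g -> L1 (fun x => f x + g x).
Proof.
move=> lf lg; have := integrableD measurable_Tor lf lg.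
by apply: eq_integrable => // x _ /=; rewrite EFinD.
Qed.

Lemma L1Z c f : L1 f -> L1 (fun x => c * f x).
Proof.
move=> lf; have := integrableZl measurable_Tor c lf.
by apply: eq_integrable => // x _ /=; rewrite EFinM.
Qed.

Lemma L1N f : L1 f -> L1 (fun x => - f x).
Proof. by move=> /(L1Z (-1)); apply: eq_L1 => x _; rewrite mulN1r. Qed.

Lemma L1B f g : L1 f -> L1 g -> L1 (fun x => f x - g x).
Proof. by move=> lf /L1N; exact: L1D. Qed.

Lemma L1_sum (J : Type) (s : seq J) (P : pred J) (F : J -> R -> R) :
  (forall i, P i -> L1 (F i)) -> L1 (fun x => \sum_(i <- s | P i) F i x).
Proof.
move=> h; have := integrable_sum measurable_Tor s h.
by apply: eq_integrable => // x _ /=; rewrite sumEFin.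
Qed.

Lemma L1_norm f : L1 f -> L1 (fun x => `|f x|).
Proof. exact: integrable_norm. Qed.

Lemma L1_le f g : measurable_fun T f -> (forall x, T x -> `|f x| <= g x) ->
  L1 g -> L1 f.
Proof.
move=> mf fg; apply: le_integrable => //; first exact/measurable_EFinP.
by move=> x Tx /=; rewrite lee_fin (le_trans (fg _ Tx)) // ler_norm.
Qed.

Lemma L1_mulb f g M : L1 f -> measurable_fun T g ->
  (forall x, T x -> `|g x| <= M) -> L1 (fun x => f x * g x).
Proof.
move=> lf mg gM.
apply: (@L1_le _ (fun x => M * `|f x|)); last exact/L1Z/L1_norm.
  by apply: measurable_funM => //; exact: L1_meas.
by move=> x Tx; rewrite normrM mulrC ler_wpM2r // gM.
Qed.

Lemma eq_I f g : (forall x, T x -> f x = g x) -> I f = I g.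
Proof. by move=> fg; apply: eq_Rintegral => x /set_mem /fg. Qed.

Lemma I_cst c : I (fun=> c) = c.
Proof. 
rewrite /I (_ : Rintegral _ _ _ = c * fine (mu T)); last exact: Rintegral_cst.
by rewrite mu_Tor mulr1. Qed.

Lemma ID f g : L1 f -> L1 g -> I (fun x => f x + g x) = I f + I g.
Proof. by move=> lf lg; exact: RintegralD. Qed.

Lemma IB f g : L1 f -> L1 g -> I (fun x => f x - g x) = I f - I g.
Proof. by move=> lf lg; exact: RintegralB. Qed.

Lemma IZ c f : L1 f -> I (fun x => c * f x) = c * I f.
Proof. by move=> lf; exact: RintegralZl. Qed.

Lemma IN f : L1 f -> I (fun x => - f x) = - I f.
Proof. by move=> lf; rewrite -mulN1r -IZ //; apply: eq_I => x _; rewrite mulN1r. Qed.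

Lemma I_sum (J : Type) (s : seq J) (P : pred J) (F : J -> R -> R) :
  (forall i, P i -> L1 (F i)) ->
  I (fun x => \sum_(i <- s | P i) F i x) = \sum_(i <- s | P i) I (F i).
Proof.
move=> h; elim: s => [|i s IH].
  by rewrite big_nil (_ : (fun x => _) = fun=> 0) ?I_cst //; apply/funext => x; rewrite big_nil.
rewrite big_cons; case: ifP => Pi.
  rewrite -IH -ID; last 2 first.
    exact: h.
    exact: L1_sum.
  by apply: eq_I => x _; rewrite big_cons Pi.
by rewrite -IH; apply: eq_I => x _; rewrite big_cons Pi.
Qed.

Lemma I_le f g : L1 f -> L1 g -> (forall x, T x -> f x <= g x) -> I f <= I g.
Proof. by move=> lf lg fg; exact: le_Rintegral. Qed.

Lemma I_ge0 f : (forall x, T x -> 0 <= f x) -> 0 <= I f.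
Proof. by move=> h; exact: Rintegral_ge0. Qed.

Lemma I_norm f : L1 f -> `|I f| <= I (fun x => `|f x|).
Proof. by move=> lf; exact: le_normr_Rintegral. Qed.

Lemma EFin_I f : L1 f -> (I f)%:E = (\int[mu]_(x in T) (f x)%:E)%E.
Proof. by move=> lf; rewrite /I /Rintegral fineK //; exact: integrable_fin_num. Qed.

Lemma aeS (P Q : R -> Prop) : (forall x, P x -> Q x) ->
  {ae mu, forall x, P x} -> {ae mu, forall x, Q x}.
Proof. by move=> PQ [N [mN N0 sN]]; exists N; split=> // x nQ; apply: sN => /PQ. Qed.

Lemma aeS2 (P1 P2 Q : R -> Prop) : (forall x, P1 x -> P2 x -> Q x) ->
  {ae mu, forall x, P1 x} -> {ae mu, forall x, P2 x} -> {ae mu, forall x, Q x}.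
Proof.
move=> PQ h1 h2; have : mu.-negligible (~` [set x | P1 x] `|` ~` [set x | P2 x]).
  exact: negligibleU.
case=> N [mN N0 sN]; exists N; split=> // x nQ; apply: sN.
by apply: contrapT => /not_orP[/contrapT h /contrapT h']; apply: nQ; exact: PQ.
Qed.

Lemma ae_eq_I f g : measurable_fun T f -> measurable_fun T g -> dens_eq f g ->
  I f = I g.
Proof.
move=> mf mg fg; rewrite /I /Rintegral; congr fine; apply: ae_eq_integral => //.
- exact/measurable_EFinP.
- exact/measurable_EFinP.
- by apply: aeS fg => x fg Tx; rewrite fg.
Qed.

Lemma ae_L1 f g : measurable_fun T g -> dens_eq f g -> L1 f -> L1 g.
Proof.
move=> mg fg lf; apply/integrableP; split; first exact/measurable_EFinP.
case/integrableP: (lf) => mf; apply: le_lt_trans.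
rewrite le_eqVlt; apply/orP; left; apply/eqP; apply: ae_eq_integral => //.
- by apply: measurableT_comp => //; exact/measurable_EFinP.
- by apply: measurableT_comp => //.
- by apply: aeS fg => x fg Tx /=; rewrite fg.
Qed.

Lemma I_eq0 f : L1 f -> (forall x, T x -> 0 <= f x) -> I f = 0 -> dens_eq f (fun=> 0).
Proof.
move=> lf f0 If; have mf := L1_meas lf.
have : (\int[mu]_(x in T) `|(f x)%:E| = 0)%E.
  rewrite -[RHS](congr1 EFin If) EFin_I //; apply: eq_integral => x /set_mem Tx.
  by rewrite gee0_abs // lee_fin f0.
move/(ae_eq_integral_abs _ measurable_Tor) => H.
have {}H : ae_eq mu T (EFin \o f) (cst 0%E) by apply: H; exact/measurable_EFinP.
by apply: aeS H => x H Tx; have [] := H Tx.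
Qed.

(** * Translation and reflection on the torus *)

Lemma lebesgue_measure_transl a (A : set (measurableTypeR R)) : measurable A ->
  pushforward mu ((fun x => x + a) : measurableTypeR R -> measurableTypeR R) A = mu A.
Proof.
move=> mA; apply/esym.
have mf : measurable_fun setT ((fun x => x + a) : measurableTypeR R -> measurableTypeR R).
  by apply: measurable_funD.
pose m := [the measure _ _ of pushforward mu ((fun x => x + a) : measurableTypeR R -> measurableTypeR R)].
apply: (@lebesgue_measure_unique _ (m mf)) => // _ [[u v]] _ <-.
rewrite /m /= /pushforward /=.
have -> : (fun x : R => x + a) @^-1` `]u, v] = `]u - a, v - a]%classic.
  by apply/seteqP; split => x /=; rewrite !in_itv /= ltrBlDr lerBrDr.
rewrite !lebesgue_measure_itv /= !lte_fin ltrD2r.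
by case: ifP => // _; rewrite -!EFinD; congr (_%:E); ring.
Qed.

Lemma ge0_integral_transl a (D : set R) (f : R -> \bar R) : measurable D ->
  measurable_fun setT f -> (forall x, 0 <= f x)%E ->
  (\int[mu]_(x in D) f x = \int[mu]_(x in [set x : R | D (x + a)%R]) f (x + a)%R)%E.
Proof.
move=> mD mf f0.
have mt : measurable_fun setT ((fun x => x + a) : measurableTypeR R -> measurableTypeR R).
  by apply: measurable_funD.
rewrite -(@ge0_integral_pushforward _ _ _ _ _ _ mt mu D f) //; last first.
  exact: measurable_funTS.
by apply: eq_measure_integral => A mA _; apply/esym/lebesgue_measure_transl.
Qed.

Lemma ge0_per_shift01 (f : R -> \bar R) a : measurable_fun setT f ->
  (forall x, 0 <= f x)%E -> (forall x : R, f (x + 1) = f x) -> 0 <= a < 1 ->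
  (\int[mu]_(x in T) f (x + a)%R = \int[mu]_(x in T) f x)%E.
Proof.
move=> mf f0 f1 /andP[a0 a1].
have -> : (\int[mu]_(x in T) f (x + a)%R = \int[mu]_(x in `[(a - 2^-1)%R, (a + 2^-1)%R[) f x)%E.
  rewrite [RHS](ge0_integral_transl a) //; congr integral.
  by apply/seteqP; split => x; rewrite TorP /= in_itv /= => /andP[h1 h2]; apply/andP; split; lra.
(* The shifted window and [T] share [[a - 1/2, 1/2)]; the two remaining pieces are translates of
   each other by the period. *)
have E1 : `[a - 2^-1, a + 2^-1[%classic = `[a - 2^-1, 2^-1[ `|` `[2^-1, a + 2^-1[.
  apply/seteqP; split => x /=; rewrite !in_itv /=.
    by move=> /andP[h1 h2]; case: (ltP x 2^-1) => h; [left|right]; apply/andP; split; lra.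
  by move=> [|] /andP[h1 h2]; apply/andP; split; lra.
have E2 : T = `[- 2^-1, a - 2^-1[ `|` `[a - 2^-1, 2^-1[.
  apply/seteqP; split => x; rewrite TorP /= !in_itv /=.
    by move=> /andP[h1 h2]; case: (ltP x (a - 2^-1)) => h; [left|right]; apply/andP; split; lra.
  by move=> [|] /andP[h1 h2]; apply/andP; split; lra.
rewrite E1 E2 !ge0_integral_setU //=; last 4 first.
- exact: measurable_funTS.
- apply/disj_setPS => x [] /=; rewrite !in_itv /= => /andP[h1 h2] /andP[h3 h4]; lra.
- exact: measurable_funTS.
- apply/disj_setPS => x [] /=; rewrite !in_itv /= => /andP[h1 h2] /andP[h3 h4]; lra.
rewrite [LHS]addeC; congr (_ + _)%E.
rewrite (ge0_integral_transl 1) //.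
under eq_integral do rewrite f1.
congr integral.
by apply/seteqP; split => x; rewrite /= !in_itv /= => /andP[h1 h2]; apply/andP; split; lra.
Qed.

Lemma per_nat f (k : nat) x : periodic1 f -> f (x + k%:R) = f x.
Proof.
move=> pf; elim: k => [|k IH]; first by rewrite addr0.
by rewrite -natr1 addrA pf.
Qed.

Lemma per_int f (k : int) x : periodic1 f -> f (x + k%:~R) = f x.
Proof.
move=> pf; case: k => k; first exact: per_nat.
by rewrite NegzE mulrNz -(@per_nat f k.+1) // subrK.
Qed.

Lemma integral_per_shift f a : measurable_fun setT f -> periodic1 f ->
  (\int[mu]_(x in T) (f (x + a))%:E = \int[mu]_(x in T) (f x)%:E)%E.
Proof.
move=> mf pf.
pose b := a - (Num.floor a)%:~R.
have b01 : 0 <= b < 1.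
  have := floor_le_tmp a; have := lt_succ_floor a.
  by rewrite /b intrD; move=> h1 h2; apply/andP; split; lra.
have -> : (\int[mu]_(x in T) (f (x + a))%:E = \int[mu]_(x in T) (f (x + b))%:E)%E.
  apply: eq_integral => x _; rewrite -(@per_int f (Num.floor a) (x + b)) //.
  by rewrite /b addrA subrK.
have mf' : measurable_fun setT (fun x => (f x)%:E) by exact/measurable_EFinP.
rewrite [LHS]integralE [RHS]integralE; congr (_ - _)%E.
  rewrite -(@ge0_per_shift01 (funepos (fun x => (f x)%:E)) b) //.
  - by apply: eq_integral => x _; rewrite !funeposE.
  - exact: measurable_funepos.
  - by move=> x; rewrite !funeposE pf.
rewrite -(@ge0_per_shift01 (funeneg (fun x => (f x)%:E)) b) //.
- by apply: eq_integral => x _; rewrite !funenegE.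
- exact: measurable_funeneg.
- by move=> x; rewrite !funenegE pf.
Qed.

Lemma I_shift f a : measurable_fun setT f -> periodic1 f ->
  I (fun x => f (x + a)) = I f.
Proof. by move=> mf pf; rewrite /I /Rintegral integral_per_shift. Qed.

Lemma measurable_shift f a : measurable_fun setT f ->
  measurable_fun setT (fun x : R => f (x + a)).
Proof. by move=> mf; apply: (measurableT_comp mf); exact: measurable_funD. Qed.

Lemma L1_shift f a : measurable_fun setT f -> periodic1 f -> L1 f ->
  L1 (fun x => f (x + a)).
Proof.
move=> mf pf /integrableP[_ lf]; apply/integrableP; split.
  by apply/measurable_EFinP; apply: measurable_funTS; exact: measurable_shift.
have := @integral_per_shift (fun x => `|f x|) a.
rewrite /= => -> //.
- exact: measurableT_comp.
- by move=> x; rewrite pf.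
Qed.

Lemma ge0_integral_opp (f : R -> \bar R) : measurable_fun setT f ->
  (forall x, 0 <= f x)%E ->
  (\int[mu]_(x in T) f (- x)%R = \int[mu]_(x in T) f x)%E.
Proof.
move=> mf f0.
(* Reflection turns [[-1/2, 1/2)] into [(-1/2, 1/2]], and the end points are null. *)
have -> : (\int[mu]_(x in T) f (- x)%R = \int[mu]_(x in `](- 2^-1)%R, 2^-1%R]) f x)%E.
  rewrite (_ : T = (-%R : _ -> measurableTypeR R) @^-1` `](- 2^-1)%R, 2^-1%R]); last first.
    by apply/seteqP; split => x; rewrite TorP /= in_itv /= => /andP[h1 h2]; apply/andP; split; lra.
  rewrite -ge0_integral_pushforward //=; last exact: measurable_funTS.
  by apply: eq_measure_integral => //= A mA AS; exact: lebesgue_measureN.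
rewrite (@integral_itv_obnd_cbnd _ _ (BRight 2^-1)); last exact: measurable_funTS.
by rewrite -(@integral_itv_bndo_bndc _ (BLeft (- 2^-1))) //; exact: measurable_funTS.
Qed.

Lemma integral_opp f : measurable_fun setT f ->
  (\int[mu]_(x in T) (f (- x))%:E = \int[mu]_(x in T) (f x)%:E)%E.
Proof.
move=> mf; have mf' : measurable_fun setT (fun x => (f x)%:E) by exact/measurable_EFinP.
rewrite [LHS]integralE [RHS]integralE; congr (_ - _)%E.
  by rewrite -(@ge0_integral_opp (funepos (fun x => (f x)%:E))) //; [by apply: eq_integral => x _; rewrite !funeposE|exact: measurable_funepos].
by rewrite -(@ge0_integral_opp (funeneg (fun x => (f x)%:E))) //; [by apply: eq_integral => x _; rewrite !funenegE|exact: measurable_funeneg].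
Qed.

Lemma I_opp f : measurable_fun setT f -> I (fun x => f (- x)) = I f.
Proof. by move=> mf; rewrite /I /Rintegral integral_opp. Qed.

Lemma L1_opp f : measurable_fun setT f -> L1 f -> L1 (fun x => f (- x)).
Proof.
move=> mf /integrableP[_ lf]; apply/integrableP; split.
  by apply/measurable_EFinP; apply: measurable_funTS; exact: measurableT_comp.
have := @integral_opp (fun x => `|f x|).
by rewrite /= => -> //; exact: measurableT_comp.
Qed.

Lemma L1_reflect f a : measurable_fun setT f -> periodic1 f -> L1 f ->
  L1 (fun x => f (a - x)).
Proof.
move=> mf pf lf; have := @L1_opp (fun x => f (x + a)).
have -> : (fun x => f (- x + a)) = (fun x => f (a - x)) by apply/funext => x; rewrite addrC.
by apply; [exact: measurable_shift|exact: L1_shift].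
Qed.

Lemma I_reflect f a : measurable_fun setT f -> periodic1 f ->
  I (fun x => f (a - x)) = I f.
Proof.
move=> mf pf; have := @I_opp (fun x => f (x + a)).
have -> : (fun x => f (- x + a)) = (fun x => f (a - x)) by apply/funext => x; rewrite addrC.
by move=> ->; [exact: I_shift|exact: measurable_shift].
Qed.

(** * Cosines and sines on the torus *)

Definition ck (k : nat) (x : R) := cos (2 * pi * k%:R * x).
Definition sk (k : nat) (x : R) := sin (2 * pi * k%:R * x).

Lemma measurable_ck k D : measurable_fun D (ck k).
Proof.
apply: measurable_funTS; apply: measurableT_comp; last exact: measurable_funM.
by apply: continuous_measurable_fun; exact: continuous_cos.
Qed.

Lemma measurable_sk k D : measurable_fun D (sk k).
Proof.
apply: measurable_funTS; apply: measurableT_comp; last exact: measurable_funM.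
by apply: continuous_measurable_fun; exact: continuous_sin.
Qed.

Lemma ck_le1 k x : `|ck k x| <= 1.
Proof. by rewrite ler_norml cos_geN1 cos_le1. Qed.

Lemma sk_le1 k x : `|sk k x| <= 1.
Proof. by rewrite ler_norml sin_geN1 sin_le1. Qed.

Lemma L1_ck k : L1 (ck k).
Proof. by apply: (@L1_bounded _ 1) => [|x _]; [exact: measurable_ck|exact: ck_le1]. Qed.

Lemma L1_sk k : L1 (sk k).
Proof. by apply: (@L1_bounded _ 1) => [|x _]; [exact: measurable_sk|exact: sk_le1]. Qed.

Lemma L1_mulck k f : L1 f -> L1 (fun x => f x * ck k x).
Proof.
by move=> lf; apply: (@L1_mulb _ _ 1) => // [|x _]; [exact: measurable_ck|exact: ck_le1].
Qed.

Lemma L1_mulsk k f : L1 f -> L1 (fun x => f x * sk k x).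
Proof.
by move=> lf; apply: (@L1_mulb _ _ 1) => // [|x _]; [exact: measurable_sk|exact: sk_le1].
Qed.

Lemma cos_add2pik (k : nat) (x : R) : cos (x + 2 * pi * k%:R) = cos x.
Proof.
elim: k => [|k IH]; first by rewrite mulr0 addr0.
by rewrite -(natr1 k) mulrDr mulr1 addrA [X in cos (_ + X)]mulr_natl cosD2pi.
Qed.

Lemma sin_add2pik (k : nat) (x : R) : sin (x + 2 * pi * k%:R) = sin x.
Proof.
elim: k => [|k IH]; first by rewrite mulr0 addr0.
by rewrite -(natr1 k) mulrDr mulr1 addrA [X in sin (_ + X)]mulr_natl sinD2pi.
Qed.

Lemma ck_per k : periodic1 (ck k).
Proof. by move=> x; rewrite /ck mulrDr mulr1 cos_add2pik. Qed.

Lemma sk_per k : periodic1 (sk k).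
Proof. by move=> x; rewrite /sk mulrDr mulr1 sin_add2pik. Qed.

Lemma ckN k x : ck k (- x) = ck k x.
Proof. by rewrite /ck mulrN cosN. Qed.

Lemma skN k x : sk k (- x) = - sk k x.
Proof. by rewrite /sk mulrN sinN. Qed.

Lemma ckD k x y : ck k (x + y) = ck k x * ck k y - sk k x * sk k y.
Proof. by rewrite /ck mulrDr cosD. Qed.

Lemma skD k x y : sk k (x + y) = sk k x * ck k y + ck k x * sk k y.
Proof. by rewrite /sk mulrDr sinD. Qed.

Lemma ck0 x : ck 0 x = 1.
Proof. by rewrite /ck mulr0 mul0r cos0. Qed.

Lemma sk0 x : sk 0 x = 0.
Proof. by rewrite /sk mulr0 mul0r sin0. Qed.

Lemma ck_sk1 k x : ck k x ^+ 2 + sk k x ^+ 2 = 1.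
Proof. exact: cos2Dsin2. Qed.

Lemma I_odd f : measurable_fun setT f -> L1 f -> (forall x, f (- x) = - f x) -> I f = 0.
Proof.
move=> mf lf fN; have := I_opp mf.
rewrite (_ : (fun x => f (- x)) = fun x => - f x); last exact/funext.
by rewrite IN // => h; lra.
Qed.

Lemma I_sk k : I (sk k) = 0.
Proof. by apply: I_odd => [||x]; [exact: measurable_sk|exact: L1_sk|rewrite skN]. Qed.

Lemma I_ck k : I (ck k) = (k == 0%N)%:R.
Proof.
have [->|k0] := eqVneq k 0%N.
  by rewrite -[RHS](I_cst 1); apply: eq_I => x _; rewrite ck0.
(* Translation by half a wavelength changes the sign of the cosine but not its integral. *)
have := @I_shift (ck k) (2 * k%:R)^-1 (@measurable_ck k setT) (@ck_per k).
rewrite (_ : (fun x => _) = fun x => - ck k x).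
  by rewrite IN; [move=> h /=; lra|exact: L1_ck].
apply/funext => x; rewrite /ck mulrDr.
have -> : 2 * pi * k%:R * (2 * k%:R)^-1 = pi :> R.
  by field; rewrite pnatr_eq0.
by rewrite cosDpi.
Qed.

End TorusIntegral.
#[export] Hint Resolve measurable_Tor measurable_Tor' : core.

(** * Parseval and the entropy bound *)

Section Parseval.
Variable R : realType.
Local Notation C := (R[i]).
Local Notation T := (@Tor R).

Lemma ck_addn a b (x : R) : ck (a + b) x = ck a x * ck b x - sk a x * sk b x.
Proof. by rewrite /ck /sk natrD mulrDr mulrDl cosD. Qed.

Lemma sk_addn a b (x : R) : sk (a + b) x = sk a x * ck b x + ck a x * sk b x.
Proof. by rewrite /ck /sk natrD mulrDr mulrDl sinD. Qed.

Lemma ck_subn a b (x : R) : (b <= a)%N ->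
  ck (a - b) x = ck a x * ck b x + sk a x * sk b x.
Proof.
move=> ba; rewrite -{2 3}(subnK ba) ck_addn sk_addn.
rewrite -[LHS]mulr1 -(ck_sk1 b x); ring.
Qed.

Lemma sk_subn a b (x : R) : (b <= a)%N ->
  sk (a - b) x = sk a x * ck b x - ck a x * sk b x.
Proof.
move=> ba; rewrite -{2 3}(subnK ba) ck_addn sk_addn.
rewrite -[LHS]mulr1 -(ck_sk1 b x); ring.
Qed.

Lemma I_ck_orth a b :
  I (fun x : R => ck a x * ck b x + sk a x * sk b x) = (a == b)%:R.
Proof.
wlog ba : a b / (b <= a)%N => [hw|].
  case/orP: (leq_total a b) => h; last exact: hw.
  by rewrite eq_sym -hw //; apply: eq_I => x _; ring.
rewrite (_ : (fun x => _) = ck (a - b)); last by apply/funext => x; rewrite ck_subn.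
by rewrite I_ck subn_eq0 eqn_leq ba andbT.
Qed.

Lemma I_sk_orth a b :
  I (fun x : R => sk a x * ck b x - ck a x * sk b x) = 0.
Proof.
have main c d : (d <= c)%N -> I (fun x : R => sk c x * ck d x - ck c x * sk d x) = 0.
  move=> dc; rewrite -[RHS](@I_sk R (c - d)).
  by apply: eq_I => x _; rewrite sk_subn.
case/orP: (leq_total b a) => h; first exact: main.
have lb : L1 (fun x : R => sk b x * ck a x - ck b x * sk a x).
  by apply: L1B; [apply: L1_mulck; exact: L1_sk|apply: L1_mulsk; exact: L1_ck].
rewrite -[RHS]oppr0 -(main b a h) -IN //.
by apply: eq_I => x _; ring.
Qed.

Definition epoint (d : nat) (x : R) : C := (ck d x +i* sk d x)%C.

Lemma epoint_exp d k x : epoint d x ^+ k = epoint (d * k) x.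
Proof.
elim: k => [|k IH]; first by rewrite expr0 muln0 /epoint ck0 sk0.
rewrite exprSr IH mulnS addnC /epoint ck_addn sk_addn; simpc.
by congr (_ +i* _)%C; ring.
Qed.

Lemma nsq_sumE L (z : 'I_L -> C) : nsq (\sum_k z k) =
  \sum_k \sum_l (complex.Re (z k) * complex.Re (z l) + complex.Im (z k) * complex.Im (z l)).
Proof.
rewrite /nsq !raddf_sum /= !expr2 !mulr_suml -big_split /=.
by apply: eq_bigr => k _; rewrite !mulr_sumr -big_split.
Qed.

(** For [d > 0] the frequencies [d * k] are distinct, so the exponentials are orthonormal. [L] may
    exceed the size, so that a prescribed coefficient can be included even if it vanishes. *)
Lemma parseval d (P : {poly C}) L : (0 < d)%N -> (size P <= L)%N ->
  L1 (fun x => nsq P.[epoint d x]) /\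
  I (fun x => nsq P.[epoint d x]) = \sum_(k < L) nsq P`_k.
Proof.
move=> d0 sP.
pose A (k l : 'I_L) : R := complex.Re P`_k * complex.Re P`_l + complex.Im P`_k * complex.Im P`_l.
pose B (k l : 'I_L) : R := complex.Re P`_k * complex.Im P`_l - complex.Im P`_k * complex.Re P`_l.
pose c k x : R := ck (d * k) x. pose s k x : R := sk (d * k) x.
have E : (fun x => nsq P.[epoint d x]) = fun x =>
   \sum_k \sum_l (A k l * (c k x * c l x + s k x * s l x) +
                  B k l * (s k x * c l x - c k x * s l x)).
  apply/funext => x; rewrite (horner_coef_wide _ sP) nsq_sumE.
  apply: eq_bigr => k _; apply: eq_bigr => l _.
  rewrite !epoint_exp /epoint /A /B -/(c k x) -/(s k x) -/(c l x) -/(s l x).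
  by case: P`_k => a b; case: P`_l => a' b'; simpc => /=; ring.
have lc k l : L1 (fun x => c k x * c l x + s k x * s l x).
  by apply: L1D; [apply: L1_mulck; exact: L1_ck|apply: L1_mulsk; exact: L1_sk].
have ls k l : L1 (fun x => s k x * c l x - c k x * s l x).
  by apply: L1B; [apply: L1_mulck; exact: L1_sk|apply: L1_mulsk; exact: L1_ck].
have lt k l : L1 (fun x => A k l * (c k x * c l x + s k x * s l x) +
                  B k l * (s k x * c l x - c k x * s l x)).
  by apply: L1D; apply: L1Z.
have lt' k : L1 (fun x => \sum_l (A k l * (c k x * c l x + s k x * s l x) +
                  B k l * (s k x * c l x - c k x * s l x))).
  exact: L1_sum.
rewrite E; split; first exact: L1_sum.
rewrite I_sum //; apply: eq_bigr => k _.
have EI l : I (fun x => A k l * (c k x * c l x + s k x * s l x) +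
    B k l * (s k x * c l x - c k x * s l x)) = A k l * (d * k == d * l)%N%:R.
  rewrite (ID (L1Z _ (lc k l)) (L1Z _ (ls k l))) (IZ _ (lc k l)) (IZ _ (ls k l)).
  by rewrite I_ck_orth I_sk_orth mulr0 addr0.
rewrite I_sum // (bigD1 k) //= big1 ?addr0 => [|l lk].
  by rewrite EI eqxx mulr1 /A /nsq !expr2.
rewrite EI eqn_mul2l (gtn_eqF d0) /= (_ : (k == l :> nat) = false) ?mulr0 //.
by apply/negbTE; rewrite eq_sym.
Qed.

End Parseval.

(** * Entropy and its dual formula *)

Section Entropy.
Variable R : realType.
Local Notation C := (R[i]).
Local Notation T := (@Tor R).
Implicit Types (q f : R -> R).

Lemma dens_ge0 q x : is_density q -> T x -> 0 <= q x.
Proof. by move=> [_ [h _]]; exact: h. Qed.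

Lemma dens_L1 q : is_density q -> L1 q.
Proof. by move=> [_ [_ []]]. Qed.

Lemma dens_I q : is_density q -> I q = 1.
Proof. by move=> [_ [_ []]]. Qed.

Lemma dens_meas q : is_density q -> measurable_fun setT q.
Proof. by case. Qed.

(** Fenchel-Young inequality: [exp] is the convex conjugate of [x ln x - x]. It is [1 + t <= exp t]
    at [t = s - ln x], with equality for [s = ln x]; taking [s = 0] gives [x - 1 <= x ln x]. *)
Lemma xlnx_young (x s : R) : 0 <= x -> x * s + x - expR s <= x * ln x.
Proof.
rewrite le_eqVlt => /predU1P[<-|x0]; first by rewrite !mul0r add0r sub0r oppr_le0 expR_ge0.
have := expR_ge1Dx (s - ln x); rewrite expRD expRN lnK // => h.
have : x * (1 + (s - ln x)) <= expR s.
  by move: h; rewrite -(ler_pM2l x0) (mulrCA x) mulfV ?gt_eqF // mulr1.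
by lra.
Qed.

Lemma measurable_xlnx q D : measurable_fun D q -> measurable_fun D (fun x : R => q x * ln (q x)).
Proof.
move=> mq; apply: measurable_funM => //; exact: measurableT_comp.
Qed.

(** The integrand is at least [q - 1], which is integrable, so its negative part is integrable and
    the entropy is finite or [+oo]. *)
Lemma entropyP q : is_density q ->
  entropy q = +oo%E \/ (L1 (fun x => q x * ln (q x)) /\
    entropy q = (I (fun x => q x * ln (q x)))%:E).
Proof.
move=> dq; pose h (x : R) := q x * ln (q x).
have mh : measurable_fun T h by apply: measurable_xlnx; apply: measurable_funTS; exact: dens_meas.
have lq1 : L1 (fun x => q x - 1) by apply: L1B; [exact: dens_L1|exact: L1_cst].
have hq x : T x -> q x - 1 <= h x.
  by move=> Tx; have := xlnx_young 0 (dens_ge0 dq Tx); rewrite expR0 mulr0 add0r.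
have lg : L1 (fun x => h x - (q x - 1)) \/
   (\int[@lebesgue_measure R]_(x in T) (h x - (q x - 1))%:E = +oo)%E.
  have [fi|] := boolP ((\int[@lebesgue_measure R]_(x in T) (h x - (q x - 1))%:E) < +oo)%E.
    left; apply/integrableP; split.
      by apply/measurable_EFinP; apply: measurable_funB => //; exact: L1_meas.
    rewrite (_ : integral _ _ _ = \int[@lebesgue_measure R]_(x in T) (h x - (q x - 1))%:E)%E //.
    by apply: eq_integral => x /set_mem Tx; rewrite gee0_abs // lee_fin subr_ge0 hq.
  by rewrite -leNgt leye_eq => /eqP ->; right.
have mh' : measurable_fun T (EFin \o h) by exact/measurable_EFinP.
case: lg => [lg|lg]; [right|left].
  have lh : L1 h by have := L1D lg lq1; apply: eq_L1 => x _; rewrite subrK.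
  by split=> //; rewrite EFin_I.
have hneg : (\int[@lebesgue_measure R]_(x in T) (EFin \o h)^\- x < +oo)%E.
  apply: (@le_lt_trans _ _ (\int[@lebesgue_measure R]_(x in T) `|(q x - 1)%:E|)%E).
    apply: ge0_le_integral => //.
    - exact: measurable_funeneg.
    - by apply: measurableT_comp => //; apply/measurable_EFinP; exact: L1_meas.
    - move=> x Tx; rewrite funenegE.
      change (maxe (- h x)%R%:E 0%R%:E <= (`|q x - 1|%R)%:E)%E.
      rewrite -EFin_max lee_fin ge_max normr_ge0 andbT.
      by have := hq _ Tx; have := ler_norm (- (q x - 1)); rewrite normrN; lra.
  by case/integrableP: lq1.
have hpos : (\int[@lebesgue_measure R]_(x in T) (EFin \o h)^\+ x = +oo)%E.
  apply/eqP; rewrite -leye_eq leNgt; apply/negP => hp.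
  have lh : L1 h.
    apply/integrableP; split => //.
    have -> : (\int[@lebesgue_measure R]_(x in T) `|(EFin \o h) x| =
      \int[@lebesgue_measure R]_(x in T) (EFin \o h)^\+ x +
      \int[@lebesgue_measure R]_(x in T) (EFin \o h)^\- x)%E.
      rewrite -ge0_integralD //; [|exact: measurable_funepos|exact: measurable_funeneg].
      by apply: eq_integral => x _; rewrite -[LHS]/((abse \o (EFin \o h)) x) fune_abse.
    exact: lte_add_pinfty.
  have /integrableP[_] : L1 (fun x => h x - (q x - 1)) by exact: L1B.
  apply/negP; rewrite -leNgt -lg le_eqVlt; apply/orP; left; apply/eqP.
  by apply: eq_integral => x /set_mem Tx; rewrite gee0_abs // lee_fin subr_ge0 hq.
rewrite /entropy integralE (_ : integral _ _ (_ ^\+)%E = +oo%E); last exact: hpos.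
by move: hneg; set A := (X in (X < _)%E); change (A < +oo -> +oo - A = +oo)%E; case: A.
Qed.

(** Gibbs variational principle: Young's inequality at [s = f x - ln Z], integrated. The two
    remaining terms cancel because [q] and [expR (f x) / Z] both have mass one. *)
Lemma entropy_dual q f B : is_density q -> L1 (fun x => q x * ln (q x)) ->
  measurable_fun T f -> (forall x, T x -> `|f x| <= B) ->
  L1 (fun x => expR (f x)) /\ 0 < I (fun x => expR (f x)) /\
  I (fun x => q x * f x) - ln (I (fun x => expR (f x))) <= I (fun x => q x * ln (q x)).
Proof.
move=> dq le mf fB.
have me : measurable_fun T (fun x => expR (f x)) by exact: measurableT_comp.
have bf x : T x -> - B <= f x <= B by move=> Tx; rewrite -ler_norml fB.
have lexp : L1 (fun x => expR (f x)).
  apply: (@L1_bounded _ _ (expR B)) => // x Tx.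
  by rewrite ger0_norm ?expR_ge0 // ler_expR; case/andP: (bf _ Tx).
have Z0 : 0 < I (fun x => expR (f x)).
  apply: (@lt_le_trans _ _ (I (fun=> expR (- B)))); first by rewrite I_cst expR_gt0.
  by apply: I_le => // [|x Tx]; [exact: L1_cst|rewrite ler_expR; case/andP: (bf _ Tx)].
split=> //; split=> //; set Z := I _ in Z0 *.
have lqf : L1 (fun x => q x * f x) by apply: (@L1_mulb _ _ _ B) => //; exact: dens_L1.
have lz : L1 (fun x => (Z^-1) * expR (f x)) by exact: L1Z.
have lq := dens_L1 dq.
have lzq : L1 (fun x => ln Z * q x) by exact: L1Z.
have H : I (fun x => (q x * f x - ln Z * q x) + (q x - Z^-1 * expR (f x))) <=
    I (fun x => q x * ln (q x)).
  apply: I_le => // [|x Tx].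
    by apply: L1D; apply: L1B.
  have := xlnx_young (f x - ln Z) (dens_ge0 dq Tx).
  by rewrite expRD expRN lnK // (mulrC (expR _)); lra.
move: H; rewrite ID; [|exact: L1B|exact: L1B].
rewrite !IB // !IZ // (dens_I dq) -/Z mulVf ?gt_eqF //; lra.
Qed.

End Entropy.

(** * Entropy against the weighted Fourier sum *)

Section MilinDual.
Variable R : realType.
Local Notation C := (R[i]).
Local Notation T := (@Tor R).
Variables (d : nat) (d0 : (0 < d)%N) (q : R -> R).
Hypothesis dq : is_density q.
Hypothesis lq : L1 (fun x => q x * ln (q x)).
Let E := I (fun x => q x * ln (q x)).

(** The integral of [q] against [exp (2 pi i d m x)], that is the conjugate of the usual Fourier
    coefficient at [d m]. *)
Definition ucoef (d : nat) (q : R -> R) (m : nat) : C :=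
  (I (fun x => q x * ck (d * m) x) +i* I (fun x => q x * sk (d * m) x))%C.
Local Notation u := (ucoef d q).

(* [2 Re hpoly (e^{2 pi i d x})] is the (truncated) potential whose Gibbs density is extremal. *)
Definition hpoly N : {poly C} := \poly_(k < N.+1) (((u k)^*)%C / k%:R).

(** The constant term is the conjugate of [u 0] divided by [0]; the convention [0^-1 = 0] makes it
    vanish although [u 0 = 1]. *)
Lemma hpoly0 N : (hpoly N)`_0 = 0.
Proof. by rewrite coef_poly /= invr0 mulr0. Qed.

Lemma hpolyS N j : (j < N)%N -> j.+1%:R * (hpoly N)`_j.+1 = ((u j.+1)^*)%C.
Proof.
move=> jN; rewrite coef_poly ltnS jN mulrCA mulfV ?mulr1 // pnatr_eq0.
Qed.

Definition usum N : R := \sum_(j < N) nsq (u j.+1) / j.+1%:R.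

Let nsqV (k : nat) : nsq (k%:R^-1 : C) = (k%:R^-1) ^+ 2.
Proof. by rewrite -(nsq_real (k%:R^-1)); congr nsq; rewrite fmorphV rmorph_nat. Qed.

Let nsqc (z : C) : nsq (z^*)%C = nsq z.
Proof. by case: z => a b; rewrite /nsq /= sqrrN. Qed.

Lemma energy_hpoly N : \sum_(j < size (hpoly N)) j%:R * nsq (hpoly N)`_j = usum N.
Proof.
transitivity (\sum_(j < N.+1) j%:R * nsq (hpoly N)`_j).
  rewrite -(subnKC (size_poly _ _ : (size (hpoly N) <= N.+1)%N)) big_split_ord /=.
  rewrite [X in _ + X]big1 ?addr0 // => j _.
  by rewrite nth_default ?leq_addr // /nsq /= expr0n addr0 mulr0.
rewrite big_ord_recl mul0r add0r; apply: eq_bigr => j _ /=.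
rewrite /bump /= add1n coef_poly ltnS ltn_ord nsqM nsqV nsqc.
by field; rewrite ?(addrC 1) ?natr1 ?nat1r pnatr_eq0.
Qed.

Lemma horner_hpoly N (z : C) :
  (hpoly N).[z] = \sum_(j < N) ((u j.+1)^*)%C / j.+1%:R * z ^+ j.+1.
Proof.
rewrite horner_poly big_ord_recl [X in X + _](_ : _ = 0) ?add0r //.
by rewrite invr0 mulr0 mul0r.
Qed.

Definition fpot N (x : R) : R := 2 * complex.Re (hpoly N).[epoint d x].

Lemma fpotE N x : fpot N x = \sum_(j < N)
  (2 / j.+1%:R) * (I (fun x => q x * ck (d * j.+1) x) * ck (d * j.+1) x +
                   I (fun x => q x * sk (d * j.+1) x) * sk (d * j.+1) x).
Proof.
rewrite /fpot horner_hpoly raddf_sum mulr_sumr.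
apply: eq_bigr => j _; rewrite epoint_exp /ucoef /epoint /=.
rewrite (_ : (j.+1%:R : C)^-1 = ((j.+1%:R^-1)%:C)%C); last first.
  by rewrite fmorphV rmorph_nat.
by simpc => /=; ring.
Qed.

Lemma measurable_fpot N D : measurable_fun D (fpot N).
Proof.
rewrite (_ : fpot N = fun x => \sum_(j < N)
  (2 / j.+1%:R) * (I (fun x => q x * ck (d * j.+1) x) * ck (d * j.+1) x +
                   I (fun x => q x * sk (d * j.+1) x) * sk (d * j.+1) x)); last first.
  by apply/funext => x; rewrite fpotE.
apply: measurable_sum => j; apply: measurable_funM => //; apply: measurable_funD;
  apply: measurable_funM => //; [exact: measurable_ck|exact: measurable_sk].
Qed.

Lemma nsq_epoint (x : R) : nsq (epoint d x) = 1.
Proof. exact: ck_sk1. Qed.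

Lemma hpoly_bounded N : exists2 r : R, 0 <= r &
  forall x, nsq (hpoly N).[epoint d x] <= r ^+ 2.
Proof.
pose nc (z : C) : R := Num.sqrt (nsq z).
have ncE (z : C) : `|z| = ((nc z)%:C)%C.
  apply/eqP; rewrite -(@eqrXn2 _ 2) ?normr_ge0 //; last by rewrite ler0c sqrtr_ge0.
  by rewrite normc_nsq -rmorphXn /= sqr_sqrtr ?nsq_ge0.
exists (\sum_(k < size (hpoly N)) nc (hpoly N)`_k).
  by apply: sumr_ge0 => k _; exact: sqrtr_ge0.
move=> x; rewrite -lecR -normc_nsq rmorphXn /= lerXn2r ?nnegrE //.
  by rewrite ler0c; apply: sumr_ge0 => k _; exact: sqrtr_ge0.
rewrite horner_coef rmorph_sum /= (le_trans (ler_norm_sum _ _ _)) //.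
apply: ler_sum => k _; rewrite normrM normrX -ncE.
suff -> : `|epoint d x| = 1 by rewrite expr1n mulr1.
by rewrite ncE /nc nsq_epoint sqrtr1.
Qed.

Lemma fpot_bounded N : exists B, forall x, `|fpot N x| <= B.
Proof.
have [r r0 h] := hpoly_bounded N; exists (2 * r) => x.
rewrite /fpot normrM ger0_norm // ler_pM2l //.
rewrite -(@ler_pXn2r _ 2) ?nnegrE // real_normK ?num_real //.
by rewrite (le_trans _ (h x)) // /nsq lerDl sqr_ge0.
Qed.

(** The factor [2] comes from [2 Re]. One [usum N] will be spent on the logarithm of the partition
    function, the other is the entropy bound. *)
Lemma I_fpot N : I (fun x => q x * fpot N x) = 2 * usum N.
Proof.
have lq1 := dens_L1 dq.
pose a j : R := I (fun x => q x * ck (d * j.+1) x).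
pose b j : R := I (fun x => q x * sk (d * j.+1) x).
transitivity (I (fun x => \sum_(j < N) (2 / j.+1%:R) *
   (a j * (q x * ck (d * j.+1) x) + b j * (q x * sk (d * j.+1) x)))).
  by apply: eq_I => x _; rewrite fpotE mulr_sumr; apply: eq_bigr => j _; rewrite /a /b; ring.
have lc j : L1 (fun x => q x * ck (d * j.+1) x) by exact: L1_mulck.
have ls j : L1 (fun x => q x * sk (d * j.+1) x) by exact: L1_mulsk.
have lcs j : L1 (fun x => a j * (q x * ck (d * j.+1) x) + b j * (q x * sk (d * j.+1) x)).
  by apply: L1D; apply: L1Z.
rewrite I_sum => [|j _]; last exact: L1Z.
rewrite /usum mulr_sumr; apply: eq_bigr => j _.
rewrite IZ // ID ?IZ //; [|exact: L1Z|exact: L1Z].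
by rewrite /nsq /= -/(a j) -/(b j); ring.
Qed.

(** [expR (fpot N x)] is [|exp h|^2]; Parseval turns its integral into the sum bounded by
    Lebedev-Milin. The remainder is required to be at least [dl] for all orders [M >= M0], so that
    it survives the limit in [M]. *)
Lemma I_exp_fpot N k (a b : 'I_k.+1) (dl : R) M0 :
  (forall M, (M0 <= M)%N -> dl <= nsq (milin_term (hpoly N) M k a -
     milin_term (hpoly N) M k b) / k.+1%:R ^+ 2) ->
  I (fun x => expR (fpot N x)) <= expR (usum N) - dl.
Proof.
move=> hdl; have [r r0 hr] := hpoly_bounded N; have [B hB] := fpot_bounded N.
pose eta M : R := expT M r * expT M r - expT M (2 * r) + (expR (2 * r) - expT M (2 * r)).
have le : L1 (fun x => expR (fpot N x)).
  by have [] := entropy_dual dq lq (@measurable_fpot N T) (fun x _ => hB x).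
have main M : (M0 <= M)%N -> I (fun x => expR (fpot N x)) <= expR (usum N) - dl + eta M.+1.
  move=> M0M.
  pose L := maxn k.+2 (size (pexp M.+1 (hpoly N))).
  have [lp Ep] := @parseval R d (pexp M.+1 (hpoly N)) L d0 (leq_maxr _ _).
  have kL : (k.+1 < L)%N by rewrite /L leq_max leqnn.
  have := @lebedev_milin R (hpoly N) (hpoly0 N) M k a b L kL.
  rewrite energy_hpoly -Ep => h1; have h2 := hdl _ M0M.
  apply: (@le_trans _ _ (I (fun x => nsq (pexp M.+1 (hpoly N)).[epoint d x] + eta M.+1))).
    apply: I_le => // [|x _]; first by apply: L1D => //; exact: L1_cst.
    by rewrite horner_pexp /fpot; exact: expR_nsq_expT.
  rewrite (ID lp (L1_cst _)) I_cst.
  by move: h1 h2; move: (nsq _ / _) => D h1 h2; lra.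
have ceta : (fun M => expR (usum N) - dl + eta M.+1) @ \oo --> expR (usum N) - dl.
  rewrite -[X in _ --> X]addr0; apply: cvgD; first exact: cvg_cst.
  have : eta M @[M --> \oo] --> (0 : R).
    rewrite (_ : 0 = expR r * expR r - expR (2 * r) + (expR (2 * r) - expR (2 * r))).
      rewrite /eta; apply: cvgD; apply: cvgB; [|exact: cvg_expT|exact: cvg_cst|exact: cvg_expT].
      by apply: cvgM; exact: cvg_expT.
    by rewrite mulr_natl mulr2n expRD; ring.
  by move=> h; rewrite cvg_shiftS.
rewrite -(cvg_lim _ ceta) //; apply: limr_ge; first by apply/cvg_ex; eexists; exact: ceta.
by exists M0 => // M /= /main.
Qed.

Lemma entropy_milin_defect N k (a b : 'I_k.+1) (dl : R) M0 :
  (forall M, (M0 <= M)%N -> dl <= nsq (milin_term (hpoly N) M k a -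
     milin_term (hpoly N) M k b) / k.+1%:R ^+ 2) ->
  usum N + dl * expR (- usum N) <= E.
Proof.
move=> hdl; have h1 := I_exp_fpot hdl; have [B hB] := fpot_bounded N.
have [_ [Z0 h2]] := entropy_dual dq lq (@measurable_fpot N T) (fun x _ => hB x).
apply: le_trans h2; rewrite I_fpot.
set Z := I _ in Z0 h1 *.
(* With [U = usum N]: [ln Z <= ln (exp U - dl) = U + ln (1 - dl exp (-U)) <= U - dl exp (-U)]. *)
suff : ln Z <= usum N - dl * expR (- usum N) by lra.
have e0 := expR_gt0 (usum N).
have -> : ln Z = usum N + ln (Z * expR (- usum N)).
  by rewrite lnM ?posrE ?expR_gt0 // expRK; ring.
rewrite lerD2l.
have h3 : Z * expR (- usum N) <= 1 - dl * expR (- usum N).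
  rewrite expRN -(ler_pM2r e0) mulrBl -!mulrA mulVf ?gt_eqF //; lra.
have z0 : 0 < Z * expR (- usum N) by rewrite mulr_gt0 ?expR_gt0.
have := @le_ln1Dx R (Z * expR (- usum N) - 1).
rewrite (_ : 1 + (Z * expR (- usum N) - 1) = Z * expR (- usum N)); last by ring.
by move=> /(_ _) h4; have := h4; lra.
Qed.

Lemma entropy_milin N : usum N <= E.
Proof.
have := @entropy_milin_defect N 0 ord0 ord0 0 0; rewrite mul0r addr0; apply => M _.
by rewrite subrr /nsq /= expr0n addr0 mul0r.
Qed.

(* At equality every Cauchy-Schwarz step of Lebedev-Milin is an equality, so the
   Fourier coefficients form a geometric progression (Poisson kernels). *)
Lemma entropy_milin_eq :
  (forall e, 0 < e -> exists N0, forall N, (N0 <= N)%N -> E - e <= usum N) ->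
  forall k, u k.+1 = u 1 ^+ k.+1.
Proof.
move=> hlim k.
elim: k {-2}k (leqnn k) => [|k IH] m mk.
  by rewrite leqn0 in mk; rewrite (eqP mk) expr1.
have [->|mk'] := eqVneq m k.+1; last by apply: IH; rewrite -ltnS ltn_neqAle mk'.
have {}IH j : (j <= k)%N -> ((u j.+1)^*)%C = ((u 1)^*)%C ^+ j.+1.
  by move=> jk; rewrite IH // rmorphXn.
set v := ((u 1)^*)%C in IH.
(* When the first [k+1] Fourier coefficients are geometric, [h] agrees with [- log (1 - v z)] to
   order [k+1], so its exponential has the coefficients of [1 / (1 - v z)] to that order. *)
have coefv N i M : (k < N)%N -> (i <= k.+1)%N -> (i <= M)%N -> (pexp M (hpoly N))`_i = v ^+ i.
  move=> kN; elim: i {-2}i (leqnn i) M => [|i IHi] j ji M jk jM.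
    by rewrite leqn0 in ji; rewrite (eqP ji) expr0 pexp_coef0 // hpoly0.
  case: j ji jk jM => [|j] ji jk jM; first by rewrite expr0 pexp_coef0 // hpoly0.
  case: M jM => [//|M] jM.
  have : j.+1%:R * (pexp M.+1 (hpoly N))`_j.+1 = j.+1%:R * v ^+ j.+1.
    rewrite pexp_coefS.
    transitivity (\sum_(l < j.+1) v ^+ j.+1); last by rewrite sumr_const card_ord mulr_natl.
    apply: eq_bigr => l _; have lj : (l <= j)%N by rewrite -ltnS.
    have jk' : (j <= k)%N by [].
    rewrite hpolyS ?(leq_ltn_trans _ kN) ?(leq_trans lj) // IH ?(leq_trans lj) //.
    rewrite IHi ?(leq_trans (leq_subr _ _)) //; last by rewrite ltnW.
    by rewrite -exprD addSn subnKC.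
  by apply: mulfI; rewrite pnatr_eq0.
(* The first and the last term of the recursion for the coefficient [k+2]: [h_1 c_(k+1) = v^(k+2)]
   against [(k+2) h_(k+2) c_0], the conjugate of [u (k+2)]. Equality of the two is the next step of
   the geometric progression. *)
pose dl : R := nsq (v ^+ k.+2 - ((u k.+2)^*)%C) / k.+2%:R ^+ 2.
have dl0 : 0 <= dl by rewrite divr_ge0 ?nsq_ge0 ?exprn_ge0.
have hS N : (k.+2 <= N)%N -> usum N + dl * expR (- usum N) <= E.
  move=> kN; apply: (@entropy_milin_defect N k.+1 ord0 ord_max dl k.+2) => M kM.
  rewrite /milin_term /= subn0 subnn hpolyS ?(leq_trans _ kN) // hpolyS //.
  rewrite !coefv ?leqnn ?(leq_trans _ kM) ?(leq_trans _ kN) // IH // expr1 expr0 mulr1.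
  by rewrite -exprS.
(* [usum N <= E] bounds the factor [expR (- usum N)] below independently of [N], so the remainder
   cannot fade as [N] grows. *)
have : dl * expR (- E) <= 0.
  apply/ler_addgt0Pr => e /hlim[N0 hN0].
  pose N := maxn N0 k.+2.
  have := hS N (leq_maxr _ _); have := hN0 N (leq_maxl _ _).
  have : dl * expR (- E) <= dl * expR (- usum N).
    by rewrite ler_wpM2l // ler_expR lerN2 entropy_milin.
  lra.
rewrite pmulr_lle0 ?expR_gt0 // => dl1.
have /eqP : dl = 0 by apply/eqP; rewrite eq_le dl1.
rewrite mulf_eq0 invr_eq0 expf_eq0 /= pnatr_eq0 orbF => /eqP /nsq_eq0 /eqP.
rewrite subr_eq0 => /eqP h.
by apply: (can_inj (@conjcK R)); rewrite rmorphXn -/v h.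
Qed.

End MilinDual.

(** * Double integrals and convolution *)

Section ProductTorus.
Variable R : realType.
Local Notation mu := (@lebesgue_measure R).
Local Notation T := (@Tor R).
Local Notation RR := (measurableTypeR R * measurableTypeR R)%type.
Local Notation mu2 := (mu \x mu)%E.
Local Notation T2 := (T `*` T).
Implicit Types (F : R -> R -> R).

Definition meas2 F := measurable_fun (setT : set RR) (fun z : RR => F z.1 z.2).
Definition L12 F := mu2.-integrable (T2 : set RR) (fun z => (F z.1 z.2)%:E).
Definition I2 F : R := fine (\int[mu2]_(z in T2) (F z.1 z.2)%:E)%E.

Lemma measurable_T2 : measurable (T2 : set RR).
Proof. exact: measurableX. Qed.
Hint Resolve measurable_T2 : core.

Let restr (G : RR -> \bar R) x : (fun y => (G \_ T2) (x, y)) =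
  if x \in T then (fun y => G (x, y)) \_ T else cst 0%E.
Proof.
apply/funext => y; rewrite !patchE.
have -> : ((x, y) \in T2) = (x \in T) && (y \in T).
  by apply/idP/andP; rewrite !inE.
by case: (x \in T) => //=; rewrite patchE.
Qed.

Let restr' (G : RR -> \bar R) y : (fun x => (G \_ T2) (x, y)) =
  if y \in T then (fun x => G (x, y)) \_ T else cst 0%E.
Proof.
apply/funext => x; rewrite !patchE.
have -> : ((x, y) \in T2) = (x \in T) && (y \in T).
  by apply/idP/andP; rewrite !inE.
by case: (y \in T) => //=; rewrite ?andbT ?andbF // patchE.
Qed.

Let integral_restr (G : RR -> \bar R) :
  (\int[mu]_x \int[mu]_y (G \_ T2) (x, y) = \int[mu]_(x in T) \int[mu]_(y in T) G (x, y))%E.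
Proof.
rewrite [RHS]integral_mkcond; apply: eq_integral => x _; rewrite restr patchE.
by case: ifP => xT; [rewrite [RHS]integral_mkcond|rewrite integral0].
Qed.

Let integral_restr' (G : RR -> \bar R) :
  (\int[mu]_y \int[mu]_x (G \_ T2) (x, y) = \int[mu]_(y in T) \int[mu]_(x in T) G (x, y))%E.
Proof.
rewrite [RHS]integral_mkcond; apply: eq_integral => x _; rewrite restr' patchE.
by case: ifP => xT; [rewrite [RHS]integral_mkcond|rewrite integral0].
Qed.

Lemma tonelli_T (G : RR -> \bar R) : measurable_fun setT G -> (forall z, 0 <= G z)%E ->
  (\int[mu2]_(z in T2) G z = \int[mu]_(x in T) \int[mu]_(y in T) G (x, y))%E.
Proof.
move=> mG G0; rewrite integral_mkcond fubini_tonelli1; first exact: integral_restr.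
  by apply/(measurable_restrictT _ _).1 => //; exact: measurable_funTS.
by move=> z; rewrite patchE; case: ifP.
Qed.

Lemma tonelli_T' (G : RR -> \bar R) : measurable_fun setT G -> (forall z, 0 <= G z)%E ->
  (\int[mu2]_(z in T2) G z = \int[mu]_(y in T) \int[mu]_(x in T) G (x, y))%E.
Proof.
move=> mG G0; rewrite integral_mkcond fubini_tonelli2; first exact: integral_restr'.
  by apply/(measurable_restrictT _ _).1 => //; exact: measurable_funTS.
by move=> z; rewrite patchE; case: ifP.
Qed.

Let measE F : meas2 F -> measurable_fun setT (fun z : RR => `|(F z.1 z.2)%:E|%E).
Proof. by move=> mF; apply: measurableT_comp => //; exact/measurable_EFinP. Qed.

Lemma measurable_inner (G : RR -> \bar R) : measurable_fun setT G -> (forall z, 0 <= G z)%E ->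
  measurable_fun T (fun x => \int[mu]_(y in T) G (x, y))%E.
Proof.
move=> mG G0; have m : measurable_fun setT (G \_ T2).
  by apply/(measurable_restrictT _ _).1 => //; exact: measurable_funTS.
have := @measurable_fun_fubini_tonelli_F _ _ _ _ _ mu (G \_ T2) m.
rewrite /fubini_F => h; apply: (eq_measurable_fun (fun x => \int[mu]_y (G \_ T2) (x, y))%E).
  by move=> x xT; rewrite restr xT -integral_mkcond.
by apply: measurable_funTS; apply: h => z; rewrite patchE; case: ifP.
Qed.

Lemma measurable_inner' (G : RR -> \bar R) : measurable_fun setT G -> (forall z, 0 <= G z)%E ->
  measurable_fun T (fun y => \int[mu]_(x in T) G (x, y))%E.
Proof.
move=> mG G0; have m : measurable_fun setT (G \_ T2).
  by apply/(measurable_restrictT _ _).1 => //; exact: measurable_funTS.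
have := @measurable_fun_fubini_tonelli_G _ _ _ _ _ mu (G \_ T2) m.
rewrite /fubini_G => h; apply: (eq_measurable_fun (fun y => \int[mu]_x (G \_ T2) (x, y))%E).
  by move=> x xT; rewrite restr' xT -integral_mkcond.
by apply: measurable_funTS; apply: h => z; rewrite patchE; case: ifP.
Qed.

(** Tonelli for [|F|]: integrability follows from an integrable bound on the norms of the sections.
    The primed version uses the other sections. *)
Lemma L12_bound F (g : R -> R) : meas2 F -> (forall x, T x -> L1 (F x)) -> L1 g ->
  (forall x, T x -> I (fun y => `|F x y|) <= g x) -> L12 F.
Proof.
move=> mF lF lg Fg; apply/integrableP; split.
  by apply: measurable_funTS; exact/measurable_EFinP.
rewrite (tonelli_T (measE mF)) //=.
have h x : T x -> (\int[mu]_(y in T) `|F x y|%:E = (I (fun y => `|F x y|))%:E)%E.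
  by move=> Tx; rewrite EFin_I //; exact/L1_norm/lF.
apply: (@le_lt_trans _ _ (\int[mu]_(x in T) `|(g x)%:E|)%E); last first.
  by case/integrableP: lg.
apply: ge0_le_integral.
- exact: measurable_Tor.
- by move=> x Tx; exact: integral_ge0.
- exact: (measurable_inner (measE mF)).
- by apply: measurableT_comp => //; apply/measurable_EFinP; exact: L1_meas.
- by move=> x Tx /=; rewrite h // lee_fin (le_trans (Fg _ Tx)) // ler_norm.
Qed.

Lemma L12_bound' F (g : R -> R) : meas2 F -> (forall y, T y -> L1 (F^~ y)) -> L1 g ->
  (forall y, T y -> I (fun x => `|F x y|) <= g y) -> L12 F.
Proof.
move=> mF lF lg Fg; apply/integrableP; split.
  by apply: measurable_funTS; exact/measurable_EFinP.
rewrite (tonelli_T' (measE mF)) //=.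
have h y : T y -> (\int[mu]_(x in T) `|F x y|%:E = (I (fun x => `|F x y|))%:E)%E.
  by move=> Ty; rewrite EFin_I //; exact/L1_norm/(lF y).
apply: (@le_lt_trans _ _ (\int[mu]_(x in T) `|(g x)%:E|)%E); last first.
  by case/integrableP: lg.
apply: ge0_le_integral.
- exact: measurable_Tor.
- by move=> x Tx; exact: integral_ge0.
- exact: (measurable_inner' (measE mF)).
- by apply: measurableT_comp => //; apply/measurable_EFinP; exact: L1_meas.
- by move=> x Tx /=; rewrite h // lee_fin (le_trans (Fg _ Tx)) // ler_norm.
Qed.

Lemma EFin_I2 F : L12 F -> (I2 F)%:E = (\int[mu2]_(z in T2) (F z.1 z.2)%:E)%E.
Proof. by move=> lF; rewrite /I2 fineK //; exact: integrable_fin_num. Qed.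

Lemma I2E F : L12 F -> (forall x, T x -> L1 (F x)) ->
  L1 (fun x => I (F x)) /\ I2 F = I (fun x => I (F x)).
Proof.
move=> lF lx; pose G (z : RR) := (F z.1 z.2)%:E.
have lG : mu2.-integrable setT (G \_ T2).
  exact: ((integrable_mkcond G measurable_T2).1 lF).
have E : fubini_F mu (G \_ T2) = (fun x => (I (F x))%:E) \_ T.
  apply/funext => x; rewrite /fubini_F restr patchE; case: ifP => [xT|_].
    by rewrite -integral_mkcond EFin_I //; apply: lx; exact: set_mem.
  by rewrite integral0.
have l : mu.-integrable setT ((fun x => (I (F x))%:E) \_ T).
  by rewrite -E; exact: (integrable_fubini_F lG).
split.
  suff : mu.-integrable T (fun x => (I (F x))%:E) by [].
  have H := @integrable_mkcond _ _ R mu T (fun x => (I (F x))%:E) (@measurable_Tor R).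
  exact: H.2 l.
rewrite /I2 integral_mkcond -(integral12_prod_meas1 lG) /I /Rintegral.
congr fine; rewrite [RHS]integral_mkcond; apply: eq_integral => x _.
exact: (congr1 (fun h => h x) E).
Qed.

Lemma I2E' F : L12 F -> (forall y, T y -> L1 (F^~ y)) ->
  I2 F = I (fun y => I (F^~ y)).
Proof.
move=> lF lx; pose G (z : RR) := (F z.1 z.2)%:E.
have lG : mu2.-integrable setT (G \_ T2).
  exact: ((integrable_mkcond G measurable_T2).1 lF).
have E : fubini_G mu (G \_ T2) = (fun y => (I (F^~ y))%:E) \_ T.
  apply/funext => x; rewrite /fubini_G restr' patchE; case: ifP => [xT|_].
    by rewrite -integral_mkcond EFin_I //; apply: (lx x); exact: set_mem.
  by rewrite integral0.
rewrite /I2 integral_mkcond -(integral21_prod_meas1 lG) /I /Rintegral.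
congr fine; rewrite [RHS]integral_mkcond; apply: eq_integral => x _.
exact: (congr1 (fun h => h x) E).
Qed.

Lemma I2_swap F : L12 F -> (forall x, T x -> L1 (F x)) -> (forall y, T y -> L1 (F^~ y)) ->
  I (fun x => I (F x)) = I (fun y => I (F^~ y)).
Proof. by move=> lF l1 l2; rewrite -(I2E lF l1).2 -(I2E' lF l2). Qed.

Lemma L12B F G : L12 F -> L12 G -> L12 (fun x y => F x y - G x y).
Proof.
move=> lF lG; have := integrableB measurable_T2 lF lG.
by apply: eq_integrable => // z _; rewrite EFinB.
Qed.

Lemma I2B F G : L12 F -> L12 G -> I2 (fun x y => F x y - G x y) = I2 F - I2 G.
Proof.
move=> lF lG; apply: EFin_inj; rewrite EFinB !EFin_I2 //; last exact: L12B.
rewrite -integralB //; apply: eq_integral => z _; exact: EFinB.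
Qed.

End ProductTorus.
#[export] Hint Resolve measurable_T2 : core.

(** * Interaction with an integrable potential *)

Section Convolution.
Variable R : realType.
Local Notation T := (@Tor R).
Variables (W : R -> R).
Hypotheses (mW : measurable_fun setT W) (pW : periodic1 W) (lW : L1 W).
Implicit Types (p r : R -> R).

Lemma meas2_conv p r : measurable_fun setT p -> measurable_fun setT r ->
  meas2 (fun x y => W (x - y) * p x * r y).
Proof.
move=> mp mr; apply: measurable_funM; first apply: measurable_funM.
- apply: measurableT_comp => //; apply: measurable_funB; first exact: measurable_fst.
  exact: measurable_snd.
- by apply: measurableT_comp => //; exact: measurable_fst.
- by apply: measurableT_comp => //; exact: measurable_snd.
Qed.

Lemma L1_conv r M x : measurable_fun setT r -> (forall y, T y -> `|r y| <= M) ->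
  L1 (fun y => W (x - y) * r y).
Proof.
move=> mr rM; apply: (@L1_mulb _ _ _ M) => //; first exact: L1_reflect.
exact: measurable_funTS.
Qed.

Lemma I_conv_bound r M x : measurable_fun setT r -> (forall y, T y -> `|r y| <= M) ->
  I (fun y => `|W (x - y) * r y|) <= M * I (fun y => `|W y|).
Proof.
move=> mr rM; have lc := L1_conv x mr rM.
have lWn : L1 (fun y => `|W (x - y)|) by apply: L1_norm; exact: L1_reflect.
have -> : I (fun y => `|W y|) = I (fun y => `|W (x - y)|).
  apply/esym/(@I_reflect _ (fun y => `|W y|)); first exact: measurableT_comp.
  by move=> y; rewrite pW.
rewrite -IZ //; apply: I_le; [exact: L1_norm|exact: L1Z|].
by move=> y Ty; rewrite normrM mulrC ler_wpM2r // rM.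
Qed.

Lemma L12_conv p r M : measurable_fun setT p -> L1 p -> measurable_fun setT r ->
  (forall y, T y -> `|r y| <= M) -> L12 (fun x y => W (x - y) * p x * r y).
Proof.
move=> mp lp mr rM.
have E x : (fun y => W (x - y) * p x * r y) = fun y => p x * (W (x - y) * r y).
  by apply/funext => y; ring.
apply: (@L12_bound _ _ (fun x => M * I (fun y => `|W y|) * `|p x|)).
- exact: meas2_conv.
- by move=> x Tx; rewrite E; apply: L1Z; exact: L1_conv rM.
- by apply: L1Z; exact: L1_norm.
- move=> x Tx.
  have -> : (fun y => `|W (x - y) * p x * r y|) = fun y => `|p x| * `|W (x - y) * r y|.
    by apply/funext => y; rewrite -normrM; congr `|_|; ring.
  rewrite IZ; last by apply: L1_norm; exact: L1_conv rM.
  by rewrite mulrC ler_wpM2r //; exact: I_conv_bound.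
Qed.

(** Only one density is bounded: the energy is then L1-continuous in the other one, although [W]
    itself is merely integrable. *)
Lemma I2_conv_bound p r M : measurable_fun setT p -> L1 p -> measurable_fun setT r ->
  (forall y, T y -> `|r y| <= M) ->
  `|I2 (fun x y => W (x - y) * p x * r y)| <= M * I (fun y => `|W y|) * I (fun x => `|p x|).
Proof.
move=> mp lp mr rM.
have E x : (fun y => W (x - y) * p x * r y) = fun y => p x * (W (x - y) * r y).
  by apply/funext => y; ring.
have lc x := L1_conv x mr rM.
have [l ->] := @I2E _ _ (L12_conv mp lp mr rM) (fun x _ => (eq_ind_r (fun h => L1 h) (L1Z (p x) (lc x)) (E x))).
apply: (le_trans (I_norm l)); rewrite -IZ; last exact: L1_norm.
apply: I_le; [exact: L1_norm|by apply: L1Z; exact: L1_norm|].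
move=> x Tx; rewrite E IZ // normrM mulrC ler_wpM2r //.
by rewrite (le_trans (I_norm (lc x))) //; exact: I_conv_bound.
Qed.

End Convolution.

(** * Fejer means *)

Section Fejer.
Variable R : realType.
Local Notation C := (R[i]).
Local Notation T := (@Tor R).
Implicit Types (f g : R -> R).

Definition rho (N k : nat) : R := 1 - k%:R / N.+1%:R.
Definition FK (N : nat) (t : R) : R := 1 + 2 * \sum_(k < N) rho N k.+1 * ck k.+1 t.

Lemma FK_sum N t : N.+1%:R * FK N t =
  N.+1%:R + 2 * \sum_(k < N.+1) (N%:R - k%:R) * ck k.+1 t.
Proof.
rewrite big_ord_recr /= subrr mul0r addr0 /FK mulrDr mulr1 mulrCA mulr_sumr.
congr (_ + 2 * _); apply: eq_bigr => k _; rewrite mulrA; congr (_ * _).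
by rewrite /rho mulrBr mulr1 mulrCA mulfV ?pnatr_eq0 // mulr1 -!natr1; ring.
Qed.

(** The Fejer kernel as a squared modulus, which gives its positivity; the induction adds one unit
    vector to the sum at a time. *)
Lemma FK_nsq N t : N.+1%:R * FK N t = nsq (\sum_(k < N.+1) epoint 1 t ^+ k).
Proof.
elim: N => [|N IH].
  rewrite big_ord1 expr0 /FK big_ord0 mulr0 addr0 mulr1.
  by rewrite /nsq /= expr1n expr0n addr0.
rewrite big_ord_recr /=; set Z := \sum_(_ < _) _ in IH *.
have -> : nsq (Z + epoint 1 t ^+ N.+1) = nsq Z + 1 +
   2 * (complex.Re Z * ck N.+1 t + complex.Im Z * sk N.+1 t).
  rewrite epoint_exp mul1n -[X in nsq Z + X + _](ck_sk1 N.+1 t) /epoint /nsq.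
  by case: Z {IH} => a b /=; ring.
rewrite -IH !FK_sum.
(* The cross terms are cosines of the differences [N+1-k] of frequencies, listed in reverse
   order. *)
have -> : complex.Re Z * ck N.+1 t + complex.Im Z * sk N.+1 t = \sum_(k < N.+1) ck k.+1 t.
  rewrite /Z !raddf_sum /= !mulr_suml -big_split /= (reindex_inj rev_ord_inj) /=.
  apply: eq_bigr => k _; rewrite epoint_exp mul1n /= subSS.
  have kN : (N - k <= N.+1)%N by rewrite (leq_trans (leq_subr _ _)).
  rewrite (mulrC (ck _ _)) (mulrC (sk _ _)) -ck_subn // subSn ?leq_subr // subKn //.
  by rewrite -ltnS.
rewrite big_ord_recr /= subrr mul0r addr0.
rewrite (eq_bigr (fun k : 'I_N.+1 => (N%:R - k%:R) * ck k.+1 t + ck k.+1 t)); last first.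
  by move=> k _; rewrite -(natr1 N); ring.
by rewrite big_split /= -(natr1 N.+1); ring.
Qed.

Lemma FK_ge0 N t : 0 <= FK N t.
Proof.
have : 0 <= N.+1%:R * FK N t by rewrite FK_nsq nsq_ge0.
by rewrite pmulr_rge0 // ltr0n.
Qed.

(** Summing the geometric series, [(N+1) F_N (1 - cos (2 pi t)) = 1 - cos (2 pi (N+1) t)]. The
    kernel therefore concentrates where the chordal distance is small. *)
Lemma FK_bound N t : FK N t * (1 - ck 1 t) <= 2 / N.+1%:R.
Proof.
have N0 : 0 < N.+1%:R :> R by rewrite ltr0n.
rewrite -(ler_pM2l N0) mulrA FK_nsq mulrCA mulfV ?gt_eqF // mulr1.
have h (m : nat) : nsq (epoint 1 t ^+ m - 1) = 2 * (1 - ck m t).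
  have := ck_sk1 m t; rewrite epoint_exp mul1n /epoint /nsq /=; lra.
have h1' : nsq (epoint 1 t - 1) = 2 * (1 - ck 1 t) by rewrite -h expr1.
have := h N.+1; rewrite subrX1 nsqM h1' => h1; have := ck_le1 N.+1 t; rewrite ler_norml => /andP[h2 h3].
have h4 : (1 - ck 1 t) * nsq (\sum_(i < N.+1) epoint 1 t ^+ i) = 1 - ck N.+1 t by lra.
by rewrite mulrC h4; lra.
Qed.

Lemma FK_le N t : FK N t <= N.+1%:R.
Proof.
have N0 : 0 < N.+1%:R :> R by rewrite ltr0n.
have : FK N t <= 1 + 2 * \sum_(k < N) rho N k.+1.
  rewrite lerD2l ler_pM2l //; apply: ler_sum => k _.
  rewrite -[leRHS]mulr1 ler_wpM2l //.
    by rewrite subr_ge0 ler_pdivrMr // mul1r ler_nat ltnS ltnW.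
  by have := ck_le1 k.+1 t; rewrite ler_norml => /andP[].
have -> : 1 + 2 * \sum_(k < N) rho N k.+1 = FK N 0.
  rewrite /FK; congr (1 + 2 * _); apply: eq_bigr => k _.
  by rewrite /ck mulr0 cos0 mulr1.
move=> /le_trans; apply; rewrite -(ler_pM2l N0) FK_nsq.
under eq_bigr => k _ do rewrite epoint_exp /epoint /ck /sk mulr0 cos0 sin0.
have -> : \sum_(i < N.+1) ((1 : R) +i* 0)%C = ((N.+1%:R : R)%:C)%C.
  by rewrite sumr_const card_ord; exact: (esym (rmorph_nat (real_complex R) N.+1)).
by rewrite nsq_real expr2.
Qed.

Lemma FK_per N : periodic1 (FK N).
Proof. by move=> x; rewrite /FK; under eq_bigr do rewrite ck_per. Qed.

Lemma measurable_FK N D : measurable_fun D (FK N).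
Proof.
apply: measurable_funD => //; apply: measurable_funM => //.
apply: measurable_sum => k; apply: measurable_funM => //; exact: measurable_ck.
Qed.

Lemma FK_norm N t : `|FK N t| <= N.+1%:R.
Proof. by rewrite ger0_norm ?FK_ge0 // FK_le. Qed.

Lemma L1_FK N : L1 (FK N).
Proof. by apply: (@L1_bounded _ _ N.+1%:R) => [|x _]; [exact: measurable_FK|exact: FK_norm]. Qed.

Lemma I_FK N : I (FK N) = 1.
Proof.
have ls : forall k : 'I_N, true -> L1 (fun x => rho N k.+1 * ck k.+1 x).
  by move=> k _; apply: L1Z; exact: L1_ck.
rewrite /FK (ID (L1_cst 1) (L1Z 2 (L1_sum _ ls))) I_cst (IZ _ (L1_sum _ ls)) (I_sum _ ls).
rewrite big1 ?mulr0 ?addr0 // => k _.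
by rewrite (IZ _ (@L1_ck R k.+1)) I_ck mulr0.
Qed.

Lemma measurable_FKsub N x D : measurable_fun D (fun y : R => FK N (x - y)).
Proof.
apply: measurable_funTS; apply: (measurableT_comp (@measurable_FK N setT)).
exact: measurable_funB.
Qed.

Lemma L1_FKsub N x : L1 (fun y => FK N (x - y)).
Proof. by apply: L1_reflect; [exact: measurable_FK|exact: FK_per|exact: L1_FK]. Qed.

Lemma I_FKsub N x : I (fun y => FK N (x - y)) = 1.
Proof. by rewrite I_reflect ?I_FK //; [exact: measurable_FK|exact: FK_per]. Qed.

Definition fejer N f x : R := I (fun y => f y * FK N (x - y)).

Lemma L1_fejer_in N f x : L1 f -> L1 (fun y => f y * FK N (x - y)).
Proof.
move=> lf; apply: (@L1_mulb _ _ _ N.+1%:R) => //; first exact: measurable_FKsub.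
by move=> y _; exact: FK_norm.
Qed.

Definition ccoef f k : R := I (fun x => f x * ck k x).
Definition scoef f k : R := I (fun x => f x * sk k x).

Lemma fejerE N f x : L1 f -> fejer N f x = I f +
  2 * \sum_(k < N) rho N k.+1 * (ccoef f k.+1 * ck k.+1 x + scoef f k.+1 * sk k.+1 x).
Proof.
move=> lf.
have lc k : L1 (fun y => f y * ck k y) by exact: L1_mulck.
have ls k : L1 (fun y => f y * sk k y) by exact: L1_mulsk.
pose F k y : R := rho N k.+1 * (ck k.+1 x * (f y * ck k.+1 y) + sk k.+1 x * (f y * sk k.+1 y)).
have lF (k : 'I_N) : true -> L1 (F k).
  by move=> _; apply: L1Z; apply: L1D; apply: L1Z.
rewrite /fejer (_ : (fun y => _) = fun y => f y + 2 * \sum_(k < N) F k y); last first.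
  apply/funext => y; rewrite /FK mulrDr mulr1 mulrCA mulr_sumr; congr (_ + 2 * _).
  by apply: eq_bigr => k _; rewrite /F ckD ckN skN; ring.
rewrite (ID lf (L1Z 2 (L1_sum _ lF))) (IZ _ (L1_sum _ lF)) (I_sum _ lF).
congr (_ + 2 * _); apply: eq_bigr => k _; rewrite /F.
rewrite (IZ _ (L1D (L1Z _ (lc _)) (L1Z _ (ls _)))) (ID (L1Z _ (lc _)) (L1Z _ (ls _))).
by rewrite (IZ _ (lc _)) (IZ _ (ls _)) /ccoef /scoef; ring.
Qed.

Lemma measurable_fejer N f D : L1 f -> measurable_fun D (fejer N f).
Proof.
move=> lf; rewrite (_ : fejer N f = fun x => I f +
  2 * \sum_(k < N) rho N k.+1 * (ccoef f k.+1 * ck k.+1 x + scoef f k.+1 * sk k.+1 x)).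
  apply: measurable_funD => //; apply: measurable_funM => //; apply: measurable_sum => k.
  apply: measurable_funM => //; apply: measurable_funD; apply: measurable_funM => //;
    [exact: measurable_ck|exact: measurable_sk].
by apply/funext => x; exact: fejerE.
Qed.

Lemma fejer_bounded N f (M x : R) : L1 f -> (forall y, T y -> `|f y| <= M) -> `|fejer N f x| <= M.
Proof.
move=> lf fM; apply: (le_trans (I_norm (L1_fejer_in N x lf))).
have -> : M = I (fun y => M * FK N (x - y)).
  by rewrite IZ; [rewrite I_FKsub mulr1|exact: L1_FKsub].
apply: I_le; first by apply: L1_norm; exact: L1_fejer_in.
  by apply: L1Z; exact: L1_FKsub.
by move=> y Ty; rewrite normrM (ger0_norm (FK_ge0 _ _)) ler_wpM2r ?FK_ge0 ?fM.
Qed.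

Lemma fejerB N f g x : L1 f -> L1 g ->
  fejer N (fun y => f y - g y) x = fejer N f x - fejer N g x.
Proof.
move=> lf lg; rewrite /fejer -IB; [|exact: L1_fejer_in|exact: L1_fejer_in].
by apply: eq_I => y _; ring.
Qed.

Lemma L1_fejer N f : L1 f -> L1 (fejer N f).
Proof.
move=> lf; rewrite (_ : fejer N f = fun x => I f +
  2 * \sum_(k < N) rho N k.+1 * (ccoef f k.+1 * ck k.+1 x + scoef f k.+1 * sk k.+1 x)).
  apply: L1D; [exact: L1_cst|apply: L1Z; apply: L1_sum => k _; apply: L1Z; apply: L1D; apply: L1Z].
    exact: L1_ck.
  exact: L1_sk.
by apply/funext => x; exact: fejerE.
Qed.

(** Tonelli, since the positive kernel [FK N (x - y)] has mass one in either variable. *)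
Lemma fejer_contract N f : measurable_fun setT f -> L1 f ->
  I (fun x => `|fejer N f x|) <= I (fun x => `|f x|).
Proof.
move=> mf lf; pose F x y : R := `|f y| * FK N (x - y).
have mF : meas2 F.
  apply: measurable_funM.
    by do 2 apply: measurableT_comp => //; exact: measurable_snd.
  apply: (measurableT_comp (@measurable_FK N setT)); apply: measurable_funB; first exact: measurable_fst.
  exact: measurable_snd.
have lFx x : T x -> L1 (F x) by move=> _; apply: L1_fejer_in; exact: L1_norm.
have lFKy y : L1 (fun x => FK N (x - y)).
  by apply: (@L1_shift _ (FK N) (- y)); [exact: measurable_FK|exact: FK_per|exact: L1_FK].
have IFKy y : I (fun x => FK N (x - y)) = 1.
  by rewrite (@I_shift _ (FK N) (- y)) ?I_FK //; [exact: measurable_FK|exact: FK_per].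
have lFy y : T y -> L1 (F^~ y) by move=> _; exact: L1Z.
have IFy y : I (F^~ y) = `|f y| by rewrite /F IZ // IFKy mulr1.
have lF : L12 F.
  apply: (@L12_bound' _ _ (fun y => `|f y|)) => //; first exact: L1_norm.
  move=> y Ty; rewrite -[leRHS]IFy le_eqVlt; apply/orP; left; apply/eqP; apply: eq_I => x _.
  by rewrite ger0_norm // /F mulr_ge0 // FK_ge0.
have [lI _] := I2E lF lFx.
have := I2_swap lF lFx lFy.
under [in RHS]eq_fun do rewrite IFy.
move=> <-; apply: I_le => //; first by apply: L1_norm; exact: L1_fejer.
move=> x Tx; apply: (le_trans (I_norm (L1_fejer_in N x lf))).
rewrite le_eqVlt; apply/orP; left; apply/eqP; apply: eq_I => y _.
by rewrite normrM (ger0_norm (FK_ge0 _ _)).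
Qed.

(* [1 - ck 1 (x - y)] is half the squared chordal distance on the circle. *)
Definition circle_uc f := forall e : R, 0 < e -> exists2 s : R, 0 < s &
  forall x y : R, T x -> T y -> 1 - ck 1 (x - y) < s -> `|f x - f y| < e.

(** Near [x] uniform continuity acts, away from [x] the decay [FK_bound] of the kernel; each part
    contributes [e / 2]. *)
Lemma fejer_unif f (M : R) : L1 f -> (forall y, T y -> `|f y| <= M) -> circle_uc f ->
  forall e : R, 0 < e -> exists N0, forall N, (N0 <= N)%N -> forall x, T x ->
    `|fejer N f x - f x| <= e.
Proof.
move=> lf fM uf e e0.
have [s s0 hs] := uf _ (divr_gt0 e0 (ltr0Sn R 1)).
have M0 : 0 <= M.
  apply: le_trans (fM 0 _) => //; rewrite TorP; apply/andP; split; lra.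
(* Away from [x] the integrand is at most [2 M * 2 / ((N+1) s)]; this is below [e / 2] as soon as
   [N + 1 > K]. *)
pose K := 8 * M / (s * e).
have K0 : 0 <= K by rewrite divr_ge0 // ?mulr_ge0 // ltW // mulr_gt0.
exists (Num.truncn K).+1 => N hN x Tx.
have N1 : 0 < N.+1%:R :> R by rewrite ltr0n.
have KN : K < N.+1%:R.
  by rewrite (lt_le_trans (truncnS_gt _)) // ler_nat ltnW.
have lk := L1_FKsub N x.
have E : fejer N f x - f x = I (fun y => (f y - f x) * FK N (x - y)).
  rewrite /fejer -[X in _ - X](_ : I (fun y => f x * FK N (x - y)) = _); last first.
    by rewrite IZ // I_FKsub mulr1.
  rewrite -IB; [|exact: L1_fejer_in|exact: L1Z].
  by apply: eq_I => y _; rewrite mulrBl.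
have lfx : L1 (fun y => f y - f x) by apply: L1B => //; exact: L1_cst.
rewrite E; apply: (le_trans (I_norm (L1_fejer_in N x lfx))).
pose c := 4 * M / (N.+1%:R * s).
have -> : e = I (fun y => e / 2 * FK N (x - y) + e / 2).
  rewrite (ID (L1Z _ lk) (L1_cst _)) I_cst IZ // I_FKsub; by field.
apply: I_le.
- by apply: L1_norm; exact: L1_fejer_in.
- by apply: L1D; [exact: L1Z|exact: L1_cst].
move=> y Ty; rewrite normrM (ger0_norm (FK_ge0 _ _)).
have F0 := FK_ge0 N (x - y).
have [hlt|hge] := ltP (1 - ck 1 (x - y)) s.
  have := hs x y Tx Ty hlt; rewrite distrC => h.
  have : `|f y - f x| * FK N (x - y) <= e / 2 * FK N (x - y) by rewrite ler_wpM2r // ltW.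
  by move: e0; lra.
have hF : FK N (x - y) <= 2 / (N.+1%:R * s).
  have := FK_bound N (x - y) => hb.
  have : FK N (x - y) * s <= 2 / N.+1%:R by apply: le_trans hb; rewrite ler_wpM2l.
  by rewrite -ler_pdivlMr // invfM mulrA.
have h2M : `|f y - f x| <= 2 * M.
  by apply: (le_trans (ler_normB _ _)); rewrite mulr_natl mulr2n lerD ?fM.
have h3 : `|f y - f x| * FK N (x - y) <= 2 * M * (2 / (N.+1%:R * s)) by rewrite ler_pM.
have h4 : 2 * M * (2 / (N.+1%:R * s)) <= e / 2.
  rewrite mulrA ler_pdivrMr ?mulr_gt0 //.
  move: KN; rewrite /K ltr_pdivrMr ?mulr_gt0 // => KN.
  have -> : e / 2 * (N.+1%:R * s) = N.+1%:R * (s * e) / 2 by ring.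
  by rewrite ler_pdivlMr //; lra.
apply: (le_trans h3); apply: (le_trans h4); rewrite lerDr.
by rewrite mulr_ge0 // ltW // divr_gt0.
Qed.

End Fejer.

(** * Uniform continuity on the circle and L1 convergence of Fejer means *)

Section CircleContinuity.
Variable R : realType.
Local Notation T := (@Tor R).
Implicit Types (f g : R -> R).

(** The cosine is strictly decreasing over half a period, so a small chord means that two points are
    close directly or through the seam of the torus. *)
Lemma ck1_close (eta d : R) : 0 < eta <= 2^-1 -> `|d| < 1 ->
  1 - ck 1 d < 1 - ck 1 eta -> `|d| < eta \/ 1 - `|d| < eta.
Proof.
move=> /andP[e0 e1] d1 h.
have pi0 : 0 < pi :> R by exact: pi_gt0.
have c1 x : ck 1 x = cos (2 * pi * x) by rewrite /ck mulr1.
have cabs : ck 1 d = ck 1 `|d|.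
  by case: (ger0P d) => // _; rewrite ckN.
have mono x : 0 <= x <= 2^-1 -> ck 1 eta < ck 1 x -> x < eta.
  move=> /andP[x0 x1]; rewrite !c1 ltr_cos.
  - by rewrite ltr_pM2l // mulr_gt0.
  - rewrite in_itv /= mulr_ge0 ?mulr_ge0 ?(ltW pi0) //=.
    have : pi * x <= pi * 2^-1 by rewrite ler_pM2l.
    lra.
  - rewrite in_itv /= mulr_ge0 ?(ltW e0) ?mulr_ge0 ?(ltW pi0) //=.
    have : pi * eta <= pi * 2^-1 by rewrite ler_pM2l.
    lra.
have h' : ck 1 eta < ck 1 `|d| by rewrite -cabs; lra.
have [le|gt] := leP `|d| 2^-1; first by left; apply: mono => //; rewrite normr_ge0.
right; apply: mono; first by apply/andP; split; lra.
by rewrite addrC ck_per ckN.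
Qed.

Lemma segment_uc f (a b : R) : continuous f -> forall e : R, 0 < e -> exists2 s : R, 0 < s &
  forall x y, a <= x <= b -> `|x - y| < s -> `|f x - f y| < e.
Proof.
move=> cf e e0.
have /compact_near_coveringP cov := @segment_compact R a b.
have h x : `[a, b]%classic x -> \forall x' \near x & i \near 0^'+,
    (fun s x => forall y, `|x - y| < s -> `|f x - f y| < e) i x'.
  move=> _; have e20 : 0 < e / 2 by rewrite divr_gt0.
  have /cvgrPdist_lt /(_ _ e20) [/= d d0 hd] := cf x.
  have d20 : 0 < d / 2 by rewrite divr_gt0.
  exists (ball x (d / 2), [set s | s < d / 2]) => /=.
    split; first exact: nbhsx_ballx.
    exact: nbhs_right_lt.
  move=> [x' s] /= [xx' sd] y xy.
  have h1 : `|f x - f x'| < e / 2.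
    by apply: hd => /=; rewrite (lt_trans xx') //; lra.
  have h2 : `|f x - f y| < e / 2.
    apply: hd => /=; rewrite (_ : x - y = (x - x') + (x' - y)); last by ring.
    by apply: (le_lt_trans (ler_normD _ _)); move: xx'; rewrite /ball /=; lra.
  rewrite (_ : f x' - f y = (f x - f y) - (f x - f x')); last by ring.
  by apply: (le_lt_trans (ler_normB _ _)); lra.
have [s s0 hs] := cov R (0^'+) (fun s x => forall y, `|x - y| < s -> `|f x - f y| < e) _ h.
have s20 : 0 < s / 2 by rewrite divr_gt0.
exists (s / 2) => // x y xab xy.
have {}s0 : 0 < s := s0.
apply: (hs (s / 2) _ s20 x _ y xy); last by rewrite /= in_itv.
by rewrite /= sub0r normrN gtr0_norm //; lra.
Qed.

Lemma continuous_circle_uc f : continuous f -> f (- 2^-1) = f 2^-1 -> circle_uc f.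
Proof.
move=> cf fe e e0; have e20 : 0 < e / 2 by rewrite divr_gt0.
have [s s0 hs] := @segment_uc f (- 2^-1) 2^-1 cf _ e20.
pose eta := Num.min s 2^-1.
have eta0 : 0 < eta by rewrite lt_min s0 invr_gt0 ltr0n.
have eta1 : eta <= 2^-1 by rewrite ge_min lexx orbT.
have etas : eta <= s by rewrite ge_min lexx.
exists (1 - ck 1 eta).
  rewrite subr_gt0 /ck mulr1 -[ltRHS]cos0 ltr_cos.
  - by rewrite mulr_gt0 // mulr_gt0 // pi_gt0.
  - by rewrite in_itv /= lexx ltW // pi_gt0.
  - rewrite in_itv /= mulr_ge0 ?mulr_ge0 ?(ltW (pi_gt0 R)) ?(ltW eta0) //=.
    have : pi * eta <= pi * 2^-1 by rewrite ler_pM2l // pi_gt0.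
    lra.
move=> x y; rewrite !TorP => /andP[x1 x2] /andP[y1 y2] h.
have xy1 : `|x - y| < 1 by rewrite ltr_norml; apply/andP; split; lra.
have ends u v : `|u - v| < s -> - 2^-1 <= u <= 2^-1 -> `|f u - f v| < e / 2.
  by move=> uv u1; exact: hs.
case: (@ck1_close eta (x - y)) => //; first by rewrite eta0.
  move=> hd; apply: (@lt_trans _ _ (e / 2)); last by lra.
  by apply: ends; [lra|apply/andP; split; lra].
move=> hd.
(* Crossing the seam: one point is close to one end point and the other point to the opposite one,
   where [f] has the same value. *)
have tri (u v w z : R) : `|u - w| < e / 2 -> `|z - v| < e / 2 -> w = z -> `|u - v| < e.
  move=> h1 h2 wz; rewrite (_ : u - v = (u - w) + (z - v)); last by rewrite wz; ring.
  by apply: (le_lt_trans (ler_normD _ _)); lra.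
have [xy|xy] := ltP x y.
  move: hd; rewrite ltr0_norm ?subr_lt0 // => hd.
  apply: (tri _ _ (f (- 2^-1)) (f 2^-1)) => //.
    by apply: ends; [rewrite ger0_norm; lra|apply/andP; split; lra].
  by apply: ends; [rewrite ger0_norm; lra|apply/andP; split; lra].
move: hd; rewrite ger0_norm ?subr_ge0 // => hd.
apply: (tri _ _ (f 2^-1) (f (- 2^-1))) => //.
  by rewrite distrC; apply: ends; [rewrite ger0_norm; lra|apply/andP; split; lra].
by apply: ends; [rewrite ler0_norm; lra|apply/andP; split; lra].
Qed.

Lemma continuous_bounded_T f : continuous f -> exists2 M : R, 0 <= M & forall x, T x -> `|f x| <= M.
Proof.
move=> cf.
have cn : {within `[- 2^-1, 2^-1], continuous (fun x => `|f x|)}.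
  apply: continuous_subspaceT => x; apply: continuous_comp; first exact: cf.
  exact: norm_continuous.
have le : - 2^-1 <= 2^-1 :> R by lra.
have [c _ hc] := EVT_max le cn; exists `|f c| => // x /TorP /andP[x1 x2].
by apply: hc; rewrite in_itv /= x1 ltW.
Qed.

Lemma continuous_L1 f : continuous f -> L1 f.
Proof.
move=> cf; have [M _ hM] := continuous_bounded_T cf; apply: L1_bounded hM.
by apply: measurable_funTS; exact: continuous_measurable_fun.
Qed.

Lemma continuous_sum_ord n (F : nat -> R -> R) : (forall k, continuous (F k)) ->
  continuous (fun x => \sum_(k < n) F k x).
Proof.
move=> cF; elim: n => [|n IH].
  by rewrite (_ : (fun x => _) = fun=> 0); [move=> x; exact: cvg_cst|apply/funext => x; rewrite big_ord0].
rewrite (_ : (fun x => _) = fun x => \sum_(k < n) F k x + F n x); last first.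
  by apply/funext => x; rewrite big_ord_recr.
by move=> x; apply: cvgD; [exact: IH|exact: cF].
Qed.

Lemma continuous_ck k : continuous (@ck R k).
Proof.
move=> x; apply: (@cvg_comp _ _ _ (fun x => 2 * pi * k%:R * x) cos _ (nbhs (2 * pi * k%:R * x))).
  by apply: cvgM; [exact: cvg_cst|exact: cvg_id].
exact: continuous_cos.
Qed.

Lemma continuous_FK N : continuous (@FK R N).
Proof.
move=> x; apply: cvgD; first exact: cvg_cst.
apply: cvgM; first exact: cvg_cst.
apply: (@continuous_sum_ord N (fun k x => rho R N k.+1 * ck k.+1 x)) => k y.
by apply: cvgM; [exact: cvg_cst|exact: continuous_ck].
Qed.

(* The cut-off [1 - F_N(x - 1/2)/(N+1)] vanishes at the end points of the torus. *)
Lemma approx_circle_uc f (e : R) : L1 f -> 0 < e -> exists g : R -> R,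
  [/\ continuous g, circle_uc g & I (fun x => `|f x - g x|) <= e].
Proof.
move=> lf e0; have e20 : 0 < e / 2 by rewrite divr_gt0.
have muT : (lebesgue_measure T < +oo)%E := mu_Tor_lty R.
have [g_ [cg lg cvg]] := approximation_continuous_integrable (@measurable_Tor R) muT lf.
have [g [{}cg {}lg hg]] : exists g : R -> R, [/\ continuous g, L1 g & I (fun x => `|f x - g x|) <= e / 2].
  have /fine_cvgP[_ /cvgrPdist_le /(_ _ e20) [N _ hN]] := cvg.
  exists (g_ N); split; [exact: cg|exact: lg|].
  have := hN N (leqnn N); rewrite /= sub0r normrN => /(le_trans (ler_norm _)).
  exact.
have [S S0 hS] := continuous_bounded_T cg.
(* The cut-off changes [g] by at most [S / (N+1)] in L1, because the kernel has mass one. *)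
pose N := (Num.truncn (S / (e / 2))).+1.
have N0 : 0 < N.+1%:R :> R by rewrite ltr0n.
have SN : S / N.+1%:R <= e / 2.
  rewrite ler_pdivrMr // mulrC -ler_pdivrMr //.
  by rewrite (le_trans (ltW (truncnS_gt _))) // ler_nat.
pose chi (x : R) := 1 - FK N (x - 2^-1) / N.+1%:R.
have FK0 : FK N 0 = N.+1%:R :> R.
  have h := FK_nsq N (0 : R); apply: (mulfI (lt0r_neq0 N0)); rewrite h.
  under eq_bigr => k _ do rewrite epoint_exp /epoint /ck /sk mulr0 cos0 sin0.
  have -> : \sum_(i < N.+1) ((1 : R) +i* 0)%C = ((N.+1%:R : R)%:C)%C.
    by rewrite sumr_const card_ord; exact: (esym (rmorph_nat (real_complex R) N.+1)).
  by rewrite nsq_real expr2.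
have chi_r : chi 2^-1 = 0 by rewrite /chi subrr FK0 mulfV ?subrr // gt_eqF.
have chi_l : chi (- 2^-1) = 0.
  rewrite /chi -(@FK_per R N) (_ : - 2^-1 - 2^-1 + 1 = 0); last by field.
  by rewrite FK0 mulfV ?subrr // gt_eqF.
have cchi : continuous chi.
  move=> x; apply: cvgB; first exact: cvg_cst.
  apply: cvgM; last exact: cvg_cst.
  apply: (@cvg_comp _ _ _ (fun x => x - 2^-1) (FK N) _ (nbhs (x - 2^-1))); last exact: continuous_FK.
  by apply: cvgB; [exact: cvg_id|exact: cvg_cst].
pose G x := g x * chi x.
have cG : continuous G by move=> x; apply: cvgM; [exact: cg|exact: cchi].
exists G; split=> //; first by apply: continuous_circle_uc => //; rewrite /G chi_r chi_l !mulr0.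
have lG := continuous_L1 cG.
have lFK : L1 (fun x : R => FK N (x - 2^-1)).
  by apply: (@L1_shift _ (FK N) (- 2^-1)); [exact: measurable_FK|exact: FK_per|exact: L1_FK].
have IFK : I (fun x : R => FK N (x - 2^-1)) = 1 :> R.
  by rewrite (@I_shift _ (FK N) (- 2^-1)) ?I_FK //; [exact: measurable_FK|exact: FK_per].
have lfg : L1 (fun x => `|f x - g x|) by apply: L1_norm; exact: L1B.
have lc : L1 (fun x => S / N.+1%:R * FK N (x - 2^-1)) by exact: L1Z.
apply: (@le_trans _ _ (I (fun x => `|f x - g x| + S / N.+1%:R * FK N (x - 2^-1)))).
  apply: I_le; [by apply: L1_norm; exact: L1B|exact: L1D|move=> x Tx].
  rewrite (_ : f x - G x = (f x - g x) + g x * (FK N (x - 2^-1) / N.+1%:R)); last first.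
    by rewrite /G /chi; ring.
  apply: (le_trans (ler_normD _ _)); rewrite lerD2l normrM.
  rewrite [`|_ / _|]ger0_norm ?divr_ge0 ?FK_ge0 //.
  by rewrite -mulrA (mulrC _^-1) ler_wpM2r ?hS // divr_ge0 ?FK_ge0.
by rewrite ID // IZ // IFK mulr1 (le_trans (lerD hg SN)) // -splitr.
Qed.

(** A continuous [g] close to [q] in L1 has uniformly convergent means, and the means of [q - g] are
    no larger than [q - g] in L1: three errors of [e / 3]. *)
Lemma fejer_L1 (q : R -> R) (M : R) : measurable_fun setT q -> (forall x, T x -> `|q x| <= M) ->
  forall e : R, 0 < e -> exists N0, forall N, (N0 <= N)%N ->
    I (fun x => `|fejer N q x - q x|) <= e.
Proof.
move=> mq qM e e0; have lq : L1 q by apply: L1_bounded qM; exact: measurable_funTS.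
have e30 : 0 < e / 3 by rewrite divr_gt0.
have [g [cg ug hg]] := approx_circle_uc lq e30.
have [S S0 hS] := continuous_bounded_T cg.
have lg := continuous_L1 cg.
have mg : measurable_fun setT g by exact: continuous_measurable_fun.
have [N0 hN0] := fejer_unif lg hS ug e30; exists N0 => N hN.
have lqg : L1 (fun x => q x - g x) by exact: L1B.
have mqg : measurable_fun setT (fun x => q x - g x) by exact: measurable_funB.
have h1 := fejer_contract N mqg lqg.
have l1 : L1 (fun x => `|fejer N (fun y => q y - g y) x|) by apply: L1_norm; exact: L1_fejer.
have l2 : L1 (fun x => `|q x - g x|) by exact: L1_norm.
apply: (@le_trans _ _ (I (fun x => (`|fejer N (fun y => q y - g y) x| + `|q x - g x|) + e / 3))).
  apply: I_le.
  - by apply: L1_norm; apply: L1B => //; exact: L1_fejer.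
  - by apply: L1D; [exact: L1D|exact: L1_cst].
  move=> x Tx; rewrite fejerB //; have := hN0 _ hN _ Tx.
  rewrite (_ : fejer N q x - q x = (fejer N q x - fejer N g x) - (q x - g x) + (fejer N g x - g x)); last by ring.
  by move=> h; apply: (le_trans (ler_normD _ _)); apply: lerD => //; exact: ler_normB.
rewrite (ID (L1D l1 l2) (L1_cst _)) (ID l1 l2) I_cst; lra.
Qed.

End CircleContinuity.

(** * Interaction energy of bounded densities *)

Section Interaction.
Variable R : realType.
Local Notation T := (@Tor R).
Variables (W : R -> R).
Hypotheses (mW : measurable_fun setT W) (pW : periodic1 W) (lW : L1 W).
Hypotheses (eW : forall x, W (- x) = W x) (aW : I W = 0).
Implicit Types (p q : R -> R).

Lemma fhatE k : fhat W k = I (fun x => W x * ck k x).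
Proof. by []. Qed.

Lemma I_W_sk k : I (fun x => W x * sk k x) = 0.
Proof.
apply: I_odd => [||x].
- by apply: measurable_funM => //; exact: measurable_sk.
- exact: L1_mulsk.
- by rewrite eW skN mulrN.
Qed.

Lemma conv_shift_eq (g : R -> R) y : measurable_fun setT g -> periodic1 g ->
  I (fun x => W (x - y) * g x) = I (fun x => W x * g (x + y)).
Proof.
move=> mg pg.
rewrite -(@I_shift _ (fun x => W (x - y) * g x) y).
- by apply: eq_I => x _; rewrite addrK.
- by apply: measurable_funM => //; exact: (measurable_shift (- y) mW).
- by move=> x; rewrite addrAC pW pg.
Qed.

Lemma I_Wsub_ck k y : I (fun x => W (x - y) * ck k x) = fhat W k * ck k y.
Proof.
rewrite conv_shift_eq; [|exact: measurable_ck|exact: ck_per].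
transitivity (I (fun x => ck k y * (W x * ck k x) - sk k y * (W x * sk k x))).
  by apply: eq_I => x _; rewrite ckD; ring.
have lc := L1_mulck k lW; have ls := L1_mulsk k lW.
by rewrite (IB (L1Z _ lc) (L1Z _ ls)) (IZ _ lc) (IZ _ ls) I_W_sk mulr0 subr0 mulrC.
Qed.

Lemma I_Wsub_sk k y : I (fun x => W (x - y) * sk k x) = fhat W k * sk k y.
Proof.
rewrite conv_shift_eq; [|exact: measurable_sk|exact: sk_per].
transitivity (I (fun x => ck k y * (W x * sk k x) + sk k y * (W x * ck k x))).
  by apply: eq_I => x _; rewrite skD; ring.
have lc := L1_mulck k lW; have ls := L1_mulsk k lW.
by rewrite (ID (L1Z _ ls) (L1Z _ lc)) (IZ _ lc) (IZ _ ls) I_W_sk mulr0 add0r mulrC.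
Qed.

Definition qsq q k : R := ccoef q k ^+ 2 + scoef q k ^+ 2.

(** Cesaro mean of the Fourier expansion of the interaction energy. *)
Definition Wsum N q : R := \sum_(k < N) rho R N k.+1 * (2 * fhat W k.+1) * qsq q k.+1.

Lemma I_Wsub y : I (fun x => W (x - y)) = 0.
Proof. by rewrite (@I_shift _ W (- y)). Qed.

Lemma L1_Wsub y : L1 (fun x => W (x - y)).
Proof. exact: (@L1_shift _ W (- y)). Qed.

Lemma I_Wsub_fejer N q y : L1 q -> I (fun x => W (x - y) * fejer N q x) =
  \sum_(k < N) rho R N k.+1 * (2 * fhat W k.+1) * (ccoef q k.+1 * ck k.+1 y + scoef q k.+1 * sk k.+1 y).
Proof.
move=> lq; have lw := L1_Wsub y.
have lc k := L1_mulck k lw; have ls k := L1_mulsk k lw.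
pose F (k : nat) (x : R) : R := 2 * rho R N k.+1 * (ccoef q k.+1 * (W (x - y) * ck k.+1 x) + scoef q k.+1 * (W (x - y) * sk k.+1 x)).
have lF (k : 'I_N) : true -> L1 (F k) by move=> _; apply: L1Z; apply: L1D; apply: L1Z.
transitivity (I (fun x => I q * W (x - y) + \sum_(k < N) F k x)).
  apply: eq_I => x _; rewrite fejerE // mulrDr (mulrC _ (I q)); congr (_ + _).
  by rewrite mulrCA !mulr_sumr; apply: eq_bigr => k _; rewrite /F; ring.
rewrite (ID (L1Z _ lw) (L1_sum _ lF)) (IZ _ lw) I_Wsub mulr0 add0r (I_sum _ lF).
apply: eq_bigr => k _; rewrite /F (IZ _ (L1D (L1Z _ (lc _)) (L1Z _ (ls _)))).
rewrite (ID (L1Z _ (lc _)) (L1Z _ (ls _))) (IZ _ (lc _)) (IZ _ (ls _)) I_Wsub_ck I_Wsub_sk.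
by ring.
Qed.

Definition Iint p r : R := I2 (fun x y => W (x - y) * p x * r y).

(** Cosines and sines are eigenfunctions of the convolution with an even potential, so smoothing one
    of the two factors makes the energy a finite sum. *)
Lemma inter_fejer N q M : measurable_fun setT q -> (forall x, T x -> `|q x| <= M) ->
  Iint (fejer N q) q = Wsum N q.
Proof.
move=> mq qM; have lq : L1 q by apply: L1_bounded qM; exact: measurable_funTS.
have mf : measurable_fun setT (fejer N q) by exact: measurable_fejer.
have fM x := fejer_bounded N x lq qM.
have lf : L1 (fejer N q) by exact: L1_fejer.
have E y : (fun x => W (x - y) * fejer N q x * q y) = fun x => q y * (W (x - y) * fejer N q x).
  by apply/funext => x; ring.
have lwf y : L1 (fun x => W (x - y) * fejer N q x).
  by apply: (@L1_mulb _ _ _ M) => //; [exact: L1_Wsub|exact: measurable_funTS].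
rewrite /Iint (I2E' (L12_conv mW pW lW mf lf mq qM)); last first.
  by move=> y _; rewrite E; exact: L1Z.
pose F (k : nat) (y : R) : R := rho R N k.+1 * (2 * fhat W k.+1) *
  (ccoef q k.+1 * (q y * ck k.+1 y) + scoef q k.+1 * (q y * sk k.+1 y)).
have lc k := L1_mulck k lq; have ls k := L1_mulsk k lq.
have lF (k : 'I_N) : true -> L1 (F k) by move=> _; apply: L1Z; apply: L1D; apply: L1Z.
transitivity (I (fun y => \sum_(k < N) F k y)).
  apply: eq_I => y _; rewrite E (IZ _ (lwf y)) I_Wsub_fejer // mulr_sumr.
  by apply: eq_bigr => k _; rewrite /F; ring.
rewrite (I_sum _ lF); apply: eq_bigr => k _; rewrite /F (IZ _ (L1D (L1Z _ (lc _)) (L1Z _ (ls _)))).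
rewrite (ID (L1Z _ (lc _)) (L1Z _ (ls _))) (IZ _ (lc _)) (IZ _ (ls _)) /qsq /ccoef /scoef.
by ring.
Qed.

(** The smoothed factor tends to [q] in L1 and the other factor is bounded, so the Cesaro means
    converge without any summability of the coefficients of [W]. *)
Lemma inter_lim q M : measurable_fun setT q -> (forall x, T x -> `|q x| <= M) ->
  forall e : R, 0 < e -> exists N0, forall N, (N0 <= N)%N -> `|Wsum N q - Iint q q| <= e.
Proof.
move=> mq qM e e0; have lq : L1 q by apply: L1_bounded qM; exact: measurable_funTS.
have T0 : T (0 : R) by apply/TorP/andP; split; lra.
have M0 : 0 <= M by exact: le_trans (qM 0 T0).
pose A := M * I (fun y => `|W y|).
have A0 : 0 <= A by rewrite mulr_ge0 // I_ge0.
have A1 : 0 < A + 1 by rewrite ltr_wpDl.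
have [N0 hN0] := fejer_L1 mq qM (divr_gt0 e0 A1); exists N0 => N /hN0 h.
have mf : measurable_fun setT (fejer N q) by exact: measurable_fejer.
have lf : L1 (fejer N q) by exact: L1_fejer.
rewrite -(inter_fejer N mq qM) /Iint.
rewrite -I2B; [|exact: (L12_conv mW pW lW mf lf mq qM)|exact: (L12_conv mW pW lW mq lq mq qM)].
have -> : (fun x y => W (x - y) * fejer N q x * q y - W (x - y) * q x * q y) =
  (fun x y => W (x - y) * (fejer N q x - q x) * q y).
  by apply/funext => x; apply/funext => y; ring.
have mfq : measurable_fun setT (fun x => fejer N q x - q x) by exact: measurable_funB.
have lfq : L1 (fun x => fejer N q x - q x) by exact: L1B.
apply: (le_trans (I2_conv_bound mW pW lW mfq lfq mq qM)); rewrite -/A.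
apply: (@le_trans _ _ (A * (e / (A + 1)))); first by rewrite ler_wpM2l.
by rewrite mulrA ler_pdivrMr // mulrC ler_wpM2l ?ltW // ; lra.
Qed.

(** * Potentials of period [1/d] and bounded densities *)

Section Periodic.
Variable d : nat.
Hypothesis d0 : (0 < d)%N.
Hypothesis Wd : forall x, W (x + d%:R^-1) = W x.

(** Translation by [1/d] multiplies the coefficient by [cos (2 pi k/d)], the sine part vanishing by
    evenness; this factor is [1] only if [d] divides [k]. *)
Lemma fhat_nmult k : ~~ (d %| k)%N -> fhat W k = 0.
Proof.
move=> dk; pose t : R := 2 * pi * k%:R * d%:R^-1.
have lc := L1_mulck k lW; have ls := L1_mulsk k lW.
have h : fhat W k = cos t * fhat W k.
  rewrite {1}fhatE -(@I_shift _ (fun x => W x * ck k x) d%:R^-1); last 2 first.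
  - by apply: measurable_funM => //; exact: measurable_ck.
  - by move=> x; rewrite pW ck_per.
  transitivity (I (fun x => cos t * (W x * ck k x) - sin t * (W x * sk k x))).
    by apply: eq_I => x _; rewrite Wd ckD -/(cos t) /ck /sk -/t; ring.
  by rewrite (IB (L1Z _ lc) (L1Z _ ls)) (IZ _ lc) (IZ _ ls) I_W_sk mulr0 subr0 fhatE.
have : (1 - cos t) * fhat W k = 0 by rewrite mulrBl mul1r -h subrr.
move/eqP; rewrite mulf_eq0 => /orP[|/eqP //].
rewrite subr_eq0 => /eqP ct.
exfalso; move/negP: dk; apply.
pose r := (k %% d)%N.
have rd : (r < d)%N by rewrite ltn_mod.
have dR0 : 0 < d%:R :> R by rewrite ltr0n.
(* The fractional part of [k/d]. The cosine is strictly decreasing for [s] in [[0, 1/2]], and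
   [1 - s] covers the other half, so [cos (2 pi s) = 1] forces [s = 0]. *)
pose s : R := r%:R / d%:R.
have s01 : 0 <= s < 1 by rewrite divr_ge0 //= ltr_pdivrMr // mul1r ltr_nat.
have cs : cos (2 * pi * s) = 1.
  rewrite [RHS]ct /t {1}(divn_eq k d) natrD natrM.
  rewrite (_ : 2 * pi * ((k %/ d)%N%:R * d%:R + (k %% d)%N%:R) / d%:R = 2 * pi * s + 2 * pi * (k %/ d)%N%:R).
    by rewrite cos_add2pik.
  by rewrite /s /r; field; rewrite gt_eqF.
have pi0 : 0 < pi :> R by exact: pi_gt0.
have cinj (x : R) : 0 <= x <= 2^-1 -> cos (2 * pi * x) = 1 -> x = 0.
  move=> /andP[x0 x1] cx; apply/eqP; rewrite eq_le x0 andbT leNgt; apply/negP => xp.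
  have : cos (2 * pi * x) < cos 0.
    rewrite ltr_cos; first by rewrite mulr_gt0 // mulr_gt0.
    - by rewrite in_itv /= lexx ltW.
    - rewrite in_itv /= mulr_ge0 ?mulr_ge0 ?(ltW pi0) //=.
      have : pi * x <= pi * 2^-1 by rewrite ler_pM2l.
      lra.
  by rewrite cx cos0 ltxx.
have s0 : s = 0.
  case/andP: s01 => sa sb; have [s2|s2] := leP s 2^-1; first by apply: cinj; rewrite ?sa.
  have : 1 - s = 0; last by move: sb; lra.
  apply: cinj; first by apply/andP; split; lra.
  rewrite (_ : 2 * pi * (1 - s) = - (2 * pi * s) + 2 * pi * 1%:R); last by rewrite mulr1n; ring.
  by rewrite cos_add2pik cosN.
have : r%:R = 0 :> R by apply/eqP; move/eqP: s0; rewrite /s mulf_eq0 invr_eq0 (gt_eqF dR0) orbF.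
by move/eqP; rewrite pnatr_eq0.
Qed.

Lemma sum_multiples (g : nat -> R) L : (forall k, ~~ (d %| k)%N -> g k = 0) ->
  \sum_(k < d * L) g k.+1 = \sum_(m < L) g (d * m.+1)%N.
Proof.
move=> g0; elim: L => [|L IH]; first by rewrite muln0 !big_ord0.
rewrite mulnS addnC big_split_ord /= IH big_ord_recr /=; congr (_ + _).
(* In each block of [d] consecutive frequencies only the last one is a multiple of [d]; since the
   sum runs over [g k.+1], it sits at position [d.-1]. *)
have dd : (d.-1 < d)%N by rewrite prednK.
rewrite (bigD1 (Ordinal dd)) //= big1 ?addr0 => [|j jd].
  by congr g; rewrite -addnS prednK // mulnS addnC.
apply: g0; rewrite -addnS dvdn_addr ?dvdn_mulr //.
apply/negP => /dvdn_leq -/(_ isT) dj; move/eqP: jd; apply; apply/val_inj => /=.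
by apply/eqP; rewrite eqn_leq -ltnS prednK // ltn_ord -(leq_add2r 1) !addn1 prednK.
Qed.

Lemma Wsum_mult L q : Wsum (d * L) q =
  \sum_(m < L) rho R (d * L) (d * m.+1) * (2 * fhat W (d * m.+1)) * nsq (ucoef d q m.+1).
Proof.
rewrite /Wsum (@sum_multiples (fun k => rho R (d * L) k * (2 * fhat W k) * qsq q k)) //.
by move=> k /fhat_nmult ->; rewrite mulr0 mulr0 mul0r.
Qed.

Hypothesis decay : forall k : nat, (0 < k)%N -> 2 * fhat W k <= d%:R / k%:R.

Lemma decay_mult m : 2 * fhat W (d * m.+1) <= m.+1%:R^-1.
Proof.
have := @decay (d * m.+1)%N; rewrite muln_gt0 d0 => /(_ isT).
by rewrite natrM invfM mulrA mulfV ?mul1r // pnatr_eq0 -lt0n.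
Qed.

Lemma rho01 L m : (m < L)%N -> 0 <= rho R (d * L) (d * m.+1) <= 1.
Proof.
move=> mL; rewrite /rho; apply/andP; split.
  by rewrite subr_ge0 ler_pdivrMr ?ltr0n // mul1r ler_nat leqW // leq_pmul2l.
by rewrite gerBl divr_ge0.
Qed.

(** Termwise [rho * 2 fhat <= rho / m <= 1 / m]; coefficients of either sign are covered because the
    weights lie in [[0, 1]]. *)
Lemma Wsum_le_usum L q : Wsum (d * L) q <= usum d q L.
Proof.
rewrite Wsum_mult; apply: ler_sum => m _.
rewrite mulrC; apply: ler_wpM2l; first exact: nsq_ge0.
have /andP[r0 r1] := @rho01 L m (ltn_ord m).
apply: (@le_trans _ _ (rho R (d * L) (d * m.+1) * m.+1%:R^-1)).
  by rewrite ler_wpM2l // decay_mult.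
by rewrite -[leRHS]mul1r ler_wpM2r.
Qed.

(** Once the cut-off is twice the frequency [d (m0+1)], its Fejer weight is at least [1/2], so half
    of the gap [dl] survives. *)
Lemma Wsum_le_usum_strict L q m0 (dl : R) : (2 * (d * m0.+1) <= d * L)%N -> 0 <= dl ->
  2 * fhat W (d * m0.+1) <= m0.+1%:R^-1 - dl ->
  Wsum (d * L) q <= usum d q L - dl / 2 * nsq (ucoef d q m0.+1).
Proof.
move=> mL dl0 hdl.
have m0L : (m0 < L)%N.
  rewrite -(leq_pmul2l d0) (leq_trans _ mL) // leq_pmull //.
rewrite Wsum_mult /usum (bigD1 (Ordinal m0L)) //= [in leRHS](bigD1 (Ordinal m0L)) //=.
set S1 := \sum_(i < L | _) _; set S2 := \sum_(i < L | _) _.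
have S12 : S1 <= S2.
  apply: ler_sum => m _; rewrite mulrC; apply: ler_wpM2l; first exact: nsq_ge0.
  have /andP[r0 r1] := @rho01 L m (ltn_ord m).
  apply: (@le_trans _ _ (rho R (d * L) (d * m.+1) * m.+1%:R^-1)).
    by rewrite ler_wpM2l // decay_mult.
  by rewrite -[leRHS]mul1r ler_wpM2r.
have /andP[r0 r1] := rho01 m0L.
have rh : 2^-1 <= rho R (d * L) (d * m0.+1).
  rewrite /rho lerBrDr -lerBrDl ler_pdivrMr ?ltr0n //.
  rewrite (_ : 1 - 2^-1 = 2^-1); last by field.
  rewrite -(ler_pM2l (ltr0Sn R 1)) mulrA mulfV // mul1r -natrM ler_nat.
  by rewrite (leq_trans mL).
set r := rho _ _ _ in r0 r1 rh *; set u := nsq _; have u0 : 0 <= u by exact: nsq_ge0.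
have mm : 0 <= m0.+1%:R^-1 :> R by rewrite invr_ge0.
have h : r * (2 * fhat W (d * m0.+1)) <= m0.+1%:R^-1 - dl / 2.
  apply: (@le_trans _ _ (r * (m0.+1%:R^-1 - dl))); first by rewrite ler_wpM2l.
  have h1 : 2^-1 * dl <= r * dl by rewrite ler_wpM2r.
  have h2 : r * m0.+1%:R^-1 <= 1 * m0.+1%:R^-1 by rewrite ler_wpM2r.
  by move: h2; set im := m0.+1%:R^-1; lra.
have : r * (2 * fhat W (d * m0.+1)) * u <= (m0.+1%:R^-1 - dl / 2) * u by rewrite ler_wpM2r.
by set im := m0.+1%:R^-1; lra.
Qed.

Lemma bounded_inter_le q M : is_density q -> (forall x, T x -> `|q x| <= M) ->
  L1 (fun x => q x * ln (q x)) -> Iint q q <= I (fun x => q x * ln (q x)).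
Proof.
move=> dq qM le; apply/ler_addgt0Pr => e e0.
have [N0 /(_ (d * N0)%N)] := inter_lim (dens_meas dq) qM e0.
rewrite leq_pmull // => /(_ isT); rewrite ler_norml => /andP[h _].
have := Wsum_le_usum N0 q; have := entropy_milin d0 dq le N0; lra.
Qed.

Hypothesis strict : exists m0, 2 * fhat W (d * m0.+1) < m0.+1%:R^-1.

(** The gap at [m0] forces [u (m0+1) = 0]. Then [usum] itself tends to the entropy, so this
    coefficient is also [u 1 ^ (m0+1)]; hence [u 1], all [u m] and every [usum] vanish. *)
Lemma bounded_equality q M : is_density q -> (forall x, T x -> `|q x| <= M) ->
  L1 (fun x => q x * ln (q x)) -> I (fun x => q x * ln (q x)) <= Iint q q ->
  I (fun x => q x * ln (q x)) <= 0.
Proof.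
move=> dq qM le hE; set E := I _ in hE *.
have [m0 hm0] := strict.
pose dl : R := m0.+1%:R^-1 - 2 * fhat W (d * m0.+1).
have dl0 : 0 < dl by rewrite subr_gt0.
have hlim (e : R) : 0 < e -> exists N0, forall L, (N0 <= L)%N ->
    E - e <= usum d q L - dl / 2 * nsq (ucoef d q m0.+1).
  move=> e0; have [N0 hN0] := inter_lim (dens_meas dq) qM e0.
  exists (maxn N0 (2 * m0.+1)) => L; rewrite geq_max => /andP[L1 L2].
  have := hN0 (d * L)%N; rewrite (leq_trans L1) ?leq_pmull // => /(_ isT).
  rewrite ler_norml => /andP[h _].
  have := @Wsum_le_usum_strict L q m0 dl _ (ltW dl0) _.
  rewrite mulnCA leq_pmul2l // L2 => /(_ isT).
  have -> : 2 * fhat W (d * m0.+1) <= m0.+1%:R^-1 - dl by rewrite /dl opprB addrC subrK.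
  move=> /(_ isT); lra.
have u0 := nsq_ge0 (ucoef d q m0.+1).
have um : nsq (ucoef d q m0.+1) = 0.
  apply/eqP; rewrite eq_le u0 andbT -(pmulr_rle0 _ (divr_gt0 dl0 (ltr0Sn R 1))).
  apply/ler_addgt0Pr => e /hlim[N0 /(_ N0 (leqnn _))].
  have := entropy_milin d0 dq le N0; rewrite -/E; lra.
have ueq : forall k, ucoef d q k.+1 = ucoef d q 1 ^+ k.+1.
  apply: (entropy_milin_eq d0 dq le) => e /hlim[N0 hN0]; exists N0 => N /hN0.
  by rewrite um -/E; lra.
have u1 : ucoef d q 1 = 0.
  by have /eqP := nsq_eq0 um; rewrite ueq expf_eq0 /= => /eqP.
apply/ler_addgt0Pr => e /hlim[N0 /(_ N0 (leqnn _))].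
rewrite um mulr0 subr0 (_ : usum d q N0 = 0); first by lra.
by apply: big1 => j _; rewrite ueq u1 expr0n /nsq /= expr0n addr0 mul0r.
Qed.

End Periodic.
End Interaction.

(** * Quantitative convexity of the entropy *)

Section EntropyConvexity.
Variable R : realType.
Local Notation T := (@Tor R).
Implicit Types (p q : R -> R).

Definition xlnx (x : R) : R := x * ln x.

(** The Bregman divergence of [x ln x] dominates the squared Hellinger distance. This is Young's
    inequality for [sqrt a] at [s = ln (sqrt m)], multiplied by [2 sqrt a]. *)
Lemma xlnx_hellinger (a m : R) : 0 <= a -> 0 < m ->
  xlnx m + (a - m) * (ln m + 1) + (Num.sqrt a - Num.sqrt m) ^+ 2 <= xlnx a.
Proof.
move=> a0 m0; set al := Num.sqrt a; set mu := Num.sqrt m.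
have al0 : 0 <= al by exact: sqrtr_ge0.
have mu0 : 0 < mu by rewrite sqrtr_gt0.
have aE : a = al ^+ 2 by rewrite sqr_sqrtr.
have mE : m = mu ^+ 2 by rewrite sqr_sqrtr // ltW.
have lm : ln m = 2 * ln mu by rewrite mE lnXn // mulr_natl.
have la : al * ln a = 2 * (al * ln al).
  move: al0; rewrite le_eqVlt => /predU1P[<-|al0]; first by rewrite !mul0r mulr0.
  by rewrite aE lnXn // -[ln al *+ 2]mulr_natl; ring.
have := xlnx_young (ln mu) al0; rewrite lnK // => h.
have h2 : 2 * al * (al * ln mu + al - mu) <= 2 * al * (al * ln al) by rewrite ler_wpM2l // mulr_ge0.
have xa : xlnx a = al * (2 * (al * ln al)) by rewrite /xlnx {1}aE expr2 -mulrA la.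
by rewrite xa /xlnx lm aE mE; move: h2; rewrite !expr2; lra.
Qed.

Lemma xlnx_defect_ge0 (a b : R) : 0 <= a -> 0 <= b ->
  xlnx ((a + b) / 2) <= (xlnx a + xlnx b) / 2.
Proof.
move=> a0 b0; have [m0|m0] := ltP 0 ((a + b) / 2); last first.
  have -> : a = 0 by lra.
  have -> : b = 0 by lra.
  by rewrite addr0 mul0r /xlnx mul0r addr0 mul0r.
have := xlnx_hellinger a0 m0; have := xlnx_hellinger b0 m0.
set m := (a + b) / 2 in m0 *.
have := sqr_ge0 (Num.sqrt a - Num.sqrt m); have := sqr_ge0 (Num.sqrt b - Num.sqrt m).
have -> : b - m = - (a - m) by rewrite /m; field.
lra.
Qed.

(* Stated in a form that integrates to an estimate of the L1 distance. *)
Lemma xlnx_defect (a b t : R) : 0 <= a -> 0 <= b -> 0 < t ->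
  `|a - b| <= ((xlnx a + xlnx b) / 2 - xlnx ((a + b) / 2)) / t + 2 * t * (a + b).
Proof.
move=> a0 b0 t0; have [m0|m0] := ltP 0 ((a + b) / 2); last first.
  have -> : a = 0 by lra.
  have -> : b = 0 by lra.
  by rewrite subrr normr0 addr0 mul0r /xlnx mul0r addr0 mul0r subrr mul0r mulr0 addr0.
have ha := xlnx_hellinger a0 m0; have hb := xlnx_hellinger b0 m0.
set m := (a + b) / 2 in m0 ha hb *.
(* Weighted arithmetic-geometric mean for [|u - v| (u + v)] with [u^2 = x], [v^2 = m], together with
   [(u + v)^2 <= 2 (x + m)]. *)
have key x : 0 <= x -> `|x - m| <= (Num.sqrt x - Num.sqrt m) ^+ 2 / (2 * t) + t * (x + m).
  move=> x0; set u := Num.sqrt x; set v := Num.sqrt m.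
  have u0 : 0 <= u by exact: sqrtr_ge0.
  have v0 : 0 <= v by exact: sqrtr_ge0.
  have -> : x = u ^+ 2 by rewrite sqr_sqrtr.
  have -> : m = v ^+ 2 by rewrite sqr_sqrtr // ltW.
  rewrite subr_sqr normrM (ger0_norm (addr_ge0 u0 v0)).
  have sn : `|u - v| ^+ 2 = (u - v) ^+ 2 by rewrite real_normK ?num_real.
  rewrite -sn; set n := `|u - v|.
  have t20 : 0 < 2 * t by rewrite mulr_gt0.
  rewrite -(ler_pM2r t20) (mulrDl (n ^+ 2 / (2 * t))) divfK ?gt_eqF //.
  have := sqr_ge0 (n - t * (u + v)).
  have := sqr_ge0 (t * (u - v)).
  rewrite !expr2; lra.
have ka := key _ a0; have kb := key _ b0.
have tri : `|a - b| <= `|a - m| + `|b - m|.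
  rewrite (_ : a - b = (a - m) - (b - m)); last by ring.
  exact: ler_normB.
have hs : (Num.sqrt a - Num.sqrt m) ^+ 2 + (Num.sqrt b - Num.sqrt m) ^+ 2 <=
  2 * ((xlnx a + xlnx b) / 2 - xlnx m).
  have hab : b - m = - (a - m) by rewrite /m; field.
  by move: hb; rewrite hab; lra.
have t2 : 0 < (2 * t)^-1 by rewrite invr_gt0 mulr_gt0.
have := hs; rewrite -(ler_pM2r t2) => hs'.
have e1 : 2 * ((xlnx a + xlnx b) / 2 - xlnx m) / (2 * t) = ((xlnx a + xlnx b) / 2 - xlnx m) / t.
  by field; rewrite gt_eqF.
have e2 : t * (a + m) + t * (b + m) = 2 * t * (a + b) by rewrite /m; field.
by move: hs'; rewrite e1 mulrDl; lra.
Qed.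

Definition Ent q : R := I (fun x => xlnx (q x)).

Lemma L1_mid p q : is_density p -> is_density q ->
  L1 (fun x => xlnx (p x)) -> L1 (fun x => xlnx (q x)) ->
  is_density (fun x => (p x + q x) / 2) /\ L1 (fun x => xlnx ((p x + q x) / 2)).
Proof.
move=> dp dq lp lq.
have l1 : L1 (fun x => (p x + q x) / 2).
  have := L1Z 2^-1 (L1D (dens_L1 dp) (dens_L1 dq)); apply: eq_L1 => x _; by rewrite mulrC.
have mm : measurable_fun setT (fun x => (p x + q x) / 2).
  by apply: measurable_funM => //; apply: measurable_funD; [exact: dens_meas dp|exact: dens_meas dq].
split.
  split=> //; split; first by move=> x Tx; rewrite divr_ge0 // addr_ge0 // ?(dens_ge0 dp) ?(dens_ge0 dq).
  split; first exact: l1.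
  transitivity (I (fun x => 2^-1 * (p x + q x))); first by apply: eq_I => x _; rewrite mulrC.
  rewrite (IZ _ (L1D (dens_L1 dp) (dens_L1 dq))) (ID (dens_L1 dp) (dens_L1 dq)).
  by rewrite (dens_I dp) (dens_I dq); field.
apply: (@L1_le _ _ (fun x => (`|xlnx (p x)| + `|xlnx (q x)|) + 1)).
- by apply: measurable_xlnx; exact: measurable_funTS.
- move=> x Tx; have p0 := dens_ge0 dp Tx; have q0 := dens_ge0 dq Tx.
  have h1 := xlnx_defect_ge0 p0 q0.
  have m0 : 0 <= (p x + q x) / 2 by rewrite divr_ge0 // addr_ge0.
  have h2 := xlnx_young 0 m0; rewrite expR0 mulr0 add0r in h2.
  have := ler_norm (xlnx (p x)); have := ler_norm (xlnx (q x)).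
  have := normr_ge0 (xlnx (p x)); have := normr_ge0 (xlnx (q x)).
  rewrite -/(xlnx ((p x + q x) / 2)) in h2.
  by rewrite ler_norml => *; apply/andP; split; lra.
- by apply: L1D; [apply: L1D; exact: L1_norm|exact: L1_cst].
Qed.

(** The mass [2] of [p + q] yields the term [4 * t]. With [t] of the order of the square root of the
    midpoint defect, near-minimisers of the entropy on a convex set are close in L1. *)
Lemma L1_dist_defect p q (t : R) : is_density p -> is_density q ->
  L1 (fun x => xlnx (p x)) -> L1 (fun x => xlnx (q x)) -> 0 < t ->
  I (fun x => `|p x - q x|) <= ((Ent p + Ent q) / 2 - Ent (fun x => (p x + q x) / 2)) / t + 4 * t.
Proof.
move=> dp dq lp lq t0; have [dm lm] := L1_mid dp dq lp lq.
have lpq := L1D (dens_L1 dp) (dens_L1 dq).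
pose D x := t^-1 * (2^-1 * (xlnx (p x) + xlnx (q x)) - xlnx ((p x + q x) / 2)).
have lD : L1 D by apply: L1Z; apply: L1B => //; apply: L1Z; exact: L1D.
have -> : ((Ent p + Ent q) / 2 - Ent (fun x => (p x + q x) / 2)) / t + 4 * t =
  I (fun x => D x + 2 * t * (p x + q x)).
  rewrite (ID lD (L1Z _ lpq)) (IZ _ lpq) (ID (dens_L1 dp) (dens_L1 dq)) (dens_I dp) (dens_I dq).
  rewrite /D (IZ _ (L1B (L1Z _ (L1D lp lq)) lm)) (IB (L1Z _ (L1D lp lq)) lm).
  by rewrite (IZ _ (L1D lp lq)) (ID lp lq) -/(Ent p) -/(Ent q) -/(Ent (fun x => (p x + q x) / 2)); field; rewrite gt_eqF.
apply: I_le.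
- by apply: L1_norm; apply: L1B; [exact: dens_L1 dp|exact: dens_L1 dq].
- by apply: L1D => //; exact: L1Z.
move=> x Tx; rewrite /D mulrC (mulrC 2^-1).
exact: (xlnx_defect (dens_ge0 dp Tx) (dens_ge0 dq Tx) t0).
Qed.

Lemma Ent_ge0 q : is_density q -> L1 (fun x => xlnx (q x)) -> 0 <= Ent q.
Proof.
move=> dq lq.
have -> : 0 = I (fun x => q x - 1) by rewrite (IB (dens_L1 dq) (L1_cst 1)) I_cst (dens_I dq) subrr.
apply: I_le => // [|x Tx]; first by apply: L1B; [exact: dens_L1|exact: L1_cst].
by have := xlnx_young 0 (dens_ge0 dq Tx); rewrite expR0 mulr0 add0r.
Qed.

Lemma is_density_qu : is_density (@qu R).
Proof.
split; first exact: measurable_cst.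
split; first by move=> x _; rewrite /qu.
by split; [exact: (@L1_cst R 1)|exact: (I_cst (1 : R))].
Qed.

Lemma xlnx_qu : (fun x : R => xlnx (qu x)) = fun=> 0.
Proof. by apply/funext => x; rewrite /xlnx /qu ln1 mulr0. Qed.

Lemma Ent_qu : Ent (@qu R) = 0.
Proof. by rewrite /Ent xlnx_qu I_cst. Qed.

Lemma L1_xlnx_qu : L1 (fun x => xlnx (@qu R x)).
Proof. by rewrite xlnx_qu; exact: L1_cst. Qed.

(** The previous estimate against the uniform density, whose entropy is [0]; the midpoint has
    nonnegative entropy. *)
Lemma pinsker q (t : R) : is_density q -> L1 (fun x => xlnx (q x)) -> 0 < t ->
  I (fun x => `|q x - 1|) <= Ent q / t + 4 * t.
Proof.
move=> dq lq t0; have := L1_dist_defect dq is_density_qu lq L1_xlnx_qu t0.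
have [dm lm] := L1_mid dq is_density_qu lq L1_xlnx_qu.
move=> /le_trans; apply; rewrite lerD2r ler_pM2r ?invr_gt0 //.
by have := Ent_ge0 dm lm; have := Ent_ge0 dq lq; rewrite Ent_qu; lra.
Qed.

Lemma Ent_le0 q : is_density q -> L1 (fun x => xlnx (q x)) -> Ent q <= 0 -> dens_eq q (@qu R).
Proof.
move=> dq lq E0.
have l1 : L1 (fun x => `|q x - 1|) by apply: L1_norm; apply: L1B; [exact: dens_L1|exact: L1_cst].
have I0 : I (fun x => `|q x - 1|) = 0.
  apply/eqP; rewrite eq_le I_ge0 // andbT; apply/ler_addgt0Pr => e e0.
  have e40 : 0 < e / 4 by rewrite divr_gt0.
  have := pinsker dq lq e40; have : Ent q / (e / 4) <= 0 by rewrite pmulr_lle0 // invr_gt0.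
  lra.
have := I_eq0 l1 (fun x _ => normr_ge0 _) I0.
by apply: aeS => x h Tx; move/eqP: (h Tx); rewrite normr_eq0 subr_eq0 => /eqP.
Qed.

End EntropyConvexity.

(** * Probability measures on the torus *)

Section ProbabilityOnTorus.
Variable R : realType.
Local Notation mu := (@lebesgue_measure R).
Local Notation T := (@Tor R).
Local Notation RR := (measurableTypeR R * measurableTypeR R)%type.
Implicit Types (P : probability R R).

Lemma maxr_subN (z : R) : Num.max z 0 - Num.max (- z) 0 = z.
Proof. by case: (leP 0 z) => z0; [rewrite max_r|rewrite max_l]; lra. Qed.

Lemma tonelli_prob P (G : RR -> \bar R) : measurable_fun setT G -> (forall z, 0 <= G z)%E ->
  (\int[P \x P]_(z in T `*` T) G z = \int[P]_(x in T) \int[P]_(y in T) G (x, y))%E.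
Proof.
move=> mG G0.
rewrite integral_mkcond fubini_tonelli1; last 2 first.
- by apply/(measurable_restrictT _ _).1; [exact: measurable_T2|exact: measurable_funTS].
- by move=> z; rewrite patchE; case: ifPn.
rewrite [RHS]integral_mkcond; apply: eq_integral => x _.
rewrite /fubini_F [RHS]patchE; case: ifPn => xT; last first.
  rewrite integral0_eq // => y _; rewrite patchE ifF //.
  by apply/negbTE; apply: contra xT => /set_mem[/= h _]; exact/mem_set.
rewrite [RHS]integral_mkcond; apply: eq_integral => y _.
rewrite !patchE; congr (if _ then _ else _).
by apply/idP/idP => /set_mem => [[_ h]|h]; apply/mem_set => //; split => //; exact: set_mem xT.
Qed.

(** A single atom would see only [W 0]; two equal atoms bring [W x] into the interaction energy. *)
Definition atom2 (x : R) : set R -> \bar R :=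
  mscale (2^-1)%:nng (measure_add (\d_(0 : R)) (\d_(x : R))).

HB.instance Definition _ x := Measure.on (atom2 x).

Lemma atom2_setT x : atom2 x setT = 1%E.
Proof.
rewrite /atom2 /mscale /= /msum 2!big_ord_recl big_ord0 /= !diracT adde0 -EFinD -EFinM; congr (_%:E); lra.
Qed.

HB.instance Definition _ x := @Measure_isProbability.Build _ _ R (atom2 x) (atom2_setT x).

Lemma atom2_T x : T x -> prob_on_T (atom2 x : probability R R).
Proof.
move=> Tx; have T0 : T 0 by apply/TorP; lra.
rewrite /prob_on_T /= /atom2 /mscale /= /msum 2!big_ord_recl big_ord0 /= adde0 !diracE !mem_set //= -EFinD -EFinM; congr (_%:E); lra.
Qed.

Lemma ge0_integral_atom2 x (f : R -> R) : T x -> measurable_fun setT f -> (forall y, 0 <= f y) ->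
  (\int[atom2 x]_(y in T) (f y)%:E = ((f 0 + f x) / 2)%:E)%E.
Proof.
move=> Tx mf f0; have T0 : T 0 by apply/TorP; lra.
have mT := @measurable_Tor R.
have mE : measurable_fun T (EFin \o f) by apply/measurable_EFinP; exact: measurable_funTS.
rewrite ge0_integral_mscale //; last by move=> y _; rewrite lee_fin.
rewrite ge0_integral_measure_add //; last by move=> y _; rewrite lee_fin.
rewrite !integral_dirac // !diracE !mem_set // !mul1e -EFinD -EFinM mulrC //.
Qed.

Lemma integral_atom2 x (f : R -> R) : T x -> measurable_fun setT f ->
  (\int[atom2 x]_(y in T) (f y)%:E = ((f 0 + f x) / 2)%:E)%E.
Proof.
move=> Tx mf; rewrite integralE.
have mp : measurable_fun setT (fun y => Num.max (f y) 0) by exact: measurable_maxr.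
have mn : measurable_fun setT (fun y => Num.max (- f y) 0).
  by apply: measurable_maxr => //; exact: measurableT_comp.
rewrite (_ : (fun y => (f y)%:E)^\+%E = fun y => (Num.max (f y) 0)%:E); last first.
  by apply/funext => y; rewrite funeposE EFin_max.
rewrite (_ : (fun y => (f y)%:E)^\-%E = fun y => (Num.max (- f y) 0)%:E); last first.
  by apply/funext => y; rewrite funenegE -EFinN EFin_max.
rewrite !ge0_integral_atom2 //; try by move=> y; rewrite le_max lexx orbT.
rewrite -EFinB; congr (_%:E).
by rewrite -mulrBl -{3}(maxr_subN (f 0)) -{3}(maxr_subN (f x)); congr (_ / _); ring.
Qed.

Lemma weak_cvg_atom2 (x_ : nat -> R) x : (forall n, T (x_ n)) -> T x ->
  (forall f : R -> R, continuous f -> periodic1 f -> f (x_ n) @[n --> \oo] --> f x) ->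
  weak_cvg (fun n => atom2 (x_ n) : probability R R) (atom2 x).
Proof.
move=> Tn Tx cf f fc fp.
have mf : measurable_fun setT f by exact: continuous_measurable_fun.
have h y : T y -> \int[atom2 y]_(z in T) f z = (f 0 + f y) / 2 by move=> Ty; rewrite /Rintegral integral_atom2.
rewrite h //; under eq_cvg do rewrite h //.
apply: cvgMl; apply: cvgD; [exact: cvg_cst|exact: cf].
Qed.

(** Separating the signs first lets Tonelli apply to each part, whatever the integrability of
    [V]. *)
Lemma inter_meas_split P (V : R -> R) : measurable_fun setT V ->
  inter_meas P V =
  (\int[P]_(x in T) \int[P]_(y in T) (Num.max (V (x - y)) 0)%:E -
   \int[P]_(x in T) \int[P]_(y in T) (Num.max (- V (x - y)) 0)%:E)%E.
Proof.
move=> mV; rewrite /inter_meas integralE.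
have mVV : measurable_fun (setT : set RR) (fun z : RR => V (z.1 - z.2)).
  by apply: measurableT_comp => //; apply: measurable_funB; [exact: measurable_fst|exact: measurable_snd].
rewrite (_ : (fun z : R * R => (V (z.1 - z.2))%:E)^\+%E = fun z => (Num.max (V (z.1 - z.2)) 0)%:E); last first.
  by apply/funext => y; rewrite funeposE EFin_max.
rewrite (_ : (fun z : R * R => (V (z.1 - z.2))%:E)^\-%E = fun z => (Num.max (- V (z.1 - z.2)) 0)%:E); last first.
  by apply/funext => y; rewrite funenegE -EFinN EFin_max.
rewrite !tonelli_prob //.
- by apply/measurable_EFinP; apply: measurable_maxr => //; exact: measurableT_comp.
- by move=> z; rewrite lee_fin le_max lexx orbT.
- by apply/measurable_EFinP; apply: measurable_maxr.
- by move=> z; rewrite lee_fin le_max lexx orbT.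
Qed.

Lemma inter_meas_atom2 x (V : R -> R) : T x -> measurable_fun setT V -> (forall y, V (- y) = V y) ->
  inter_meas (atom2 x : probability R R) V = ((V 0 + V x) / 2)%:E.
Proof.
move=> Tx mV eV; rewrite inter_meas_split //.
have key (U : R -> R) : measurable_fun setT U -> (forall y, U (- y) = U y) -> (forall y, 0 <= U y) ->
  (\int[atom2 x]_(a in T) \int[atom2 x]_(b in T) (U (a - b))%:E = ((U 0 + U x) / 2)%:E)%E.
  move=> mU eU U0.
  transitivity (\int[atom2 x]_(a in T) ((U a + U (a - x)) / 2)%:E)%E.
    apply: eq_integral => a _; rewrite ge0_integral_atom2 ?subr0 //.
    by apply: measurableT_comp => //; apply: measurable_funB => //; exact: measurable_cst.
  rewrite ge0_integral_atom2 //; first by rewrite subrr sub0r eU; congr (_%:E); lra.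
  - apply: measurable_funM => //; apply: measurable_funD => //.
    by apply: measurableT_comp => //; apply: measurable_funB => //; exact: measurable_cst.
  - by move=> y; rewrite divr_ge0 // addr_ge0.
rewrite (key (fun y => Num.max (V y) 0)); last 3 first.
- exact: measurable_maxr.
- by move=> y; rewrite eV.
- by move=> y; rewrite le_max lexx orbT.
rewrite (key (fun y => Num.max (- V y) 0)); last 3 first.
- by apply: measurable_maxr => //; exact: measurableT_comp.
- by move=> y; rewrite eV.
- by move=> y; rewrite le_max lexx orbT.
rewrite -EFinB; congr (_%:E).
by rewrite -mulrBl -{3}(maxr_subN (V 0)) -{3}(maxr_subN (V x)); congr (_ / _); ring.
Qed.

Lemma increasing_seq_ge (s : nat -> nat) n : increasing_seq s -> (n <= s n)%N.
Proof.
move=> si; elim: n => // n IH; apply: leq_ltn_trans IH _.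
by have /increasing_seqP := si; exact.
Qed.

(* Semicontinuity is tested on [(delta_0 + delta_x) / 2], whose interaction
   energy is [(W 0 + W x) / 2]. *)
Lemma usc_bounded_above (W : R -> R) : measurable_fun setT W -> periodic1 W ->
  (forall y, W (- y) = W y) -> inter_usc W -> exists2 B : R, 0 <= B & forall x, W x <= B.
Proof.
move=> mW pW eW uW.
suff [B hB] : exists B : R, forall x, T x -> W x <= B.
  exists (Num.max B 0) => [|x]; first by rewrite le_max lexx orbT.
  rewrite le_max; apply/orP; left.
  have := @per_int R W (- Num.floor (x + 2^-1)) x pW => <-; apply: hB; apply/TorP.
  have := Num.Theory.floor_le_tmp (x + 2^-1); have := Num.Theory.floorD1_gt (x + 2^-1).
  by rewrite mulrNz rmorphD /= => *; apply/andP; split; lra.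
apply/not_existsP => nB.
have xP (j : nat) : {x | T x /\ j%:R < W x}.
  apply/cid; apply/not_existsP => h; apply: (nB j%:R) => x Tx.
  by rewrite leNgt; apply/negP => wx; apply: (h x).
pose x_ j := sval (xP j).
have Tx j : T (x_ j) by have [] := svalP (xP j).
have Wx j : j%:R < W (x_ j) by have [] := svalP (xP j).
have [|s si /cvg_ex[l xl]] := @bolzano_weierstrass R x_.
  exists 1; split; first by rewrite num_real.
  move=> y y1 j _; have /TorP := Tx j; rewrite /= ler_norml => /andP[*]; apply/andP; split; lra.
have l1 : - 2^-1 <= l.
  by apply: (cvgr_to_ge xl); near=> n; have /TorP/andP[] := Tx (s n).
have l2 : l <= 2^-1.
  by apply: (cvgr_to_le xl); near=> n; have /TorP/andP[_ /ltW] := Tx (s n).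
(* The limit may be the excluded end point [1/2], which on the torus is the point [-1/2]. *)
pose l' := if l == 2^-1 then - 2^-1 else l.
have Tl : T l'.
  apply/TorP; rewrite /l'; case: eqP => [_|/eqP ll]; first by lra.
  by rewrite l1 lt_neqAle ll l2.
have cf (f : R -> R) : continuous f -> periodic1 f -> f (x_ (s n)) @[n --> \oo] --> f l'.
  move=> fc fp; have -> : f l' = f l.
    rewrite /l'; case: eqP => // ->; rewrite -(fp (- 2^-1)); congr f; lra.
  by apply: cvg_comp; [exact: xl|exact: fc].
have := uW _ _ (fun n => atom2_T (Tx (s n))) (atom2_T Tl) (weak_cvg_atom2 (fun n => Tx (s n)) Tl cf).
rewrite inter_meas_atom2 //.
rewrite (_ : (fun n => inter_meas _ W) = fun n => ((W 0 + W (x_ (s n))) / 2)%:E); last first.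
  by apply/funext => n; rewrite inter_meas_atom2.
(* The energies diverge along the sequence, while semicontinuity bounds their upper limit by the
   finite energy of the limit measure. *)
have cy : ((W 0 + W (x_ (s n))) / 2)%:E @[n --> \oo] --> +oo%E.
  apply/cvgeryP/cvgryPge => A; near=> n.
  have h : 2 * `|A| + `|W 0| <= n%:R by near: n; exact: nbhs_infty_ger.
  have := Wx (s n); have : n%:R <= (s n)%:R :> R.
    by rewrite ler_nat increasing_seq_ge.
  have := ler_norm A; have := ler_norm (- W 0); rewrite normrN; lra.
by rewrite (cvg_limn_einf_sup cy).2 leye_eq.
Unshelve. all: by end_near. Qed.

End ProbabilityOnTorus.

(** * Comparison of interaction energy and entropy *)

Section ProductTorusOrder.
Variable R : realType.
Local Notation mu := (@lebesgue_measure R).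
Local Notation T := (@Tor R).
Local Notation mu2 := (mu \x mu)%E.
Local Notation RR := (measurableTypeR R * measurableTypeR R)%type.
Implicit Types F G : R -> R -> R.

Lemma eq_I2 F G : (forall x y, T x -> T y -> F x y = G x y) -> I2 F = I2 G.
Proof.
by move=> FG; congr fine; apply: eq_integral => -[x y] /set_mem[/= Tx Ty]; rewrite FG.
Qed.

Lemma L12Z c F : L12 F -> L12 (fun x y => c * F x y).
Proof.
move=> lF; have := integrableZl (@measurable_T2 R) c lF.
by apply: eq_integrable => // z _; rewrite EFinM.
Qed.

Lemma I2Z c F : L12 F -> I2 (fun x y => c * F x y) = c * I2 F.
Proof.
move=> lF; apply: EFin_inj; rewrite EFinM !EFin_I2 //; last exact: L12Z.
by rewrite -integralZl //; apply: eq_integral => z _; exact: EFinM.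
Qed.

Lemma I2_ge0 F : (forall x y, T x -> T y -> 0 <= F x y) -> 0 <= I2 F.
Proof.
move=> F0; apply: fine_ge0; apply: integral_ge0 => -[x y] [/= Tx Ty].
by rewrite lee_fin F0.
Qed.

Lemma I2_le F G : L12 F -> L12 G -> (forall x y, T x -> T y -> F x y <= G x y) -> I2 F <= I2 G.
Proof.
move=> lF lG FG; rewrite -subr_ge0 -I2B //; apply: I2_ge0 => x y Tx Ty.
by rewrite subr_ge0 FG.
Qed.

Lemma meas2_prod (p r : R -> R) : measurable_fun setT p -> measurable_fun setT r ->
  meas2 (fun x y => p x * r y).
Proof.
move=> mp mr; rewrite /meas2; apply: measurable_funM.
- by apply: measurableT_comp => //; exact: measurable_fst.
- by apply: measurableT_comp => //; exact: measurable_snd.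
Qed.

Lemma L12_prod (p r : R -> R) : measurable_fun setT p -> measurable_fun setT r -> L1 p -> L1 r ->
  L12 (fun x y => p x * r y) /\ I2 (fun x y => p x * r y) = I p * I r.
Proof.
move=> mp mr lp lr.
have l : L12 (fun x y => p x * r y).
  apply: (@L12_bound _ _ (fun x => I (fun y => `|r y|) * `|p x|)).
  - exact: meas2_prod.
  - by move=> x _; exact: L1Z.
  - by apply: L1Z; exact: L1_norm.
  - move=> x _; rewrite (eq_I (g := fun y => `|p x| * `|r y|)); last by move=> y _; rewrite normrM.
    by rewrite IZ; [rewrite mulrC|exact: L1_norm].
split=> //; have [_ ->] := I2E l (fun x _ => L1Z (p x) lr).
rewrite (eq_I (g := fun x => I r * p x)); last by move=> x _; rewrite IZ // mulrC.
by rewrite IZ // mulrC.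
Qed.

(** The integrable majorant makes the positive part integrable, so only the value [-oo] can prevent
    integrability. *)
Lemma integral2_cases F G : meas2 F -> L12 G -> (forall x y, T x -> T y -> F x y <= G x y) ->
  (\int[mu2]_(z in T `*` T) (F z.1 z.2)%:E)%E = -oo%E \/
  (L12 F /\ (\int[mu2]_(z in T `*` T) (F z.1 z.2)%:E)%E = (I2 F)%:E).
Proof.
move=> mF lG FG; pose f (z : RR) := (F z.1 z.2)%:E.
have mf : measurable_fun (T `*` T : set RR) f by apply/measurable_EFinP; exact: measurable_funTS.
have fp : (\int[mu2]_(z in T `*` T) f^\+ z < +oo)%E.
  case/integrableP: lG => mG; apply: le_lt_trans; apply: ge0_le_integral => //.
  - exact: measurable_funepos.
  - by apply: measurableT_comp.
  - move=> [x y] [/= Tx Ty]; rewrite funeposE /f /=.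
    rewrite -EFin_max lee_fin ge_max normr_ge0 andbT.
    exact: le_trans (FG _ _ Tx Ty) (ler_norm _).
have [fn|] := boolP ((\int[mu2]_(z in T `*` T) f^\- z) < +oo)%E.
  right; have lF : L12 F.
    apply/integrableP; split => //.
    rewrite (_ : integral _ _ _ = \int[mu2]_(z in T `*` T) (f^\+ z + f^\- z))%E.
      rewrite ge0_integralD //; first exact: lte_add_pinfty.
      - exact: measurable_funepos.
      - exact: measurable_funeneg.
    by apply: eq_integral => z _; rewrite -[RHS]/((f^\+ \+ f^\-)%E z) -fune_abse.
  by split => //; rewrite EFin_I2.
rewrite -leNgt leye_eq => /eqP fn; left.
rewrite -/(f _) integralE fn; case: (integral _ _ _) fp => //= r _.
Qed.

End ProductTorusOrder.

(** * From bounded to arbitrary densities *)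

Section Coercivity.
Variable R : realType.
Local Notation T := (@Tor R).
Variables (W : R -> R).
Hypotheses (mW : measurable_fun setT W) (pW : periodic1 W) (lW : L1 W).
Hypotheses (eW : forall x, W (- x) = W x) (aW : I W = 0).
Variable B : R.
Hypotheses (B0 : 0 <= B) (WB : forall x, W x <= B).
Implicit Types (p q : R -> R).

Lemma interP q : is_density q -> inter W q = -oo%E \/
  (L12 (fun x y => W (x - y) * q x * q y) /\ inter W q = (Iint W q q)%:E).
Proof.
move=> dq; have mq := dens_meas dq; have lq := dens_L1 dq.
apply: (@integral2_cases _ (fun x y => W (x - y) * q x * q y) (fun x y => B * (q x * q y))).
- exact: meas2_conv.
- by apply: L12Z; have [] := L12_prod mq mq lq lq.
- by move=> x y Tx Ty; rewrite -mulrA ler_wpM2r // mulr_ge0 // (dens_ge0 dq).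
Qed.

Lemma Iint_le_B q : is_density q -> L12 (fun x y => W (x - y) * q x * q y) -> Iint W q q <= B.
Proof.
move=> dq l; have mq := dens_meas dq; have lq := dens_L1 dq.
have [l2 e2] := L12_prod mq mq lq lq.
have -> : B = I2 (fun x y => B * (q x * q y)) by rewrite I2Z // e2 (dens_I dq) !mulr1.
apply: I2_le => //; first exact: L12Z.
by move=> x y Tx Ty; rewrite -mulrA ler_wpM2r // mulr_ge0 // (dens_ge0 dq).
Qed.

(* With equality for every [m], the Fejer means of [W] at [0] would be divergent
   harmonic sums, although they are bounded by [B]. *)
Lemma strict_decay d : (0 < d)%N -> (forall x, W (x + d%:R^-1) = W x) ->
  (forall k : nat, (0 < k)%N -> 2 * fhat W k <= d%:R / k%:R) ->
  exists m0, 2 * fhat W (d * m0.+1) < m0.+1%:R^-1.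
Proof.
move=> d0 Wd decay; apply: contrapT => /forallNP h.
have eqh m : 2 * fhat W (d * m.+1) = m.+1%:R^-1.
  apply/eqP; rewrite eq_le (decay_mult d0 decay m) /= leNgt.
  by apply/negP; exact: h.
(* The Fejer weight lowers [1/(m+1)] by [d / (d L + 1) <= 1/L]; the [L] errors add up to at most
   [1]. *)
have hb L : \sum_(m < L) (m.+1%:R^-1 : R) <= B + 1.
  have h1 : I (fun x => W x * FK (d * L) x) =
      \sum_(k < d * L) rho R (d * L) k.+1 * (2 * fhat W k.+1).
    rewrite (eq_I (g := fun x => W x + \sum_(k < d * L) (2 * rho R (d * L) k.+1) * (W x * ck k.+1 x))); last first.
      move=> x _; rewrite /FK mulrDr mulr1; congr (_ + _).
      by rewrite !mulr_sumr; apply: eq_bigr => k _; ring.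
    have ls : L1 (fun x => \sum_(k < d * L) (2 * rho R (d * L) k.+1) * (W x * ck k.+1 x)).
      by apply: L1_sum => k _; apply: L1Z; exact: L1_mulck.
    rewrite ID // aW add0r I_sum => [|k _]; last by apply: L1Z; exact: L1_mulck.
    by apply: eq_bigr => k _; rewrite IZ ?fhatE; [ring|exact: L1_mulck].
  have h2 : I (fun x => W x * FK (d * L) x) <= B.
    have -> : B = I (fun x => B * FK (d * L) x) by rewrite IZ ?I_FK ?mulr1 //; exact: L1_FK.
    apply: I_le.
    - apply: (@L1_mulb _ _ _ (d * L).+1%:R) => //; first exact: measurable_FK.
      by move=> x _; exact: FK_norm.
    - by apply: L1Z; exact: L1_FK.
    - by move=> x _; rewrite ler_wpM2r // FK_ge0.
  rewrite h1 (sum_multiples d0 (g := fun k => rho R (d * L) k * (2 * fhat W k))) in h2; last first.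
    by move=> k dk; rewrite (fhat_nmult mW pW lW eW d0 Wd dk) !mulr0.
  apply: le_trans (_ : _ <= \sum_(m < L) (rho R (d * L) (d * m.+1) * (2 * fhat W (d * m.+1)) + L%:R^-1)) _.
    apply: ler_sum => m _; rewrite eqh /rho.
    have L0 : (0 < L)%N by case: (L) m => [[]//|].
    have dL : d%:R / (d * L).+1%:R <= L%:R^-1 :> R.
      rewrite ler_pdivrMr ?ltr0n // mulrC ler_pdivlMr ?ltr0n // -natrM ler_nat.
      exact: leqnSn.
    have m0 : m.+1%:R != 0 :> R by rewrite pnatr_eq0.
    rewrite natrM mulrBl mul1r (_ : d%:R * m.+1%:R / (d * L).+1%:R / m.+1%:R = d%:R / (d * L).+1%:R); first by set x := m.+1%:R^-1; set y := d%:R / _ in dL *; set z := L%:R^-1 in dL *; move: dL; lra.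
    by rewrite -mulrA (mulrC _^-1) mulrA mulfK.
  rewrite big_split /= lerD // sumr_const card_ord -[X in X <= _]mulr_natr.
  by case: (L) => [|L']; [rewrite mulr0|rewrite mulVf // pnatr_eq0].
apply: (@dvg_harmonic R); apply: nondecreasing_is_cvgn.
  by apply: nondecreasing_series => n _ _; rewrite /harmonic /= invr_ge0.
exists (B + 1) => _ [n _ <-]; rewrite /series /= big_mkord; exact: hb.
Qed.

Section Truncation.
Variable d : nat.
Hypothesis d0 : (0 < d)%N.
Hypothesis Wd : forall x, W (x + d%:R^-1) = W x.
Hypothesis decay : forall k : nat, (0 < k)%N -> 2 * fhat W k <= d%:R / k%:R.

(* [g] is [q] cut off at a high level [M]: the entropy removed exceeds any fixed
   multiple of the removed mass [1 - I g]. *)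
Lemma truncation q : is_density q -> L1 (fun x => xlnx (q x)) ->
  L12 (fun x y => W (x - y) * q x * q y) ->
  exists (g : R -> R) (M : R), [/\ measurable_fun setT g,
    forall x, T x -> 0 <= g x <= q x /\ g x <= M,
    Iint W q q <= Ent q - (1 - I g) &
    Iint W q q <= Iint W g g + B * (1 - I g ^+ 2)].
Proof.
move=> dq lq l12; have mq := dens_meas dq; have Lq := dens_L1 dq.
have E0 := Ent_ge0 dq lq; set E := Ent q in E0 *.
(* With [a] the removed mass, the removed entropy is at least [a * lM]. The part [2 * E] ensures
   [a <= 1/2], so half of it survives the factor [m = 1 - a]: then [2 * B] pays for the lost
   interaction, and [2] for the normalisation and the claimed gain [a]. *)
pose lM : R := 4 * B + 4 + 2 * E.
have lM0 : 0 < lM by rewrite /lM ltr_wpDr ?mulr_ge0 // ltr_wpDl ?mulr_ge0.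
pose M := expR lM.
pose g x := if q x <= M then q x else 0.
pose b x := if q x <= M then 0 else q x.
have mg : measurable_fun setT g.
  apply: (measurable_fun_ifT (f := fun x => q x <= M)) => //.
  apply: measurable_fun_ler => //; exact: measurable_cst.
have gq x : T x -> 0 <= g x <= q x.
  by move=> Tx; have q0 := dens_ge0 dq Tx; rewrite /g; case: ifP => _; rewrite ?lexx ?q0.
have M0 : 0 < M by exact: expR_gt0.
have gM x : g x <= M by rewrite /g; case: ifP => // _; exact: ltW.
have gn x : T x -> `|g x| <= M by move=> Tx; case/andP: (gq x Tx) => g0 _; rewrite ger0_norm.
have gb x : q x = g x + b x by rewrite /g /b; case: ifP => _; rewrite ?addr0 ?add0r.
have Lg : L1 g by apply: (L1_bounded (M := M)) => //; exact: measurable_funTS.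
have Lb : L1 b by have := L1B Lq Lg; apply: eq_L1 => x _; rewrite gb addrC addKr.
have b0 x : T x -> 0 <= b x by move=> Tx; have := dens_ge0 dq Tx; rewrite /b; case: ifP.
have Lxg : L1 (fun x => xlnx (g x)).
  apply: (L1_le (g := fun x => `|xlnx (q x)|)); last exact: L1_norm.
  - by apply: measurable_xlnx; exact: measurable_funTS.
  - by move=> x _; rewrite /g; case: ifP => // _; rewrite /xlnx mul0r normr0.
have xgb x : xlnx (q x) = xlnx (g x) + xlnx (b x).
  by rewrite /g /b /xlnx; case: ifP => _; rewrite mul0r ?addr0 ?add0r.
have Lxb : L1 (fun x => xlnx (b x)).
  by have := L1B lq Lxg; apply: eq_L1 => x _; rewrite xgb addrC addKr.
pose a := I b; pose m := I g.
have am : m = 1 - a.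
  have := dens_I dq; rewrite (eq_I (g := fun x => g x + b x)) ?ID // -/m -/a; lra.
have a0 : 0 <= a by exact: I_ge0.
have hb : a * lM <= I (fun x => xlnx (b x)).
  rewrite mulrC /a -IZ //; apply: I_le => //; first exact: L1Z.
  move=> x Tx; rewrite /b /xlnx; case: ifP => [_|/negbT]; first by rewrite mulr0 mul0r.
  rewrite -ltNge => qM; rewrite mulrC ler_pM2l; last exact: lt_trans qM.
  by rewrite -[lM]expRK ler_ln ?posrE // ?(lt_trans M0) // ltW.
have hE : E = I (fun x => xlnx (g x)) + I (fun x => xlnx (b x)).
  by rewrite /E /Ent (eq_I (g := fun x => xlnx (g x) + xlnx (b x))) ?ID.
have hg1 : m - 1 <= I (fun x => xlnx (g x)).
  rewrite /m -[1 in X in X <= _](@I_cst R) -IB //; last exact: L1_cst.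
  apply: I_le => //; first by apply: L1B => //; exact: L1_cst.
  move=> x Tx; case/andP: (gq x Tx) => g0 _.
  by have := xlnx_young 0 g0; rewrite expR0 mulr0 add0r.
have a1 : a <= 2^-1.
  have m0 : 0 <= m by apply: I_ge0 => x Tx; case/andP: (gq x Tx).
  have : a * lM <= E + 1 by move: hb hE hg1; lra.
  move=> h; rewrite -(ler_pM2r lM0); apply: le_trans h _.
  have e2 : 2^-1 * lM = E + 2 * B + 2 by rewrite /lM; field.
  rewrite e2; have : 0 <= 2 * B by rewrite mulr_ge0.
  lra.
have m0 : 0 < m by lra.
(* The cut-off function is normalised so that the inequality for bounded densities applies;
   [m >= 1/2] keeps this under control. *)
pose p x := m^-1 * g x.
have pM x : T x -> `|p x| <= m^-1 * M.
  by move=> Tx; rewrite normrM gtr0_norm ?invr_gt0 // ler_pM2l ?invr_gt0 // gn.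
have dp : is_density p.
  split; first by apply: measurable_funM => //; exact: measurable_cst.
  split; first by move=> x Tx; case/andP: (gq x Tx) => g0 _; rewrite mulr_ge0 // invr_ge0 ltW.
  split; first exact: L1Z.
  by rewrite -/(I p) IZ // -/m mulVf // gt_eqF.
have xp x : T x -> xlnx (p x) = m^-1 * xlnx (g x) - ln m * p x.
  move=> Tx; have [g0|g0] := eqVneq (g x) 0; first by rewrite /p /xlnx g0 !(mulr0, mul0r) subr0.
  have {}g0 : 0 < g x by rewrite lt_neqAle eq_sym g0; case/andP: (gq x Tx).
  rewrite /p /xlnx lnM ?posrE ?invr_gt0 // lnV ?posrE //; ring.
have Lxp : L1 (fun x => xlnx (p x)).
  by apply: (@eq_L1 _ (fun x => m^-1 * xlnx (g x) - ln m * p x)) => [x Tx|]; [rewrite xp|apply: L1B; apply: L1Z => //; exact: L1Z].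
have Ep : Ent p = m^-1 * I (fun x => xlnx (g x)) - ln m.
  rewrite /Ent (eq_I xp) IB; [|exact: L1Z|by apply: L1Z; exact: L1Z].
  by rewrite (IZ _ Lxg) (IZ _ (dens_L1 dp)) (dens_I dp) mulr1.
have lgg : L12 (fun x y => W (x - y) * g x * g y).
  by apply: (L12_conv mW pW lW (M := M)).
have Ip : Iint W p p = m^-1 ^+ 2 * Iint W g g.
  by rewrite /Iint -I2Z //; apply: eq_I2 => x y _ _; rewrite /p; ring.
have main : Iint W p p <= Ent p := bounded_inter_le mW pW lW eW aW d0 Wd decay dp pM Lxp.
have [l2q e2q] := L12_prod mq mq Lq Lq.
have [l2g e2g] := L12_prod mg mg Lg Lg.
(* The product of [q] dominates that of [g], so the removed part contributes at most [B] times its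
   mass. *)
have diff : Iint W q q <= Iint W g g + B * (1 - m ^+ 2).
  rewrite -lerBlDl /Iint -I2B //.
  have -> : B * (1 - m ^+ 2) = I2 (fun x y => B * (q x * q y - g x * g y)).
    by rewrite I2Z; [rewrite I2B // e2q e2g (dens_I dq) mulr1 expr2|exact: L12B].
  apply: I2_le; [exact: L12B|by apply: L12Z; exact: L12B|].
  move=> x y Tx Ty; rewrite -!mulrA -mulrBr ler_wpM2r // subr_ge0.
  by case/andP: (gq x Tx) => gx qx; case/andP: (gq y Ty) => gy qy; exact: ler_pM.
exists g, M; split=> //; first by move=> x Tx; split; [exact: gq|exact: gM].
have lnm : - (m ^+ 2 * ln m) <= m * a.
  have h := xlnx_young 0 (ltW m0); rewrite expR0 mulr0 add0r in h.
  have : m * (m - 1) <= m * (m * ln m) by rewrite ler_pM2l.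
  have -> : a = 1 - m by rewrite am subKr.
  by rewrite expr2; lra.
have hgg : Iint W g g <= m * I (fun x => xlnx (g x)) - m ^+ 2 * ln m.
  have e1 : Iint W g g = m ^+ 2 * Iint W p p by rewrite Ip; field; rewrite gt_eqF.
  have e2 : m * I (fun x => xlnx (g x)) - m ^+ 2 * ln m = m ^+ 2 * Ent p by rewrite Ep; field; rewrite gt_eqF.
  by rewrite e1 e2 ler_pM2l // exprn_gt0.
have h3 : m * (a * lM) <= m * I (fun x => xlnx (b x)) by rewrite ler_pM2l.
have h4 : 0 <= a * E by rewrite mulr_ge0.
have h5 : 0 <= a * a by rewrite mulr_ge0.
have h6 : a * (2^-1 * lM) <= a * (m * lM) by rewrite ler_wpM2l // ler_pM2r //; lra.
have h7 : 0 <= B * (a * a) by rewrite !mulr_ge0.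
have e8 : m * I (fun x => xlnx (g x)) = E - a * E - m * I (fun x => xlnx (b x)).
  rewrite {1 2}hE am; ring.
apply: le_trans diff _.
rewrite -/m; rewrite am in hgg lnm e8 h3 h6 *.
move: h6; rewrite /lM; rewrite /lM in h3.
lra.
Qed.

Lemma inter_le_Ent q : is_density q -> L1 (fun x => xlnx (q x)) ->
  L12 (fun x y => W (x - y) * q x * q y) -> Iint W q q <= Ent q.
Proof.
move=> dq lq l12; have [g [M [mg gq h _]]] := truncation dq lq l12.
apply: le_trans h _; rewrite gerBl subr_ge0 -(dens_I dq); apply: I_le.
- apply: (L1_bounded (M := M)) => [|x Tx]; first exact: measurable_funTS.
  by have [/andP[g0 _] gM] := gq x Tx; rewrite ger0_norm.
- exact: dens_L1.
- by move=> x Tx; have [/andP[]] := gq x Tx.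
Qed.

(** The gain [1 - I g] in [truncation] must vanish, so [q] equals the bounded [g] almost everywhere,
    and the equality case for bounded densities applies. *)
Lemma Ent_le_inter q : is_density q -> L1 (fun x => xlnx (q x)) ->
  L12 (fun x y => W (x - y) * q x * q y) -> Ent q <= Iint W q q -> dens_eq q (@qu R).
Proof.
move=> dq lq l12 Eq; have [g [M [mg gq h1 h2]]] := truncation dq lq l12.
have Lq := dens_L1 dq.
have gM x : T x -> `|g x| <= M by move=> Tx; have [/andP[g0 _] gM] := gq x Tx; rewrite ger0_norm.
have Lg : L1 g by apply: (L1_bounded (M := M)) => //; exact: measurable_funTS.
have g1 : I g = 1.
  apply/eqP; rewrite eq_le; apply/andP; split; last by move: Eq h1; lra.
  by rewrite -(dens_I dq); apply: I_le => // x Tx; have [/andP[]] := gq x Tx.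
have qg : dens_eq q g.
  have : dens_eq (fun x => q x - g x) (fun=> 0).
    apply: I_eq0; first exact: L1B.
    - by move=> x Tx; rewrite subr_ge0; have [/andP[]] := gq x Tx.
    - by rewrite IB // g1 (dens_I dq) subrr.
  by apply: aeS => x h Tx; apply/eqP; rewrite -subr_eq0; apply/eqP; exact: h.
have dg : is_density g by split=> //; split => // x Tx; have [/andP[]] := gq x Tx.
have mx (f : R -> R) : measurable_fun setT f -> measurable_fun T (fun x => xlnx (f x)).
  by move=> mf; apply: measurable_xlnx; exact: measurable_funTS.
have xqg : dens_eq (fun x => xlnx (q x)) (fun x => xlnx (g x)).
  by apply: aeS qg => x h Tx; rewrite h.
have Lxg : L1 (fun x => xlnx (g x)) by apply: ae_L1 xqg lq; exact: mx.
have Eg : Ent q = Ent g by apply: ae_eq_I => //; [apply: mx; exact: dens_meas|exact: mx].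
apply: (Ent_le0 dq lq); rewrite Eg.
apply: (bounded_equality mW pW lW eW aW d0 Wd decay _ dg gM Lxg); first exact: strict_decay.
rewrite -/(Ent g) -Eg; apply: le_trans Eq _; apply: le_trans h2 _.
by rewrite g1 expr1n subrr mulr0 addr0.
Qed.

(** The interaction may be [-oo]. For [K > 0] the energy is then [+oo], but for [K = 0] the product
    [0 * -oo] is [0] and the entropy alone remains; hence the separate case. *)
Lemma energyE q (K : R) : is_density q ->
  [\/ energy W K q = +oo%E,
      [/\ K = 0, L1 (fun x => xlnx (q x)) & energy W K q = (Ent q)%:E] |
      [/\ L1 (fun x => xlnx (q x)), L12 (fun x y => W (x - y) * q x * q y) &
        energy W K q = (Ent q - K * Iint W q q)%:E] ] \/ K < 0.
Proof.
move=> dq; rewrite /energy; have [K0|K0] := leP 0 K; [left|by right].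
have [->|[lq ->]] := entropyP dq; first by rewrite eqxx; exact: Or31.
rewrite /=; have [->|[l ->]] := interP dq; last by apply: Or33; split.
move: K0; rewrite le_eqVlt => /predU1P[<-|K0].
  by apply: Or32; split => //; rewrite mul0e sube0.
by apply: Or31; rewrite gt0_muleNy // ?lte_fin.
Qed.

Lemma energy_ge0 q (K : R) : 0 <= K <= 1 -> is_density q -> (0 <= energy W K q)%E.
Proof.
move=> /andP[K0 K1] dq; case: (energyE K dq) => [[->//|[_ lq ->]|[lq l ->]]|]; last by rewrite ltNge K0.
  by rewrite lee_fin Ent_ge0.
rewrite lee_fin; have h := inter_le_Ent dq lq l; have E0 := Ent_ge0 dq lq.
have : K * Iint W q q <= K * Ent q by rewrite ler_wpM2l.
have : 0 <= (1 - K) * Ent q by rewrite mulr_ge0 // subr_ge0.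
lra.
Qed.

(** For [K < 1] the inequality leaves [(1 - K) Ent q <= 0]; only [K = 1] calls for the equality
    case. *)
Lemma Ent_le_Kinter q (K : R) : 0 <= K <= 1 -> is_density q -> L1 (fun x => xlnx (q x)) ->
  L12 (fun x y => W (x - y) * q x * q y) -> Ent q <= K * Iint W q q -> dens_eq q (@qu R).
Proof.
move=> /andP[K0 K1] dq lq l h.
move: K1; rewrite le_eqVlt => /predU1P[K1|K1].
  by apply: Ent_le_inter => //; move: h; rewrite K1 mul1r.
apply: Ent_le0 => //; have h' := inter_le_Ent dq lq l.
have : K * Iint W q q <= K * Ent q by rewrite ler_wpM2l.
have K1' : 0 < 1 - K by rewrite subr_gt0.
rewrite -(pmulr_rle0 (Ent q) K1'); lra.
Qed.

Lemma energy_le0 q (K : R) : 0 <= K <= 1 -> is_density q -> (energy W K q <= 0)%E -> dens_eq q (@qu R).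
Proof.
move=> K01 dq; case: (energyE K dq) => [[->//|[_ lq ->]|[lq l ->]]|]; rewrite ?lee_fin.
- exact: Ent_le0.
- by rewrite subr_le0; exact: Ent_le_Kinter.
- by case/andP: K01 => K0 _; rewrite ltNge K0.
Qed.

End Truncation.

Lemma Iint_unif q : is_density q -> dens_eq q (@qu R) ->
  L12 (fun x y => W (x - y) * q x * q y) -> Iint W q q = 0.
Proof.
move=> dq h l; have mq := dens_meas dq.
have lWx x : L1 (fun y => W (x - y)) by exact: L1_reflect.
have mm x : measurable_fun T (fun y => W (x - y) * q x * q y).
  apply: measurable_funTS; apply: measurable_funM => //; apply: measurable_funM; last exact: measurable_cst.
  apply: measurableT_comp => //; apply: measurable_funB => //; exact: measurable_cst.
have ee x : dens_eq (fun y => q x * W (x - y)) (fun y => W (x - y) * q x * q y).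
  by apply: aeS h => y h Ty; rewrite h // /qu mulr1 mulrC.
rewrite /Iint; have [_ ->] := I2E l (fun x _ => ae_L1 (mm x) (ee x) (L1Z (q x) (lWx x))).
rewrite (eq_I (g := fun=> 0)) ?I_cst // => x _.
rewrite -(ae_eq_I _ (mm x) (ee x)); last exact: L1_meas (L1Z (q x) (lWx x)).
by rewrite IZ // I_reflect // aW mulr0.
Qed.

Lemma Ent_unif q : is_density q -> dens_eq q (@qu R) -> Ent q = 0.
Proof.
move=> dq h; rewrite -Ent_qu; apply: ae_eq_I.
- by apply: measurable_xlnx; apply: measurable_funTS; exact: dens_meas.
- by rewrite xlnx_qu; exact: measurable_cst.
- by apply: aeS h => x h Tx; rewrite h.
Qed.

Lemma energy_unif_ge0 q (K : R) : 0 <= K -> is_density q -> dens_eq q (@qu R) -> (0 <= energy W K q)%E.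
Proof.
move=> K0 dq h; case: (energyE K dq) => [[->//|[_ lq ->]|[lq l ->]]|]; last by rewrite ltNge K0.
  by rewrite Ent_unif.
by rewrite Ent_unif // Iint_unif // mulr0 subrr.
Qed.

Lemma energy_qu (K : R) : 0 <= K -> energy W K (@qu R) = 0%E.
Proof.
move=> K0; have dq := is_density_qu R.
have l : L12 (fun x y => W (x - y) * @qu R x * @qu R y).
  apply: (L12_conv mW pW lW (M := 1)); [exact: measurable_cst|exact: L1_cst|exact: measurable_cst|].
  by move=> y _; rewrite /qu normr1.
rewrite /energy; have -> : entropy (@qu R) = 0%E.
  by rewrite /entropy integral0_eq // => x _; rewrite /qu ln1 mulr0.
rewrite /= (_ : inter W (@qu R) = (Iint W (@qu R) (@qu R))%:E); last by rewrite /Iint EFin_I2.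
rewrite Iint_unif //; last by apply: aeW.
by rewrite mule0 sube0.
Qed.

End Coercivity.

(** * Compactness of sublevel sets of the entropy *)

Section Limits.
Variable R : realType.
Local Notation mu := (@lebesgue_measure R).
Local Notation T := (@Tor R).
Implicit Types (f p q : R -> R).

Lemma limn_einf_ge (u : nat -> \bar R) (a : \bar R) :
  (\forall n \near \oo, (a <= u n)%E) -> (a <= limn_einf u)%E.
Proof.
move=> [N _ h]; rewrite limn_einf_lim; apply: lime_ge; first exact: is_cvg_einfs.
near=> n; apply: le_ereal_inf_tmp => _ /= [k nk <-]; apply: h => /=.
by apply: leq_trans nk; near: n; exact: nbhs_infty_ge.
Unshelve. all: by end_near. Qed.

Lemma limn_einf_le (u : nat -> \bar R) (a : \bar R) :
  (\forall n \near \oo, (u n <= a)%E) -> (limn_einf u <= a)%E.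
Proof.
move=> h; rewrite limn_einf_lim; apply: lime_le; first exact: is_cvg_einfs.
apply: filterS h => n; apply: le_trans; apply: ereal_inf_lbound; exists n => //=.
Qed.

Lemma measurable_fun_limn_einf (D : set R) (f_ : nat -> R -> \bar R) :
  (forall n, measurable_fun D (f_ n)) -> measurable_fun D (fun x => limn_einf (fun n => f_ n x)).
Proof.
move=> mf; apply: (measurableT_comp (@oppe_measurable R setT)).
apply: (@measurable_fun_limn_esup _ _ _ D (fun n x => - f_ n x)%E) => n.
exact: (measurableT_comp (@oppe_measurable R setT)).
Qed.

(** Fatou in the form that suits lower semicontinuity: pointwise only an eventual bound
    [f - e <= f_ n] is asked, and integrability of [f] is part of the conclusion. *)
Lemma fatou_T (f_ : nat -> R -> R) f (c : R) :
  (forall n, measurable_fun T (f_ n)) -> (forall n x, T x -> 0 <= f_ n x) ->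
  measurable_fun T f -> (forall x, T x -> 0 <= f x) ->
  {ae mu, forall x, T x -> forall e : R, 0 < e -> \forall n \near \oo, f x - e <= f_ n x} ->
  (forall n, L1 (f_ n)) ->
  (forall e : R, 0 < e -> \forall n \near \oo, I (f_ n) <= c + e) ->
  L1 f /\ I f <= c.
Proof.
move=> mf_ f_0 mf f0 ff lf_ hc.
have mE n : measurable_fun T (EFin \o f_ n) by apply/measurable_EFinP; exact: mf_.
have mEf : measurable_fun T (EFin \o f) by exact/measurable_EFinP.
have h1 : (\int[mu]_(x in T) (f x)%:E <= \int[mu]_(x in T) limn_einf (fun n => (f_ n x)%:E))%E.
  apply: ae_ge0_le_integral => //.
  - by move=> x Tx; apply: limn_einf_ge; near=> n; rewrite lee_fin f_0.
  - exact: measurable_fun_limn_einf.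
  - apply: aeS ff => x h Tx; apply/lee_subgt0Pr => e e0; rewrite -EFinB.
    by apply: limn_einf_ge; apply: filterS (h Tx e e0) => n; rewrite lee_fin.
have h2 := @fatou _ _ R mu T (@measurable_Tor R) (fun n x => (f_ n x)%:E) mE (fun n x Tx => f_0 n x Tx).
have h3 : (\int[mu]_(x in T) (f x)%:E <= c%:E)%E.
  apply: le_trans h1 _; apply: le_trans h2 _; apply/lee_addgt0Pr => e e0; rewrite -EFinD.
  apply: limn_einf_le; apply: filterS (hc e e0) => n h.
  by rewrite -EFin_I // lee_fin.
have lf : L1 f.
  apply/integrableP; split => //; apply: le_lt_trans (ltry c); apply: le_trans h3.
  by rewrite le_eqVlt; apply/orP; left; apply/eqP; apply: eq_integral => x /set_mem Tx; rewrite /= ger0_norm // f0.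
by split => //; rewrite -lee_fin EFin_I.
Unshelve. all: by end_near. Qed.

(** A cluster point in the compact product of segments, by Tychonoff. Monotonicity of [s] is
    replaced by [i <= s i], with accuracy [1/(i+1)] on the coordinates up to [i]. *)
Lemma diagonal_extraction (u : nat -> nat -> R) (M : R) : (forall j k, `|u j k| <= M) ->
  exists (g : nat -> R) (s : nat -> nat), (forall i, (i <= s i)%N) /\
    forall i k, (k <= i)%N -> `|u (s i) k - g k| < i.+1%:R^-1.
Proof.
move=> uM; pose X := prod_topology (fun _ : nat => R).
have C := @tychonoff nat (fun=> R) (fun=> `[- M, M]%classic) (fun=> @segment_compact _ _ _).
pose F : set_system X := (u : nat -> X) @ \oo.
have FF : ProperFilter F by exact: fmap_proper_filter.
have [|g [_ clg]] := C F FF.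
  by exists 0%N => // j _ k /=; rewrite in_itv /= -ler_norml.
have nb (n : nat) (e : R) : 0 < e -> nbhs (g : X) [set f : X | forall k, (k < n)%N -> `|f k - g k| < e].
  have NF : Filter (nbhs (g : X)) by exact: nbhs_filter.
  move=> e0; elim: n => [|n IH].
    by rewrite (_ : [set _ | _] = setT); [exact: filterT|apply/seteqP; split].
  have pc := @proj_continuous nat (fun=> R) n g.
  have pn : nbhs (g : X) [set f : X | `|f n - g n| < e].
    by move/cvgrPdist_lt: pc => /(_ e e0); apply: filterS => f; rewrite distrC.
  apply: filterS (filterI IH pn) => f [h1 h2] k; rewrite ltnS leq_eqVlt => /predU1P[->//|].
  exact: h1.
have sel i : {j | (i <= j)%N /\ forall k, (k <= i)%N -> `|u j k - g k| < i.+1%:R^-1}.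
  apply/cid.
  have := clg (u @` [set j | (i <= j)%N]) _ _ (nb i.+1 i.+1%:R^-1 _).
  case=> [|//|_ [[j ij <-] h]]; last by exists j; split.
  by exists i => // j /= ij; exists j.
exists g, (fun i => sval (sel i)); split=> i; first by have [] := svalP (sel i).
by move=> k ki; have [_] := svalP (sel i); apply.
Unshelve. all: by end_near. Qed.

(** Riesz-Fischer with a rate: the sum of [|p_ n - p_ n.+1|] has integral at most [6 * 2 = 12],
    hence is finite almost everywhere and the telescoping series converges there. *)
Lemma L1_complete (p_ : nat -> R -> R) : (forall n, measurable_fun setT (p_ n)) ->
  (forall n x, T x -> 0 <= p_ n x) -> (forall n, L1 (p_ n)) ->
  (forall n m, (n <= m)%N -> I (fun x => `|p_ n x - p_ m x|) <= 6 * 2^-1 ^+ n) ->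
  exists q, [/\ measurable_fun setT q, forall x, T x -> 0 <= q x, L1 q,
    forall n, I (fun x => `|p_ n x - q x|) <= 6 * 2^-1 ^+ n &
    {ae mu, forall x, T x -> p_ n x @[n --> \oo] --> q x}].
Proof.
move=> mp p0 lp hp.
(* An upper limit is measurable and makes sense also at the points where the sequence diverges. *)
pose q x := fine (limn_esup (fun n => (p_ n x)%:E)).
have mq : measurable_fun setT q.
  apply: measurableT_comp; first exact: fine_measurable.
  by apply: measurable_fun_limn_esup => n; apply/measurable_EFinP.
have q0 x : T x -> 0 <= q x.
  move=> Tx; apply: fine_ge0; apply: le_trans (limn_einf_sup _).
  by apply: limn_einf_ge; near=> n; rewrite lee_fin p0.
pose S N x := \sum_(n < N) `|p_ n x - p_ n.+1 x|.
have ld n m : L1 (fun x => `|p_ n x - p_ m x|) by apply: L1_norm; exact: L1B.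
have lS N : L1 (S N) by apply: L1_sum => n _; exact: ld.
have IS N : I (S N) <= 12.
  rewrite /S I_sum => [|n _]; last exact: ld.
  apply: le_trans (_ : _ <= \sum_(n < N) 6 * 2^-1 ^+ n) _; first by apply: ler_sum => n _; exact: hp.
  rewrite -mulr_sumr; have -> : \sum_(n < N) (2^-1 : R) ^+ n = 2 - 2 * 2^-1 ^+ N.
    elim: (N) => [|k IH]; first by rewrite big_ord0 expr0 mulr1 subrr.
    by rewrite big_ord_recr /= IH exprS; field.
  by have : 0 <= (2^-1 : R) ^+ N; [rewrite exprn_ge0|lra].
have Sinc x : nondecreasing_seq (fun N => S N x).
  by apply/nondecreasing_seqP => N; rewrite /S big_ord_recr /= lerDl.
have S0 N x : 0 <= S N x by apply: sumr_ge0.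
pose G x := limn_einf (fun N => (S N x)%:E).
have mS N : measurable_fun T (fun x => (S N x)%:E) by have := measurable_int _ (lS N).
have mG : measurable_fun T G by apply: measurable_fun_limn_einf.
have G0 x : (0 <= G x)%E by apply: limn_einf_ge; near=> n; rewrite lee_fin.
have IG : (\int[mu]_(x in T) G x <= 12%:E)%E.
  apply: le_trans (fatou mu (@measurable_Tor R) mS _) _; first by move=> n x _; rewrite lee_fin.
  by apply: limn_einf_le; near=> n; rewrite -EFin_I // lee_fin.
have lG : mu.-integrable T G.
  apply/integrableP; split => //; apply: le_lt_trans (ltry 12); apply: le_trans IG.
  by rewrite le_eqVlt; apply/orP; left; apply/eqP; apply: eq_integral => x _; rewrite gee0_abs.
have cv : {ae mu, forall x, T x -> p_ n x @[n --> \oo] --> q x}.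
  apply: aeS (integrable_ae (@measurable_Tor R) lG) => x h Tx.
  have Gf := h Tx.
  have Sb N : S N x <= fine (G x).
    rewrite -lee_fin fineK //; apply: limn_einf_ge; near=> n; rewrite lee_fin.
    by apply: Sinc; near: n; exact: nbhs_infty_ge.
  have cs : cvgn (series (telescope (fun n => p_ n x))).
    apply: normed_cvg; rewrite (_ : [normed series _] = fun N => S N x); last first.
      apply/funext => N; rewrite /S -(big_mkord xpredT (fun n => `|p_ n x - p_ n.+1 x|)).
      by apply: eq_bigr => n _; rewrite /telescope distrC.
    apply: nondecreasing_is_cvgn; first exact: Sinc.
    by exists (fine (G x)) => _ [N _ <-]; exact: Sb.
  have cp : cvgn (fun n => p_ n x).
    rewrite (_ : (fun n => p_ n x) = fun n => p_ 0%N x + series (telescope (fun n => p_ n x)) n); last first.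
      by apply/funext => n; exact: (eq_sum_telescope (fun n => p_ n x)).
    by apply: is_cvgD => //; exact: is_cvg_cst.
  have /cvg_ex[l pl] := cp.
  have pE : (p_ n x)%:E @[n --> \oo] --> l%:E by apply/cvg_EFin => //; near=> n.
  by rewrite /q (cvg_limn_einf_sup pE).2.
have lim n : L1 (fun x => `|p_ n x - q x|) /\ I (fun x => `|p_ n x - q x|) <= 6 * 2^-1 ^+ n.
  apply: (@fatou_T (fun m x => `|p_ n x - p_ (n + m)%N x|)).
  - by move=> m; exact: L1_meas.
  - by move=> m x _.
  - by apply: measurable_funTS; apply: measurableT_comp => //; exact: measurable_funB.
  - by move=> x _.
  - apply: aeS cv => x h Tx e e0; move/cvgrPdist_lt: (h Tx) => /(_ e e0) [N _ hN].
    near=> m; have : `|q x - p_ (n + m)%N x| < e.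
      by apply: hN => /=; apply: leq_trans (leq_addl _ _); near: m; exact: nbhs_infty_ge.
    have := ler_distD (p_ (n + m)%N x) (p_ n x) (q x).
    by rewrite (distrC (p_ (n + m)%N x) (q x)) => *; lra.
  - by move=> m; exact: ld.
  - by move=> e e0; near=> m; apply: le_trans (hp n (n + m)%N (leq_addr _ _)) _; rewrite lerDl ltW.
exists q; split => //; last by move=> n; have [] := lim n.
apply: (@L1_le _ _ (fun x => `|p_ 0%N x - q x| + `|p_ 0%N x|)).
- exact: measurable_funTS.
- move=> x _; have := ler_normD (q x - p_ 0%N x) (p_ 0%N x); rewrite subrK [X in _ <= X + _ -> _]distrC; exact.
- by apply: L1D; [have [] := lim 0%N|exact: L1_norm].
Unshelve. all: by end_near. Qed.

End Limits.

(** * Weak limits of densities of bounded entropy *)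

Section WeakLimits.
Variable R : realType.
Local Notation T := (@Tor R).
Implicit Types (f p q : R -> R).

(** Cosines at even and sines at odd indices, so that the moments of a density form one real
    sequence for the diagonal extraction. *)
Definition tk (k : nat) (x : R) : R := if odd k then sk k./2 x else ck k./2 x.
Definition coef p (k : nat) : R := I (fun x => p x * tk k x).

Lemma measurable_tk k D : measurable_fun D (tk k).
Proof. by rewrite /tk; case: odd; [exact: measurable_sk|exact: measurable_ck]. Qed.

Lemma tk_le1 k x : `|tk k x| <= 1.
Proof. by rewrite /tk; case: odd; [exact: sk_le1|exact: ck_le1]. Qed.

Lemma L1_multk k f : L1 f -> L1 (fun x => f x * tk k x).
Proof.
by move=> lf; apply: (L1_mulb (M := 1)) => // [|x _]; [exact: measurable_tk|exact: tk_le1].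
Qed.

Lemma coef_double p k : coef p k.*2 = ccoef p k.
Proof. by rewrite /coef /tk odd_double doubleK. Qed.

Lemma coef_doubleS p k : coef p k.*2.+1 = scoef p k.
Proof. by rewrite /coef /tk /= odd_double /= uphalf_double. Qed.

Lemma coef_dist p q k : L1 p -> L1 q -> `|coef p k - coef q k| <= I (fun x => `|p x - q x|).
Proof.
move=> lp lq; rewrite /coef -IB; [|exact: L1_multk..].
have ll : L1 (fun x => p x * tk k x - q x * tk k x) by apply: L1B; exact: L1_multk.
apply: le_trans (I_norm ll) _; apply: I_le; [exact: L1_norm|by apply: L1_norm; exact: L1B|].
by move=> x _; rewrite -mulrBl normrM ler_piMr // tk_le1.
Qed.

Lemma coef_le1 p k : is_density p -> `|coef p k| <= 1.
Proof.
move=> dp; have lp := dens_L1 dp; rewrite -(dens_I dp).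
apply: le_trans (I_norm (L1_multk k lp)) _; apply: I_le => //; first by apply: L1_norm; exact: L1_multk.
by move=> x Tx; rewrite normrM (ger0_norm (dens_ge0 dp Tx)) ler_piMr ?tk_le1 // (dens_ge0 dp).
Qed.

Lemma coef_mid p q k : L1 p -> L1 q -> coef (fun x => (p x + q x) / 2) k = (coef p k + coef q k) / 2.
Proof.
move=> lp lq; rewrite /coef (eq_I (g := fun x => 2^-1 * (p x * tk k x + q x * tk k x))); last first.
  by move=> x _; field.
by rewrite (IZ _ (L1D (L1_multk k lp) (L1_multk k lq))) (ID (L1_multk k lp) (L1_multk k lq)) mulrC.
Qed.

Lemma I_mul_fejer N f q : L1 f -> L1 q -> I (fun x => q x * fejer N f x) = I f * I q +
  2 * \sum_(k < N) rho R N k.+1 * (ccoef f k.+1 * ccoef q k.+1 + scoef f k.+1 * scoef q k.+1).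
Proof.
move=> lf lq.
pose F (k : 'I_N) x := (2 * rho R N k.+1 * ccoef f k.+1) * (q x * ck k.+1 x) +
  (2 * rho R N k.+1 * scoef f k.+1) * (q x * sk k.+1 x).
have lF k : L1 (F k) by apply: L1D; apply: L1Z; [exact: L1_mulck|exact: L1_mulsk].
rewrite (eq_I (g := fun x => I f * q x + \sum_(k < N) F k x)); last first.
  move=> x _; rewrite fejerE // mulrDr mulrC; congr (_ + _).
  by rewrite !mulr_sumr; apply: eq_bigr => k _; rewrite /F; ring.
rewrite ID; [|exact: L1Z|exact: L1_sum]; rewrite IZ // I_sum //; congr (_ + _).
rewrite mulr_sumr; apply: eq_bigr => k _.
rewrite /F ID; [|by apply: L1Z; exact: L1_mulck|by apply: L1Z; exact: L1_mulsk].
by rewrite (IZ _ (L1_mulck k.+1 lq)) (IZ _ (L1_mulsk k.+1 lq)) -/(ccoef q k.+1) -/(scoef q k.+1); ring.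
Qed.

(** Fejer polynomials approximate [f] uniformly, and the error keeps its size when integrated
    against any density; for polynomials finitely many moments decide. *)
Lemma cvg_coef_weak (q_ : nat -> R -> R) q f : (forall i, is_density (q_ i)) -> is_density q ->
  (forall k, coef (q_ i) k @[i --> \oo] --> coef q k) -> continuous f -> periodic1 f ->
  I (fun x => f x * q_ i x) @[i --> \oo] --> I (fun x => f x * q x).
Proof.
move=> dq_ dq hc fc fp.
have lf := continuous_L1 fc.
have [M _ fM] := continuous_bounded_T fc.
have uf : circle_uc f.
  by apply: continuous_circle_uc => //; rewrite -(fp (- 2^-1)); congr f; lra.
have approx (e : R) : 0 < e -> exists N, forall p, is_density p ->
    `|I (fun x => f x * p x) - I (fun x => p x * fejer N f x)| <= e.
  move=> e0; have [N hN] := fejer_unif lf fM uf e0; exists N => p dp; have lp := dens_L1 dp.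
  have l1 : L1 (fun x => f x * p x).
    have := L1_mulb lp (L1_meas lf) fM; by apply: eq_L1 => x _; rewrite mulrC.
  have l2 : L1 (fun x => p x * fejer N f x).
    apply: (L1_mulb (M := M)) => //; first exact: measurable_fejer.
    by move=> x Tx; exact: fejer_bounded.
  rewrite -IB //; apply: le_trans (I_norm (L1B l1 l2)) _.
  have -> : e = I (fun x => e * p x) by rewrite IZ // (dens_I dp) mulr1.
  apply: I_le; [by apply: L1_norm; exact: L1B|exact: L1Z|].
  move=> x Tx; rewrite (mulrC (f x)) -mulrBr normrM (ger0_norm (dens_ge0 dp Tx)) mulrC.
  by rewrite ler_wpM2r ?(dens_ge0 dp) // distrC; exact: hN.
have trig N : I (fun x => q_ i x * fejer N f x) @[i --> \oo] --> I (fun x => q x * fejer N f x).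
  rewrite I_mul_fejer //; last exact: dens_L1.
  rewrite (_ : (fun i => _) = fun i => I f * 1 +
    2 * \sum_(k < N) rho R N k.+1 * (ccoef f k.+1 * ccoef (q_ i) k.+1 + scoef f k.+1 * scoef (q_ i) k.+1)); last first.
    by apply/funext => i; rewrite I_mul_fejer //; [rewrite (dens_I (dq_ i))|exact: dens_L1].
  rewrite (dens_I dq); apply: cvgD; first exact: cvg_cst.
  apply: cvgMr; apply: cvg_big; [exact: add_continuous|].
  move=> k _; apply: cvgMr; apply: cvgD; apply: cvgMr.
    by have := hc k.+1.*2; rewrite coef_double; under eq_cvg do rewrite coef_double.
  by have := hc k.+1.*2.+1; rewrite coef_doubleS; under eq_cvg do rewrite coef_doubleS.
apply/cvgrPdist_le => e e0.
have e3 : 0 < e / 3 by rewrite divr_gt0.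
have [N hN] := approx _ e3.
near=> i.
have h1 := hN _ (dq_ i); have h2 := hN _ dq.
have h3 : `|I (fun x => q x * fejer N f x) - I (fun x => q_ i x * fejer N f x)| <= e / 3.
  by near: i; move/cvgrPdist_le: (trig N); apply.
move: h1 h2 h3; rewrite !ler_norml => /andP[a1 a2] /andP[b1 b2] /andP[c1 c2].
by apply/andP; split; lra.
Unshelve. all: by end_near. Qed.

Lemma xlnx_lsc (u_ : nat -> R) (a e : R) : (forall n, 0 <= u_ n) -> 0 <= a -> u_ n @[n --> \oo] --> a ->
  0 < e -> \forall n \near \oo, xlnx a - e <= xlnx (u_ n).
Proof.
move=> u0 a0 ua e0.
(* Slope of an affine minorant: [ln a] is exact for [a > 0], while at [a = 0] the finite slope
   [ln (e / 2)] loses [e / 2]. *)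
have [s hs] : exists s : R, xlnx a - e / 2 <= a * s + a - expR s.
  move: a0; rewrite le_eqVlt => /predU1P[<-|a0].
    exists (ln (e / 2)); rewrite lnK ?posrE ?divr_gt0 // /xlnx; lra.
  by exists (ln a); rewrite lnK // /xlnx; lra.
have cl : u_ n * s + u_ n - expR s @[n --> \oo] --> a * s + a - expR s.
  apply: cvgB; last exact: cvg_cst.
  by apply: cvgD => //; apply: cvgMl.
have lt : xlnx a - e < a * s + a - expR s by apply: lt_le_trans hs; lra.
apply: filterS (cvgr_gt _ cl _ lt) => n h.
exact: le_trans (ltW h) (xlnx_young s (u0 n)).
Qed.

Lemma cvg_geo (c : R) : c * 2^-1 ^+ n @[n --> \oo] --> (0 : R).
Proof. by apply: (@cvg_geometric R c 2^-1); rewrite ger0_norm //; lra. Qed.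

Lemma cvg_natSinv_dist (a_ : nat -> R) (l : R) i0 :
  (forall i, (i0 <= i)%N -> `|a_ i - l| <= i.+1%:R^-1) -> a_ i @[i --> \oo] --> l.
Proof.
move=> h; apply/cvgrPdist_le => e e0; near=> i; rewrite distrC.
apply: le_trans (h i _) _; first by near: i; exact: nbhs_infty_ge.
by apply/ltW; near: i; exact: (near_infty_natSinv_lt (PosNum e0)).
Unshelve. all: by end_near. Qed.

(* The limit density is built from near-minimisers of the entropy under
   finitely many moment constraints: quantitative convexity of the entropy
   makes them converge in L1. *)
Lemma density_compact (q_ : nat -> R -> R) (E : R) :
  (forall j, is_density (q_ j)) -> (forall j, L1 (fun x => xlnx (q_ j x))) ->
  (forall j, Ent (q_ j) <= E) ->
  exists (s : nat -> nat) q (eta : R),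
    [/\ forall i, (i <= s i)%N, is_density q /\ L1 (fun x => xlnx (q x)), Ent q <= eta,
      Ent (q_ (s i)) @[i --> \oo] --> eta &
      forall f, continuous f -> periodic1 f ->
        I (fun x => f x * q_ (s i) x) @[i --> \oo] --> I (fun x => f x * q x)].
Proof.
move=> dq_ lq_ Eq.
(* Coordinate [0] carries the entropy, so that it converges along the same extraction as the
   moments. *)
pose u j k := if k is k'.+1 then coef (q_ j) k' else Ent (q_ j).
have [|g [s [si hs]]] := @diagonal_extraction R u (Num.max E 1).
  move=> j [|k] /=; rewrite le_max; last by rewrite (coef_le1 _ (dq_ j)) orbT.
  by rewrite ger0_norm ?Eq // Ent_ge0.
(* Nested sets stable under midpoints, each containing the extracted densities from some index
   on. *)
pose C j p := [/\ is_density p, L1 (fun x => xlnx (p x)) &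
  forall k, (k < j)%N -> `|coef p k - g k.+1| <= j.+1%:R^-1].
have Cm i j p : (i <= j)%N -> C j p -> C i p.
  move=> ij [dp lp h]; split => // k ki; apply: le_trans (h k (leq_trans ki ij)) _.
  by rewrite lef_pV2 ?posrE ?ltr0n // ler_nat.
have Cmid j p r : C j p -> C j r -> C j (fun x => (p x + r x) / 2).
  move=> [dp lp hp] [dr lr hr]; have [dm lm] := L1_mid dp dr lp lr; split => // k kj.
  rewrite coef_mid; [|exact: dens_L1..].
  rewrite (_ : _ - _ = ((coef p k - g k.+1) + (coef r k - g k.+1)) / 2); last by field.
  rewrite normrM (ger0_norm (_ : 0 <= 2^-1)) //.
  have := ler_normD (coef p k - g k.+1) (coef r k - g k.+1).
  have := hp k kj; have := hr k kj; set im := _^-1; move=> *.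
  by rewrite ler_pdivrMr //; lra.
have Cq i j : (j <= i)%N -> C j (q_ (s i)).
  move=> ji; split => // k kj; have := hs i k.+1 (leq_trans kj ji) => /= /ltW/le_trans; apply.
  by rewrite lef_pV2 ?posrE ?ltr0n // ler_nat.
(* These infima increase with [j] and stay below the limit entropy [eta], because far members of the
   sequence are admissible. *)
pose e_ j := inf [set Ent p | p in [set p | C j p]].
have hI j : has_inf [set Ent p | p in [set p | C j p]].
  split; first by exists (Ent (q_ (s j))), (q_ (s j)) => //=; exact: Cq.
  by exists 0 => _ [p [dp lp _] <-]; exact: Ent_ge0.
have e_le j p : C j p -> e_ j <= Ent p by move=> Cp; apply: ge_inf; [have [] := hI j|exists p].
pose eta := g 0%N.
have cE : Ent (q_ (s i)) @[i --> \oo] --> eta.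
  by apply: (@cvg_natSinv_dist _ _ 0%N) => i _; apply/ltW/(hs i 0%N).
have e_eta j : e_ j <= eta.
  by apply: (cvgr_to_ge cE); near=> i; apply: e_le; apply: Cq; near: i; exact: nbhs_infty_ge.
have hS : has_sup (range e_) by split; [exists (e_ 0%N), 0%N|exists eta => _ [j _ <-]].
pose es := sup (range e_).
have es_eta : es <= eta by apply: ge_sup => [|_ [j _ <-] //]; have [] := hS.
have e_mono i j : (i <= j)%N -> e_ i <= e_ j.
  move=> ij; apply: lb_le_inf; first by have [] := hI j.
  by move=> _ [p Cp <-]; apply: e_le; exact: Cm Cp.
(* Entropies are taken within [t^2] of [es]. Midpoints remain admissible, so the defect is at most
   [2 t^2], and [L1_dist_defect] with this [t] gives [2 t + 4 t]: the constant [6] of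
   [L1_complete]. *)
pose t n : R := 2^-1 ^+ n.
have t0 n : 0 < t n by rewrite exprn_gt0.
have tm n m : (n <= m)%N -> t m <= t n by move=> nm; apply: ler_wiXn2l => //; lra.
have sel n : {mp : nat * (R -> R) | [/\ (n <= mp.1)%N, es - t n ^+ 2 < e_ mp.1, C mp.1 mp.2 &
    Ent mp.2 < es + t n ^+ 2]}.
  apply/cid; have [_ [j _ <-] hj] := sup_adherent (exprn_gt0 2 (t0 n)) hS.
  pose m := maxn n j.
  have [_ [p Cp <-] hp] := inf_adherent (exprn_gt0 2 (t0 n)) (hI m).
  exists (m, p); split => //=; first exact: leq_maxl.
    by apply: lt_le_trans hj _; apply: e_mono; exact: leq_maxr.
  apply: lt_le_trans hp _; rewrite lerD2r; apply: sup_ubound; [by have [] := hS|by exists m].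
pose m_ n := (sval (sel n)).1; pose p_ n := (sval (sel n)).2.
have hm n : [/\ (n <= m_ n)%N, es - t n ^+ 2 < e_ (m_ n), C (m_ n) (p_ n) & Ent (p_ n) < es + t n ^+ 2].
  exact: svalP (sel n).
have dp n : is_density (p_ n) by have [_ _ []] := hm n.
have lp n : L1 (fun x => xlnx (p_ n x)) by have [_ _ []] := hm n.
have tm2 n m : (n <= m)%N -> t m ^+ 2 <= t n ^+ 2.
  by move=> nm; rewrite ler_sqr ?nnegrE ?(ltW (t0 _)) // tm.
have hp n m : (n <= m)%N -> I (fun x => `|p_ n x - p_ m x|) <= 6 * 2^-1 ^+ n.
  move=> nm; apply: le_trans (L1_dist_defect (dp n) (dp m) (lp n) (lp m) (t0 n)) _.
  have [_ a1 a2 a3] := hm n; have [_ b1 b2 b3] := hm m.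
  have mid : es - t n ^+ 2 <= Ent (fun x => (p_ n x + p_ m x) / 2).
    have [mm|mm] := leqP (m_ n) (m_ m).
      apply: le_trans (ltW a1) _; apply: e_le; apply: Cmid => //; exact: Cm mm b2.
    apply: le_trans (_ : es - t m ^+ 2 <= _); first by rewrite lerD2l lerN2 tm2.
    apply: le_trans (ltW b1) _; apply: e_le; apply: Cmid => //; exact: Cm (ltnW mm) a2.
  have : ((Ent (p_ n) + Ent (p_ m)) / 2 - Ent (fun x => (p_ n x + p_ m x) / 2)) / t n <= 2 * t n.
    rewrite ler_pdivrMr // -mulrA -expr2; have := tm2 _ _ nm; lra.
  rewrite -/(t n); lra.
have [q [mq q0 lq hq cq]] := L1_complete (fun n => dens_meas (dp n)) (fun n x Tx => dens_ge0 (dp n) Tx)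
  (fun n => dens_L1 (dp n)) hp.
have dq : is_density q.
  split=> //; split => //; split => //; apply/eqP; rewrite -subr_eq0 -normr_le0.
  apply: (cvgr_to_ge (cvg_geo 6)); near=> n.
  have lpn := dens_L1 (dp n).
  rewrite -/(I q) (_ : I q - 1 = - I (fun x => p_ n x - q x)); last first.
    by rewrite IB // (dens_I (dp n)) opprB.
  by rewrite normrN; apply: le_trans (hq n); apply: I_norm; exact: L1B.
have gq k : g k.+1 = coef q k.
  apply/eqP; rewrite -subr_eq0 -normr_le0; rewrite -[0]addr0.
  apply: (cvgr_to_ge (cvgD (cvg_geo 6) (@cvg_harmonic R))); near=> n.
  have [nm _ [_ _ h] _] := hm n.
  have kn : (k < n)%N by near: n; exact: nbhs_infty_gt.
  have h1 := h k (leq_trans kn nm).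
  have h2 : `|coef (p_ n) k - coef q k| <= 6 * 2^-1 ^+ n.
    by apply: le_trans (hq n); apply: coef_dist => //; exact: dens_L1.
  have h3 : (m_ n).+1%:R^-1 <= n.+1%:R^-1 :> R by rewrite lef_pV2 ?posrE ?ltr0n // ler_nat.
  rewrite (_ : _ - _ = (coef (p_ n) k - coef q k) - (coef (p_ n) k - g k.+1)); last by ring.
  apply: le_trans (ler_normB _ _) _; apply: lerD => //; exact: le_trans h1 h3.
(* Adding [1] makes the integrand nonnegative, by [x ln x >= x - 1], as Fatou requires. *)
have [lxq Exq] : L1 (fun x => xlnx (q x) + 1) /\ I (fun x => xlnx (q x) + 1) <= es + 1.
  have pos (a : R) : 0 <= a -> 0 <= xlnx a + 1.
    by move=> a0; have := xlnx_young 0 a0; rewrite expR0 mulr0 add0r -/(xlnx a); lra.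
  have mm (f : R -> R) : measurable_fun setT f -> measurable_fun T (fun x => xlnx (f x) + 1).
    move=> mf; apply: measurable_funD; last exact: measurable_cst.
    by apply: measurable_xlnx; exact: measurable_funTS.
  apply: (@fatou_T _ (fun n x => xlnx (p_ n x) + 1)).
  - by move=> n; apply: mm; exact: dens_meas.
  - by move=> n x Tx; apply: pos; exact: (dens_ge0 (dp n)).
  - exact: mm.
  - by move=> x Tx; apply: pos; exact: q0.
  - apply: aeS cq => x h Tx e e0.
    apply: filterS (xlnx_lsc (fun n => dens_ge0 (dp n) Tx) (q0 x Tx) (h Tx) e0) => n; lra.
  - by move=> n; apply: L1D; [exact: lp|exact: L1_cst].
  - move=> e e0; near=> n; rewrite (ID (lp n) (L1_cst 1)) I_cst -/(Ent (p_ n)).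
    have [_ _ _ a3] := hm n.
    have t1 : t n <= 1 by rewrite -[1]/(t 0%N); exact: tm.
    have t2 : t n ^+ 2 <= t n by rewrite expr2 ler_piMl // ltW.
    have t3 : t n <= e.
      near: n; have := cvg_geo 1 => /cvgrPdist_le /(_ e e0); apply: filterS => n.
      by rewrite mul1r sub0r normrN ger0_norm // ltW.
    lra.
have lxq' : L1 (fun x => xlnx (q x)).
  by have := L1B lxq (L1_cst 1); apply: eq_L1 => x _; rewrite addrK.
exists s, q, eta; split => //.
- by apply: le_trans es_eta; move: Exq; rewrite (ID lxq' (L1_cst 1)) I_cst -/(Ent q) lerD2r.
- move=> f fc fp; apply: cvg_coef_weak => // k; rewrite -gq.
  by apply: (@cvg_natSinv_dist _ _ k.+1) => i ki; apply/ltW; exact: (hs i k.+1).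
Unshelve. all: by end_near. Qed.

End WeakLimits.

(** * Densities as measures *)

Section DensityMeasure.
Variable R : realType.
Local Notation mu := (@lebesgue_measure R).
Local Notation T := (@Tor R).
Local Notation RR := (measurableTypeR R * measurableTypeR R)%type.
Implicit Types (q : R -> R).

(** [is_density] fixes the sign of [q] on [T] only; clipping and the indicator give a nonnegative
    weight on all of [R]. *)
Definition weight q (x : R) : R := Num.max (q x) 0 * \1_T x.

(** The proof [dq] is an argument so that the probability structure can be attached to the term. *)
Definition dmeas q (dq : is_density q) : set R -> \bar R :=
  fun A => (\int[mu]_(x in A) (weight q x)%:E)%E.

Section Measure.
Variables (q : R -> R) (dq : is_density q).

Lemma weight_ge0 x : 0 <= weight q x.
Proof. by rewrite mulr_ge0 // le_max lexx orbT. Qed.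

Lemma weight_T x : T x -> weight q x = q x.
Proof.
by move=> Tx; rewrite /weight indicE mem_set // mulr1 max_l // (dens_ge0 dq).
Qed.

Lemma measurable_weight D : measurable_fun D (weight q).
Proof.
apply: measurable_funTS; apply: measurable_funM; last by apply: measurable_indic; exact: measurable_Tor.
by apply: measurable_maxr => //; exact: dens_meas dq.
Qed.

Lemma measurable_EFin_weight D : measurable_fun D (fun x => (weight q x)%:E).
Proof. by apply/measurable_EFinP; exact: measurable_weight. Qed.

Lemma integral_weight (f : R -> \bar R) :
  (\int[mu]_x (f x * (weight q x)%:E) = \int[mu]_(x in T) (f x * (q x)%:E))%E.
Proof.
rewrite [RHS]integral_mkcond; apply: eq_integral => x _; rewrite patchE.
case: ifPn => [/set_mem Tx|xT]; first by rewrite weight_T.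
by rewrite /weight indicE (negbTE xT) mulr0 mule0.
Qed.

Lemma dmeas0 : dmeas dq set0 = 0%E.
Proof. by rewrite /dmeas integral_set0. Qed.

Lemma dmeas_ge0 A : (0 <= dmeas dq A)%E.
Proof. by apply: integral_ge0 => x _; rewrite lee_fin weight_ge0. Qed.

Lemma dmeas_sigma_additive : semi_sigma_additive (dmeas dq).
Proof.
move=> F mF tF mUF; rewrite /dmeas; apply: cvg_toP.
  apply: ereal_nondecreasing_is_cvgn => m n mn.
  apply: lee_sum_nneg_natr => // k _ _.
  by apply: integral_ge0 => /= x Fkx; rewrite lee_fin weight_ge0.
rewrite ge0_integral_bigcup //=.
- exact: measurable_EFin_weight.
- by move=> x _; rewrite lee_fin weight_ge0.
Qed.

End Measure.

HB.instance Definition _ q (dq : is_density q) := isMeasure.Build _ _ _ (dmeas dq)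
  (@dmeas0 q dq) (@dmeas_ge0 q dq) (@dmeas_sigma_additive q dq).

Lemma dmeas_setT q (dq : is_density q) : dmeas dq setT = 1%E.
Proof.
have := integral_weight dq (fun=> 1%E); under eq_integral do rewrite mul1e.
rewrite /dmeas => ->; under eq_integral do rewrite mul1e.
by rewrite -(EFin_I (dens_L1 dq)) (dens_I dq).
Qed.

HB.instance Definition _ q (dq : is_density q) :=
  @Measure_isProbability.Build _ _ R (dmeas dq) (dmeas_setT dq).

Section Integral.
Variables (q : R -> R) (dq : is_density q).
Let P : probability R R := dmeas dq.

Lemma dmeas_prob_on_T : prob_on_T P.
Proof.
rewrite /prob_on_T /P /= /dmeas -[RHS](congr1 EFin (dens_I dq)) (EFin_I (dens_L1 dq)).
by apply: eq_integral => x /set_mem Tx; rewrite weight_T.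
Qed.

Lemma integral_dmeas_indic E : measurable E ->
  (\int[P]_x (\1_E x)%:E = \int[mu]_x ((\1_E x)%:E * (weight q x)%:E))%E.
Proof.
move=> mE; rewrite integral_indic // setIT /P /= /dmeas integral_mkcond.
apply: eq_integral => x _; rewrite patchE indicE.
by case: ifP => _; rewrite ?mul1e ?mul0e.
Qed.

Import HBNNSimple.

Lemma integral_dmeas_nnsfun (f : {nnsfun R >-> R}) :
  (\int[P]_x (f x)%:E = \int[mu]_x ((f x)%:E * (weight q x)%:E))%E.
Proof.
have mA r : measurable_fun (setT : set R) (fun x : R => (r * \1_(f @^-1` [set r]) x)%:E).
  exact/measurable_EFinP/measurableT_comp.
have mB r : measurable_fun (setT : set R) (fun x : R => (\1_(f @^-1` [set r]) x)%:E).
  exact/measurable_EFinP/measurable_indic.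
under [LHS]eq_integral do rewrite fimfunE -fsumEFin//.
rewrite [LHS]ge0_integral_fsum//; last first.
  by move=> n x _; rewrite EFinM nnfun_muleindic_ge0.
under [RHS]eq_integral.
  move=> x xD; rewrite fimfunE -fsumEFin// ge0_mule_fsuml; last first.
    by move=> r; rewrite EFinM nnfun_muleindic_ge0.
  over.
rewrite [RHS]ge0_integral_fsum//; last 2 first.
  - move=> r; apply: emeasurable_funM; last exact: measurable_EFin_weight.
    exact: mA.
  - by move=> r x _; rewrite mule_ge0 ?lee_fin ?weight_ge0 // -lee_fin EFinM nnfun_muleindic_ge0.
apply: eq_fsbigr => r _.
under [RHS]eq_integral do rewrite EFinM -muleA.
have [r0|r0] := leP 0 r.
  rewrite [RHS]ge0_integralZl //.
  - by rewrite !integralZl_indic_nnsfun// integral_dmeas_indic.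
  - apply: emeasurable_funM; last exact: measurable_EFin_weight.
    exact: mB.
  - by move=> x _; rewrite mule_ge0 // lee_fin weight_ge0.
have e0 x : \1_(f @^-1` [set r]) x = 0 :> R.
  rewrite indicE memNset // => /= fr; have : 0 <= f x by exact: fun_ge0.
  by rewrite fr leNgt r0.
rewrite !integral0_eq // => x _; first by rewrite e0 mul0e mule0.
by rewrite e0 mulr0.
Qed.

Lemma ge0_integral_dmeas (f : R -> \bar R) : measurable_fun setT f -> (forall x, 0 <= f x)%E ->
  (\int[P]_x f x = \int[mu]_x (f x * (weight q x)%:E))%E.
Proof.
move=> mf f0; pose f_ := nnsfun_approx measurableT mf.
have mf_ n : measurable_fun (setT : set R) (fun x : R => (f_ n x)%:E).
  exact/measurable_EFinP/measurable_funTS.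
have ndf x m n : (m <= n)%N -> f_ m x <= f_ n x.
  by move=> mn; exact/lefP/nd_nnsfun_approx.
transitivity (limn (fun n => \int[P]_x (f_ n x)%:E)%E).
  rewrite -monotone_convergence//=.
  - apply: eq_integral => x _; apply/esym/cvg_lim => //=.
    exact: cvg_nnsfun_approx.
  - by move=> n x _; rewrite lee_fin.
  - by move=> x _ m n mn; rewrite lee_fin; exact: ndf.
rewrite [RHS](_ : _ = limn (fun n => \int[mu]_x ((f_ n x)%:E * (weight q x)%:E))%E).
  by congr (limn _); apply/funext => n; exact: integral_dmeas_nnsfun.
rewrite -monotone_convergence//=.
- apply: eq_integral => x _; apply/esym/cvg_lim => //=.
  by apply: cvgeZr => //; exact: cvg_nnsfun_approx.
- move=> n; apply: emeasurable_funM; last exact: measurable_EFin_weight.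
  exact: mf_.
- by move=> n x _; rewrite mule_ge0 // lee_fin // weight_ge0.
- move=> x _ m n mn; rewrite lee_wpmul2r ?lee_fin ?weight_ge0 //.
  exact: ndf.
Qed.

Lemma ge0_integral_dmeas_T (f : R -> \bar R) : measurable_fun T f -> (forall x, T x -> 0 <= f x)%E ->
  (\int[P]_(x in T) f x = \int[mu]_(x in T) (f x * (q x)%:E))%E.
Proof.
move=> mf f0; rewrite integral_mkcond ge0_integral_dmeas.
- rewrite (integral_weight dq); apply: eq_integral => x xT; by rewrite patchE xT.
- by apply/(measurable_restrictT _ _).1; [exact: measurable_Tor|].
- by move=> x; rewrite patchE; case: ifPn => // /set_mem; exact: f0.
Qed.

Lemma integral_dmeas (f : R -> R) : measurable_fun setT f ->
  \int[P]_(x in T) f x = I (fun x => f x * q x).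
Proof.
move=> mf; rewrite /I /Rintegral; congr fine; rewrite integralE [RHS]integralE.
have mE : measurable_fun T (fun x => (f x)%:E) by apply/measurable_EFinP; exact: measurable_funTS.
rewrite !ge0_integral_dmeas_T //; [|exact: measurable_funeneg|exact: measurable_funepos].
congr (_ - _)%E; apply: eq_integral => x /set_mem Tx; have q0 := dens_ge0 dq Tx.
- rewrite !funeposE -!EFin_max -EFinM; congr (_%:E).
  by rewrite maxr_pMl // mul0r.
- rewrite !funenegE -!EFinN -!EFin_max -EFinM; congr (_%:E).
  by rewrite maxr_pMl // mul0r mulNr.
Qed.

Lemma dmeas_double (U : R -> R) : measurable_fun setT U -> (forall x, 0 <= U x) ->
  (\int[P]_(x in T) \int[P]_(y in T) (U (x - y))%:E =
   \int[mu \x mu]_(z in T `*` T) (U (z.1 - z.2) * q z.1 * q z.2)%:E)%E.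
Proof.
(* Absolute values make the integrand nonnegative off the torus as well, as Tonelli requires; on the
   torus nothing changes. *)
move=> mU U0; pose G (z : RR) := (U (z.1 - z.2) * `|q z.1| * `|q z.2|)%:E.
have mUU : measurable_fun (setT : set RR) (fun z : RR => U (z.1 - z.2)).
  by apply: measurableT_comp => //; apply: measurable_funB; [exact: measurable_fst|exact: measurable_snd].
have mq := dens_meas dq.
have mG : measurable_fun setT G.
  apply/measurable_EFinP; apply: measurable_funM; first apply: measurable_funM => //.
  - by apply: measurableT_comp => //; apply: measurableT_comp => //; exact: measurable_fst.
  - by apply: measurableT_comp => //; apply: measurableT_comp => //; exact: measurable_snd.
have G0 z : (0 <= G z)%E by rewrite lee_fin !mulr_ge0.
rewrite [RHS](_ : _ = \int[mu \x mu]_(z in T `*` T) G z)%E; last first.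
  apply: eq_integral => -[x y] /set_mem[/= Tx Ty].
  by rewrite /G /= !ger0_norm // ?(dens_ge0 dq).
rewrite tonelli_T //.
have mUx (x : R) : measurable_fun setT (fun y : R => (U (x - y))%:E).
  apply/measurable_EFinP; apply: measurableT_comp => //; apply: measurable_funB => //; exact: measurable_cst.
have inner x : T x -> (\int[mu]_(y in T) G (x, y) = (\int[P]_(y in T) (U (x - y))%:E) * (q x)%:E)%E.
  move=> Tx; rewrite ge0_integral_dmeas_T; last 2 first.
  - exact: measurable_funTS.
  - by move=> y _; rewrite lee_fin.
  rewrite -ge0_integralZr //.
  - apply: eq_integral => y /set_mem Ty; rewrite /G /= !ger0_norm ?(dens_ge0 dq) // -!EFinM.
    by congr (_%:E); ring.
  - apply: emeasurable_funM; first exact: (measurable_funTS (mUx x)).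
    by apply/measurable_EFinP; exact: measurable_funTS.
  - by move=> y Ty; rewrite mule_ge0 // lee_fin // (dens_ge0 dq).
  - by rewrite lee_fin (dens_ge0 dq).
rewrite ge0_integral_dmeas_T.
- by apply: eq_integral => x /set_mem Tx; rewrite inner.
- rewrite (_ : (fun x : R => _) = fun x : R => (\int[mu]_(y in T) ((U (x - y))%:E * (`|q y|)%:E))%E); last first.
    apply/funext => x; rewrite ge0_integral_dmeas_T; last 2 first.
    + exact: measurable_funTS.
    + by move=> y _; rewrite lee_fin.
    by apply: eq_integral => y /set_mem Ty; rewrite ger0_norm // (dens_ge0 dq).
  apply: (@measurable_inner R (fun z => (U (z.1 - z.2))%:E * (`|q z.2|)%:E)%E).
  + apply/measurable_EFinP; apply: measurable_funM => //.
    by apply: measurableT_comp => //; apply: measurableT_comp => //; exact: measurable_snd.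
  + by move=> z; rewrite mule_ge0 // lee_fin.
- by move=> x _; apply: integral_ge0 => y _; rewrite lee_fin.
Qed.

Lemma inter_meas_dmeas (V : R -> R) : measurable_fun setT V -> inter_meas P V = inter V q.
Proof.
move=> mV; rewrite inter_meas_split // /inter [RHS]integralE.
rewrite (dmeas_double (U := fun z => Num.max (V z) 0)); last 2 first.
- exact: measurable_maxr.
- by move=> y; rewrite le_max lexx orbT.
rewrite (dmeas_double (U := fun z => Num.max (- V z) 0)); last 2 first.
- by apply: measurable_maxr => //; exact: measurableT_comp.
- by move=> y; rewrite le_max lexx orbT.
congr (_ - _)%E; apply: eq_integral => -[x y] /set_mem[/= Tx Ty];
  have q1 := dens_ge0 dq Tx; have q2 := dens_ge0 dq Ty.
- rewrite funeposE -EFin_max; congr (_%:E).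
  by rewrite !maxr_pMl // !mul0r.
- rewrite funenegE -EFinN -EFin_max; congr (_%:E).
  by rewrite !maxr_pMl // !mul0r !mulNr.
Qed.

End Integral.

Lemma inter_usc_dens (W : R -> R) (q_ : nat -> R -> R) q : measurable_fun setT W -> inter_usc W ->
  (forall i, is_density (q_ i)) -> is_density q ->
  (forall f, continuous f -> periodic1 f ->
     I (fun x => f x * q_ i x) @[i --> \oo] --> I (fun x => f x * q x)) ->
  (limn_esup (fun i => inter W (q_ i)) <= inter W q)%E.
Proof.
move=> mW uW dq_ dq h.
have := uW (fun i => dmeas (dq_ i) : probability R R) (dmeas dq : probability R R)
  (fun i => dmeas_prob_on_T (dq_ i)) (dmeas_prob_on_T dq).
rewrite inter_meas_dmeas // (_ : (fun n => inter_meas _ W) = fun i => inter W (q_ i)); last first.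
  by apply/funext => i; rewrite inter_meas_dmeas.
apply=> f fc fp; have mf : measurable_fun setT f by exact: continuous_measurable_fun.
rewrite integral_dmeas //; under eq_cvg do rewrite integral_dmeas //.
exact: h.
Qed.

End DensityMeasure.

(** * The phase transition *)

Section PhaseTransition.
Variable R : realType.
Local Notation T := (@Tor R).
Local Notation mu := (@lebesgue_measure R).

Lemma ln_leB1 (c : R) : 0 < c -> ln c <= c - 1.
Proof.
by move=> c0; have := @le_ln1Dx R (c - 1); rewrite (_ : 1 + (c - 1) = c); [apply; lra|ring].
Qed.

(** Second-order Taylor bound at [1], where the second derivative [1/y] is at most [1 + e] between
    [x] and [1]. The difference [f] of the two sides increases up to [1] and decreases after it, so
    it is at most [f 1 = 0]. *)
Lemma xlnx_quad (x e : R) : 0 <= e -> 0 < x -> 1 <= x * (1 + e) ->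
  xlnx x <= (x - 1) + (1 + e) / 2 * ((x - 1) * (x - 1)).
Proof.
move=> e0 x0 xe.
pose f (y : R) := y * ln y - (y - 1) - (1 + e) / 2 * ((y - 1) * (y - 1)).
have df (y : R) : 0 < y -> is_derive y 1 f (ln y - (1 + e) * (y - 1)).
  move=> y0; have d1 := is_deriveB (is_derive_id y (1 : R)) (is_derive_cst (1 : R) y 1).
  have d2 := is_deriveB (is_deriveB (is_deriveM (is_derive_id y (1 : R)) (is_derive1_ln y0)) d1)
    (is_deriveZ ((1 + e) / 2) (is_deriveM d1 d1)).
  apply: (is_derive_eq d2).
  change (y * y^-1 + ln y * 1 - (1 - 0) - (1 + e) / 2 * ((y - 1) * (1 - 0) + (y - 1) * (1 - 0)) =
    ln y - (1 + e) * (y - 1)).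
  by field; exact: lt0r_neq0.
have cf (a b : R) : 0 < a -> {within `[a, b], continuous f}.
  move=> a0; apply: derivable_within_continuous => y; rewrite in_itv /= => /andP[ay _].
  by have [] := df y (lt_le_trans a0 ay).
have dfi (a b : R) : 0 < a -> forall y, y \in `]a, b[ -> is_derive y 1 f (ln y - (1 + e) * (y - 1)).
  by move=> a0 y; rewrite in_itv /= => /andP[ay _]; apply: df; exact: lt_trans ay.
have f1 : f 1 = 0 by rewrite /f ln1; ring.
suff : f x <= 0 by rewrite /f /xlnx; lra.
have [x1|x1] := leP 1 x.
  have [c] := MVT_segment x1 (dfi _ _ ltr01) (cf _ _ ltr01).
  rewrite in_itv /= => /andP[c1 cx]; rewrite f1 subr0 => ->.
  rewrite mulr_le0_ge0 //; last lra.
  have h : ln c <= c - 1 by apply: ln_leB1; lra.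
  have : 0 <= e * (c - 1) by rewrite mulr_ge0 //; lra.
  lra.
have [c] := MVT_segment (ltW x1) (dfi _ _ x0) (cf _ _ x0).
rewrite in_itv /= => /andP[xc c1]; rewrite f1 sub0r => h.
rewrite -oppr_ge0 h mulr_ge0 //; last lra.
have c0 : 0 < c by exact: lt_le_trans xc.
have lc : 1 - c^-1 <= ln c.
  have ci : 0 < c^-1 by rewrite invr_gt0.
  by have := ln_leB1 ci; rewrite lnV ?posrE //; lra.
have ce : 1 <= c * (1 + e) by apply: le_trans xe _; rewrite ler_wpM2r // addr_ge0.
have e2 : 1 - c^-1 - (1 + e) * (c - 1) = (1 - c) / c * (c * (1 + e) - 1) by field; exact: lt0r_neq0.
have : 0 <= (1 - c) / c * (c * (1 + e) - 1).
  by rewrite mulr_ge0 ?divr_ge0 ?subr_ge0 // ltW.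
rewrite -e2; lra.
Qed.

Variables (W : R -> R).
Hypotheses (mW : measurable_fun setT W) (pW : periodic1 W) (lW : L1 W).
Hypotheses (eW : forall x, W (- x) = W x) (aW : I W = 0).
Hypothesis uW : inter_usc W.
Variable B : R.
Hypotheses (B0 : 0 <= B) (WB : forall x, W x <= B).
Variable d : nat.
Hypothesis d0 : (0 < d)%N.
Hypothesis Wd : forall x, W (x + d%:R^-1) = W x.
Hypothesis decay : forall k : nat, (0 < k)%N -> 2 * fhat W k <= d%:R / k%:R.
Hypothesis Wd1 : 2 * fhat W d = 1.
Implicit Types (p q : R -> R).

(** Semicontinuity bounds the energy of the limit below by a real number; this also excludes the
    value [-oo] and so yields integrability. *)
Lemma inter_weak_limit (q_ : nat -> R -> R) q (l : R) :
  (forall i, is_density (q_ i)) -> is_density q ->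
  (forall f, continuous f -> periodic1 f ->
     I (fun x => f x * q_ i x) @[i --> \oo] --> I (fun x => f x * q x)) ->
  (forall i, L12 (fun x y => W (x - y) * q_ i x * q_ i y)) ->
  (forall e : R, 0 < e -> \forall i \near \oo, l - e <= Iint W (q_ i) (q_ i)) ->
  L12 (fun x y => W (x - y) * q x * q y) /\ l <= Iint W q q.
Proof.
move=> dq_ dq wq lq hl; have := inter_usc_dens mW uW dq_ dq wq.
have h1 : (l%:E <= limn_esup (fun i => inter W (q_ i)))%E.
  apply: le_trans (limn_einf_sup _); apply/lee_subgt0Pr => e e0; rewrite -EFinB.
  apply: limn_einf_ge; apply: filterS (hl e e0) => i h.
  by rewrite /inter -(EFin_I2 (lq i)) lee_fin.
move=> /(le_trans h1); have [->|[lqq ->]] := interP mW WB dq; first by rewrite leeNy_eq.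
by rewrite lee_fin.
Qed.

Lemma uniform_min (K : R) : 0 <= K <= 1 -> is_global_min W K (@qu R) /\
  forall q, is_global_min W K q -> dens_eq q (@qu R).
Proof.
move=> K01; case/andP: (K01) => K0 K1; have dqu := is_density_qu R.
have eu := energy_qu mW pW lW aW K0.
split; first by split => // p dp; rewrite eu; exact: (energy_ge0 mW pW lW eW aW B0 WB d0 Wd decay).
move=> q [dq hq]; apply: (energy_le0 mW pW lW eW aW B0 WB d0 Wd decay K01 dq).
by rewrite -eu; exact: hq.
Qed.

Lemma negative_energy (K : R) : 1 < K -> exists2 p, is_density p & exists2 r : R, r < 0 & energy W K p = r%:E.
Proof.
(* For [1 + e cos] the entropy is at most [(1 + 2 e) e^2 / 4] and the interaction is [e^2 / 4], so
   [4 e <= K - 1] makes the energy negative. The bound [4 e <= 1] keeps the density positive and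
   gives [(1 - e)(1 + 2 e) >= 1], as [xlnx_quad] asks. *)
move=> K1; pose e : R := Num.min (K - 1) 1 / 4.
have m0 : 0 < Num.min (K - 1) 1 by rewrite lt_min subr_gt0 K1 ltr01.
have e0 : 0 < e by rewrite divr_gt0.
have eK : 4 * e <= K - 1 by rewrite /e mulrC divfK // ge_min lexx.
have e1 : 4 * e <= 1 by rewrite /e mulrC divfK // ge_min lexx orbT.
pose p x := 1 + e * ck d x.
have cb x : - e <= e * ck d x <= e.
  have := ck_le1 d x; rewrite -ler_norml => h.
  by rewrite normrM gtr0_norm // ler_piMr // ltW.
have Lp : L1 p by apply: L1D; [exact: L1_cst|apply: L1Z; exact: L1_ck].
have mp : measurable_fun setT p.
  apply: measurable_funD; first exact: measurable_cst.
  by apply: measurable_funM; [exact: measurable_cst|exact: (@measurable_ck R d setT)].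
have p0 x : 0 < p x by rewrite /p; have /andP[] := cb x; lra.
have p2 x : `|p x| <= 2 by rewrite gtr0_norm // /p; have /andP[] := cb x; lra.
have Ip : I p = 1.
  by rewrite /p (ID (L1_cst 1) (L1Z e (L1_ck R d))) I_cst (IZ _ (L1_ck R d)) I_ck (gtn_eqF d0) mulr0 addr0.
have dp : is_density p by split => //; split => [x _|]; [exact: ltW|split].
have lp : L1 (fun x => xlnx (p x)).
  apply: (@L1_bounded _ _ 3); first by apply: measurable_xlnx; exact: measurable_funTS.
  move=> x _; have h0 := xlnx_young 0 (ltW (p0 x)); rewrite expR0 mulr0 add0r -/(xlnx (p x)) in h0.
  have h1 : ln (p x) <= p x - 1.
    exact: ln_leB1.
  have h2 : xlnx (p x) <= p x * (p x - 1) by rewrite /xlnx ler_pM2l.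
  have px : p x <= 2 by apply: le_trans (p2 x); exact: ler_norm.
  have h3 : p x * (p x - 1) <= 2 * 1.
    have [pp|pp] := leP 0 (p x - 1); first by apply: ler_pM => //; [exact: ltW|lra].
    have : p x * (p x - 1) <= 0 by rewrite nmulr_lle0 // ltW.
    lra.
  by rewrite ler_norml; have := p0 x; move=> *; apply/andP; split; lra.
have I2c : I (fun x : R => ck d x * ck d x) = 2^-1.
  rewrite (eq_I (g := fun x : R => 2^-1 * (1 + ck (d + d) x))); last first.
    by move=> x _; rewrite ck_addn; have := ck_sk1 d x; rewrite !expr2; lra.
  rewrite (IZ _ (L1D (L1_cst 1) (L1_ck R _))) (ID (L1_cst 1) (L1_ck R _)) I_cst I_ck.
  by rewrite addn_eq0 (gtn_eqF d0) addr0 mulr1.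
have Lcc : L1 (fun x : R => ck d x * ck d x) by apply: L1_mulck; exact: L1_ck.
have entp : Ent p <= (1 + 2 * e) / 4 * (e * e).
  have -> : (1 + 2 * e) / 4 * (e * e) = I (fun x => e * ck d x + (1 + 2 * e) / 2 * (e * e) * (ck d x * ck d x)).
    rewrite (ID (L1Z _ (L1_ck R d)) (L1Z _ Lcc)) (IZ _ (L1_ck R d)) (IZ _ Lcc) I_ck (gtn_eqF d0) I2c mulr0 add0r.
    by field.
  apply: I_le => //; first by apply: L1D; apply: L1Z => //; exact: L1_ck.
  move=> x _; have e20 : 0 <= 2 * e by rewrite mulr_ge0 // ltW.
  have h : 1 <= p x * (1 + 2 * e).
    have hp : 1 - e <= p x by rewrite /p; have /andP[] := cb x; lra.
    have : (1 - e) * (1 + 2 * e) <= p x * (1 + 2 * e) by rewrite ler_wpM2r //; lra.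
    have : 0 <= e * (1 - 2 * e) by rewrite mulr_ge0 ?ltW //; lra.
    lra.
  apply: le_trans (xlnx_quad e20 (p0 x) h) _.
  by rewrite /p le_eqVlt; apply/orP; left; apply/eqP; field.
have l12 : L12 (fun x y => W (x - y) * p x * p y) by apply: (L12_conv mW pW lW (M := 2)).
have Lwy y : L1 (fun x => W (x - y)) by exact: L1_Wsub.
have intp : Iint W p p = e * e / 4.
  have Lwc y : L1 (fun x => W (x - y) * ck d x) by exact: L1_mulck.
  have Lwp y : L1 (fun x => W (x - y) * p x).
    have := L1D (Lwy y) (L1Z e (Lwc y)); by apply: eq_L1 => x _; rewrite /p; ring.
  have Iwp y : I (fun x => W (x - y) * p x) = e / 2 * ck d y.
    rewrite (eq_I (g := fun x => W (x - y) + e * (W (x - y) * ck d x))); last by move=> x _; rewrite /p; ring.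
    rewrite (ID (Lwy y) (L1Z e (Lwc y))) (IZ _ (Lwc y)) (I_Wsub mW pW aW) (I_Wsub_ck mW pW lW eW).
    have -> : fhat W d = 2^-1 by move: Wd1; lra.
    by field.
  have Lwpp y : L1 (fun x => W (x - y) * p x * p y).
    have := L1Z (p y) (Lwp y); by apply: eq_L1 => x _; rewrite mulrC.
  rewrite /Iint (I2E' l12 (fun y _ => Lwpp y)).
  rewrite (eq_I (g := fun y => e / 2 * ck d y + e * e / 2 * (ck d y * ck d y))); last first.
    move=> y _; rewrite (eq_I (g := fun x => p y * (W (x - y) * p x))); last by move=> x _; rewrite mulrC.
    by rewrite (IZ _ (Lwp y)) Iwp /p; field.
  rewrite (ID (L1Z _ (L1_ck R d)) (L1Z _ Lcc)) (IZ _ (L1_ck R d)) (IZ _ Lcc) I_ck (gtn_eqF d0) I2c mulr0 add0r.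
  by field.
exists p => //; exists (Ent p - K * Iint W p p).
  rewrite intp; have h1 : 0 < e * e by rewrite mulr_gt0.
  have h2 : 0 < e * e * (K - 1 - 2 * e) by rewrite mulr_gt0 //; lra.
  lra.
rewrite /energy; have [h|[_ ->]] := entropyP dp; last first.
  by rewrite /= /inter -(EFin_I2 l12).
by move: h; rewrite /entropy -(EFin_I lp).
Qed.

Lemma minimizer_exists K : 1 < K -> exists q, is_global_min W K q /\ ~ dens_eq q (@qu R).
Proof.
move=> K1; have K0 : 0 < K by exact: lt_trans K1.
have EE q : is_density q -> energy W K q = +oo%E \/ [/\ L1 (fun x => xlnx (q x)),
    L12 (fun x y => W (x - y) * q x * q y) & energy W K q = (Ent q - K * Iint W q q)%:E].
  move=> dq; case: (energyE mW WB K dq) => [[->|[Kz]|h]|]; [by left| |by right|].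
    by move: K0; rewrite Kz ltxx.
  by rewrite ltNge (ltW K0).
(* Only finite energies are collected, so the infimum is taken among reals: bounded below by
   [- K B], and negative by the cosine perturbation. *)
pose S := [set r : R | exists2 p, is_density p & energy W K p = r%:E].
have lbS r : S r -> - (K * B) <= r.
  move=> [p dp]; have [->//|[lp l ->] [<-]] := EE p dp.
  have := Ent_ge0 dp lp; have := Iint_le_B WB dp l; rewrite -(ler_pM2l K0); lra.
have [p1 dp1 [r1 r10 er1]] := negative_energy K1.
have Sr1 : S r1 by exists p1.
have hS : has_inf S by split; [exists r1|exists (- (K * B))].
pose m := inf S.
have mS r : S r -> m <= r by move=> Sr; apply: ge_inf; [have [] := hS|].
have m0 : m < 0 by apply: le_lt_trans r10; exact: mS.
have sel j : {q | is_density q /\ exists r : R, [/\ energy W K q = r%:E, m <= r & r < m + j.+1%:R^-1]}.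
  apply/cid; have j0 : 0 < j.+1%:R^-1 :> R by rewrite invr_gt0 ltr0n.
  have [r Sr rm] := inf_adherent j0 hS; have := mS r Sr; case: Sr => q dq er mr.
  by exists q; split => //; exists r.
pose q_ j := sval (sel j).
have hq j : [/\ is_density (q_ j), L1 (fun x => xlnx (q_ j x)),
    L12 (fun x y => W (x - y) * q_ j x * q_ j y),
    m <= Ent (q_ j) - K * Iint W (q_ j) (q_ j) &
    Ent (q_ j) - K * Iint W (q_ j) (q_ j) <= m + j.+1%:R^-1].
  have [dq [r []]] := svalP (sel j); rewrite -/(q_ j) in dq *.
  have [->//|[lq l ->] [<-] h1 h2] := EE _ dq; by split => //; exact: ltW.
have dq_ j : is_density (q_ j) by have [] := hq j.
have hE j : Ent (q_ j) <= m + 1 + K * B.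
  have [_ _ l _] := hq j; have := Iint_le_B WB (dq_ j) l; rewrite -(ler_pM2l K0) => h.
  have : j.+1%:R^-1 <= 1 :> R by rewrite invf_le1 ?ltr0n // ler1n.
  set z := _^-1; lra.
have [s [q [eta [si [dq lq] Eq cE wq]]]] := density_compact dq_ (fun j => (let: And5 _ h _ _ _ := hq j in h)) hE.
(* The entropies tend to [eta] and the energies to [m], so the interactions tend to
   [(eta - m) / K]. *)
have [|l12 hI] := @inter_weak_limit (fun i => q_ (s i)) q ((eta - m) / K) (fun i => dq_ (s i)) dq wq
  (fun i => (let: And5 _ _ h _ _ := hq (s i) in h)).
  move=> e e0; have Ke : 0 < K * e / 2 by rewrite divr_gt0 // mulr_gt0.
  near=> i.
  have h1 : eta - K * e / 2 <= Ent (q_ (s i)).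
    by near: i; move/cvgrPdist_le: cE => /(_ _ Ke); apply: filterS => i; rewrite ler_norml => /andP[_]; lra.
  have h2 : i.+1%:R^-1 <= K * e / 2.
    by apply/ltW; near: i; exact: (near_infty_natSinv_lt (PosNum Ke)).
  have h3 : (s i).+1%:R^-1 <= i.+1%:R^-1 :> R by rewrite lef_pV2 ?posrE ?ltr0n // ler_nat ltnS.
  have [_ _ _ _ h4] := hq (s i).
  rewrite -(ler_pM2l K0) mulrBr mulrC divfK ?gt_eqF //.
  by move: h1 h2 h3 h4; set z1 := i.+1%:R^-1; set z2 := (s i).+1%:R^-1; lra.
have eq_m : energy W K q = (Ent q - K * Iint W q q)%:E.
  rewrite /energy; have [h|[_ ->]] := entropyP dq; last by rewrite /= /inter -(EFin_I2 l12).
  by move: h; rewrite /entropy -(EFin_I lq).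
have le_m : Ent q - K * Iint W q q <= m.
  move: hI; rewrite -(ler_pM2l K0) mulrC divfK ?gt_eqF //; lra.
exists q; split.
  split=> // p dp; have [->|[lp l ep]] := EE p dp; first by rewrite leey.
  by rewrite eq_m ep lee_fin; apply: le_trans le_m _; apply: mS; exists p.
move=> h; have := energy_unif_ge0 mW pW lW aW WB (ltW K0) dq h.
by rewrite eq_m lee_fin leNgt (le_lt_trans le_m m0).
Unshelve. all: by end_near. Qed.

Lemma continuous_at1 : continuous_transition W 1.
Proof.
split; first by have [] := @uniform_min 1; rewrite ?ler01 ?lexx.
move=> qK hK e e0; apply: contrapT => hn.
have sel j : {K : R | 1 < K < 1 + j.+1%:R^-1 /\ ~ (L1dist (qK K) (@qu R) < e%:E)%E}.
  apply/cid; apply: contrapT => h; apply: hn; exists j.+1%:R^-1; first by rewrite invr_gt0 ltr0n.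
  by move=> K hKj; apply: contrapT => h2; apply: h; exists K.
pose K_ j := sval (sel j); pose q_ j := qK (K_ j).
have Kj j : 1 < K_ j < 1 + j.+1%:R^-1 by have [] := svalP (sel j).
have nd j : ~ (L1dist (q_ j) (@qu R) < e%:E)%E by have [] := svalP (sel j).
have inv1 j : j.+1%:R^-1 <= 1 :> R by rewrite invf_le1 ?ltr0n // ler1n.
have hq j : [/\ is_density (q_ j), L1 (fun x => xlnx (q_ j x)),
    L12 (fun x y => W (x - y) * q_ j x * q_ j y) &
    Ent (q_ j) <= K_ j * Iint W (q_ j) (q_ j)].
  have /andP[K1 _] := Kj j; have K0 : 0 < K_ j by exact: lt_trans K1.
  have [dq hm] := hK _ K1; rewrite -/(q_ j) in dq hm.
  have := hm _ (is_density_qu R); rewrite (energy_qu mW pW lW aW (ltW K0)).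
  case: (energyE mW WB (K_ j) dq) => [[->//|[Kz]|[lq l ->]]|].
  - by move: K0; rewrite Kz ltxx.
  - by rewrite lee_fin subr_le0.
  - by rewrite ltNge (ltW K0).
have dq_ j : is_density (q_ j) by have [] := hq j.
have lq_ j : L1 (fun x => xlnx (q_ j x)) by have [] := hq j.
have l12_ j : L12 (fun x y => W (x - y) * q_ j x * q_ j y) by have [] := hq j.
have IB_ j : Iint W (q_ j) (q_ j) <= B by exact: Iint_le_B.
(* Replacing the coupling [K_ j] by [1] costs at most [(K_ j - 1) * B], which tends to [0]. *)
have hI j : Ent (q_ j) - j.+1%:R^-1 * B <= Iint W (q_ j) (q_ j).
  have [_ _ _ h] := hq j; have /andP[K1 K2] := Kj j.
  have h1 : (K_ j - 1) * Iint W (q_ j) (q_ j) <= (K_ j - 1) * B by rewrite ler_wpM2l // subr_ge0 ltW.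
  have h2 : (K_ j - 1) * B <= j.+1%:R^-1 * B by rewrite ler_wpM2r //; move: K2; set z := _^-1; lra.
  by move: h1 h2; set z := _^-1; lra.
have hE j : Ent (q_ j) <= 2 * B.
  have := hI j; have := IB_ j; have : j.+1%:R^-1 * B <= 1 * B by rewrite ler_wpM2r.
  by set z := _^-1; lra.
have [s [q [eta [si [dq lq] Eq cE wq]]]] := density_compact dq_ lq_ hE.
have [|l12 hIq] := @inter_weak_limit (fun i => q_ (s i)) q eta (fun i => dq_ (s i)) dq wq (fun i => l12_ (s i)).
  move=> r r0; have r2 : 0 < r / 2 by rewrite divr_gt0.
  have rB : 0 < r / 2 / (B + 1) by rewrite divr_gt0 //; move: B0; lra.
  near=> i.
  have h1 : eta - r / 2 <= Ent (q_ (s i)).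
    by near: i; move/cvgrPdist_le: cE => /(_ _ r2); apply: filterS => i; rewrite ler_norml => /andP[_]; lra.
  have h2 : i.+1%:R^-1 <= r / 2 / (B + 1).
    by apply/ltW; near: i; exact: (near_infty_natSinv_lt (PosNum rB)).
  have h3 : (s i).+1%:R^-1 <= i.+1%:R^-1 :> R by rewrite lef_pV2 ?posrE ?ltr0n // ler_nat ltnS.
  have B1 : 0 < B + 1 by move: B0; lra.
  have h4 : (s i).+1%:R^-1 * B <= r / 2.
    have z0 : 0 <= (s i).+1%:R^-1 :> R by rewrite invr_ge0.
    apply: le_trans (_ : (s i).+1%:R^-1 * (B + 1) <= _); first by rewrite ler_wpM2l // lerDl.
    by rewrite -ler_pdivlMr //; exact: le_trans h3 h2.
  by have := hI (s i); move: h1 h4; set z := (s i).+1%:R^-1; lra.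
have qq : dens_eq q (@qu R).
  apply: (Ent_le_inter mW pW lW eW aW B0 WB d0 Wd decay dq lq l12); exact: le_trans Eq hIq.
have eta0 : eta <= 0 by rewrite (Iint_unif mW pW lW aW dq qq l12) in hIq.
(* [pinsker] at [t = e / 8] gives [e <= Ent / (e / 8) + e / 2], so these entropies cannot tend to a
   limit [eta <= 0]. *)
have low i : e / 16 * e <= Ent (q_ (s i)).
  have Lq1 : L1 (fun x => `|q_ (s i) x - 1|).
    by apply: L1_norm; apply: L1B; [exact: dens_L1|exact: L1_cst].
  have h1 : e <= I (fun x => `|q_ (s i) x - 1|).
    rewrite leNgt; apply/negP => h; apply: (nd (s i)).
    by rewrite /L1dist /qu -(EFin_I Lq1) lte_fin.
  have e8 : 0 < e / 8 by rewrite divr_gt0.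
  have := le_trans h1 (pinsker (dq_ (s i)) (lq_ (s i)) e8).
  have -> : 4 * (e / 8) = e / 2 by field.
  move=> h2; have : e / 2 <= Ent (q_ (s i)) / (e / 8) by lra.
  rewrite ler_pdivlMr //; lra.
have : e / 16 * e <= eta by apply: (cvgr_to_ge cE); near=> i; exact: low.
have : 0 < e / 16 * e by rewrite mulr_gt0 // divr_gt0.
move: eta0; lra.
Unshelve. all: by end_near. Qed.

Lemma uniform_critical K : is_critical W K (@qu R).
Proof.
have cv x : Defs.conv W (@qu R) x = 0.
  have := I_reflect x mW pW; rewrite aW => <-.
  by apply: eq_I => y _; rewrite /qu mulr1.
have lWx x : L1 (fun y => W (x - y)) by exact: L1_reflect.
have e1 : (fun x => expR (2 * K * Defs.conv W (@qu R) x)) = fun=> 1.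
  by apply/funext => x; rewrite cv mulr0 expR0.
split; first exact: is_density_qu.
split; first by apply: aeW => x _; have := lWx x; apply: eq_L1 => y _; rewrite /qu mulr1.
split; first by have := L1_cst (1 : R); apply: eq_L1 => x _; rewrite cv mulr0 expR0.
apply: aeW => x _; rewrite cv mulr0 expR0 /qu.
by have := I_cst (1 : R); rewrite /I e1 => ->; rewrite divr1.
Qed.

(* A critical point satisfies [Ent q = 2 K Iint W q q - ln Z], and [Z >= 1]
   because the potential has mean zero. *)
Lemma critical_uniform (K : R) q : 0 <= K -> K <= 2^-1 -> is_critical W K q -> dens_eq q (@qu R).
Proof.
move=> K0 K1 [dq [lc [le hq]]].
have mq := dens_meas dq; have Lq := dens_L1 dq.
pose g := Defs.conv W q; pose Z := I (fun x => expR (2 * K * g x)).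
have lZ : L1 (fun x => expR (2 * K * g x)) by exact: le.
have hq' : dens_eq q (fun x => expR (2 * K * g x) / Z) by exact: hq.
have Z0 : 0 < Z.
  rewrite lt_neqAle I_ge0 ?andbT; last by move=> x _; exact: expR_ge0.
  apply/eqP => Zz; have : I q = 0.
    rewrite -[RHS](I_cst (0 : R)); apply: ae_eq_I; [exact: L1_meas|exact: measurable_cst|].
    by apply: aeS hq' => x h Tx; rewrite h // -Zz invr0 mulr0.
  by rewrite (dens_I dq); exact/eqP/oner_neq0.
(* [W <= B] gives [W * q <= B], so the Kirkwood-Monroe equation bounds [q] almost everywhere by this
   constant; [p] is a version of [q] bounded on the whole torus, for which Fubini is available. *)
pose M := expR (2 * K * B) / Z.
have M0 : 0 < M by rewrite divr_gt0 // expR_gt0.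
have gB : {ae mu, forall x, T x -> g x <= B}.
  apply: aeS lc => x h Tx; have lx := h Tx.
  have -> : B = I (fun y => B * q y) by rewrite IZ // (dens_I dq) mulr1.
  apply: I_le => //; first exact: L1Z.
  by move=> y Ty; rewrite ler_wpM2r // (dens_ge0 dq).
pose p x := Num.min (q x) M.
have mp : measurable_fun setT p by apply: measurable_minr => //; exact: measurable_cst.
have p0 x : T x -> 0 <= p x by move=> Tx; rewrite le_min (dens_ge0 dq Tx) ltW.
have pM x : T x -> `|p x| <= M by move=> Tx; rewrite ger0_norm ?p0 // ge_min lexx orbT.
have qp : dens_eq q p.
  apply: aeS2 hq' gB => x h1 h2 Tx; rewrite /p min_l // (h1 Tx) ler_pM2r ?invr_gt0 //.
  by rewrite ler_expR ler_wpM2l ?mulr_ge0 // h2.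
have Lp : L1 p by apply: (L1_bounded (M := M)) => //; exact: measurable_funTS.
have dp : is_density p.
  split=> //; split => //; split => //.
  by rewrite -(dens_I dq); apply/esym/ae_eq_I => //; exact: L1_meas.
have mWq (r : R -> R) x : measurable_fun setT r -> measurable_fun T (fun y => W (x - y) * r y).
  move=> mr; apply: measurable_funTS; apply: measurable_funM => //.
  by apply: measurableT_comp => //; apply: measurable_funB => //; exact: measurable_cst.
have gp x : g x = I (fun y => W (x - y) * p y).
  apply: ae_eq_I; [exact: mWq|exact: mWq|].
  by apply: aeS qp => y h Ty; rewrite h.
have l12 : L12 (fun x y => W (x - y) * p x * p y) by apply: (L12_conv mW pW lW (M := M)).
have l1x x : L1 (fun y => W (x - y) * p y) by apply: (L1_conv mW pW lW (M := M)).
have IF x : I (fun y => W (x - y) * p x * p y) = p x * g x.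
  by rewrite gp -IZ //; apply: eq_I => y _; ring.
have L1F x : L1 (fun y => W (x - y) * p x * p y).
  by have := L1Z (p x) (l1x x); apply: eq_L1 => y _; ring.
have [Lpg0 Ipg0] := I2E l12 (fun x _ => L1F x).
have Lpg : L1 (fun x => p x * g x) by move: Lpg0; apply: eq_L1 => x _; exact: IF.
have Ipg : Iint W p p = I (fun x => p x * g x) by rewrite /Iint Ipg0; apply: eq_I => x _; exact: IF.
(* With the constant factor [1], exchanging the integrals computes the mean of the potential [g]: it
   is zero because [W] has zero average. *)
have l12' : L12 (fun x y => W (x - y) * 1 * p y).
  by apply: (L12_conv mW pW lW (p := fun=> 1) (M := M)) => //; exact: L1_cst.
have L1F' x : L1 (fun y => W (x - y) * 1 * p y).
  by have := l1x x; apply: eq_L1 => y _; rewrite mulr1.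
have [Lg0 Ig0] := I2E l12' (fun x _ => L1F' x).
have eg x : I (fun y => W (x - y) * 1 * p y) = g x.
  by rewrite gp; apply: eq_I => y _; rewrite mulr1.
have Lg : L1 g by move: Lg0; apply: eq_L1 => x _; exact: eg.
have Ig : I g = 0.
  transitivity (I2 (fun x y => W (x - y) * 1 * p y)).
    by rewrite Ig0; apply: eq_I => x _; rewrite eg.
  have Lwy y : L1 (fun x => W (x - y) * 1 * p y).
    have := L1Z (p y) (L1_Wsub mW pW lW y); by apply: eq_L1 => x _; ring.
  rewrite (I2E' l12' (fun y _ => Lwy y)) (eq_I (g := fun=> 0)) ?I_cst // => y _.
  rewrite (eq_I (g := fun x => p y * W (x - y))); last by move=> x _; ring.
  by rewrite (IZ _ (L1_Wsub mW pW lW y)) (I_Wsub mW pW aW) mulr0.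
have Z1 : 1 <= Z.
  have L1g := L1D (L1_cst 1) (L1Z (2 * K) Lg).
  have -> : 1 = I (fun x => 1 + 2 * K * g x) by rewrite (ID (L1_cst 1) (L1Z _ Lg)) I_cst (IZ _ Lg) Ig mulr0 addr0.
  by apply: I_le => // x _; exact: expR_ge1Dx.
have xp : dens_eq (fun x => 2 * K * (p x * g x) - ln Z * p x) (fun x => xlnx (p x)).
  apply: aeS2 hq' qp => x h1 h2 Tx; rewrite /xlnx.
  have pe : p x = expR (2 * K * g x) / Z by rewrite -h2 // h1.
  have -> : ln (p x) = 2 * K * g x - ln Z.
    by rewrite pe lnM ?posrE ?expR_gt0 ?invr_gt0 // expRK lnV ?posrE.
  ring.
have Ll : L1 (fun x => 2 * K * (p x * g x) - ln Z * p x) by apply: L1B; exact: L1Z.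
have mxp : measurable_fun T (fun x => xlnx (p x)) by apply: measurable_xlnx; exact: measurable_funTS.
have lxp : L1 (fun x => xlnx (p x)) by apply: ae_L1 xp Ll.
have Ep : Ent p = 2 * K * Iint W p p - ln Z.
  rewrite /Ent -(ae_eq_I (L1_meas Ll) mxp xp) (IB (L1Z _ Lpg) (L1Z _ Lp)).
  by rewrite (IZ _ Lpg) (IZ _ Lp) (dens_I dp) mulr1 Ipg.
have K2 : 0 <= 2 * K <= 1.
  rewrite mulr_ge0 //=; have := ler_wpM2l (ler0n R 2) K1.
  by rewrite divff // pnatr_eq0.
have pu : dens_eq p (@qu R).
  apply: (Ent_le_Kinter mW pW lW eW aW B0 WB d0 Wd decay K2 dp lxp l12).
  by rewrite Ep gerBl ln_ge0.
by apply: aeS2 qp pu => x h1 h2 Tx; rewrite h1 // h2.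
Qed.

(** Positive coefficients occur only at frequencies [d (m+1)], where they are at most
    [1 / (2 (m+1))]; the supremum [1/2] is attained at [d]. *)
Lemma Ksharp1 : Ksharp W = 1.
Proof.
rewrite /Ksharp; set S := [set _ | _ in _].
have Sd : S 2^-1.
  have h : fhat W d = 2^-1 by move: Wd1; lra.
  by exists d => //=; rewrite h; split.
have ubS r : S r -> r <= 2^-1.
  move=> [k [k0 kp] <-]; have [/dvdnP[m km]|nk] := boolP (d %| k)%N; last first.
    by rewrite (fhat_nmult mW pW lW eW d0 Wd nk).
  case: m => [|m] in km; first by rewrite km mul0n in k0.
  have := decay_mult d0 decay m; rewrite mulnC -km => h.
  have : m.+1%:R^-1 <= 1 :> R by rewrite invf_le1 ?ltr0n // ler1n.
  by move: h; set z := _^-1; lra.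
have -> : sup S = 2^-1.
  apply/eqP; rewrite eq_le; apply/andP; split.
    by apply: ge_sup => //; exists 2^-1.
  by apply: ub_le_sup => //; exists 2^-1.
by rewrite divff ?invr1.
Qed.

End PhaseTransition.

Theorem theorem1p1 (R : realType) (n : nat) (W Wp : R -> R)
  (* standing assumptions on W (W seen as a 1-periodic function on R) *)
  (HWmeas : measurable_fun setT W)
  (HWper : periodic1 W)
  (HWeven : forall x, W (- x) = W x)
  (HWint : (@lebesgue_measure R).-integrable (@Tor R) (fun x => (W x)%:E))
  (HWavg : \int[@lebesgue_measure R]_(x in @Tor R) W x = 0)
  (* Wp is W^+ = 2 sum_{k in I+} \hat W(k) cos(2 pi k .) *)
  (HWpmeas : measurable_fun setT Wp)
  (HWpper : periodic1 Wp)
  (HWpeven : forall x, Wp (- x) = Wp x)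
  (HWpint : (@lebesgue_measure R).-integrable (@Tor R) (fun x => (Wp x)%:E))
  (HWp0 : fhat Wp 0 = 0)
  (HWpk : forall k : nat, (0 < k)%N ->
          fhat Wp k = (if 0 < fhat W k then fhat W k else 0))
  (* entropy controls the positive part W^+_+ of W^+ *)
  (Hbound : forall K : R, 0 <= K -> exists2 C : R, 0 <= C &
     forall q : R -> R, is_density q ->
       (- C%:E <= energy (fun x => Num.max (Wp x) 0%R) K q)%E)
  (Husc : inter_usc W)
  (* hypotheses of the theorem *)
  (Hper : forall x, W (x + (n.+1%:R)^-1) = W x)
  (Hn1 : 2 * fhat W n.+1 = 1)
  (Hdecay : forall k : nat, (0 < k)%N -> 2 * fhat W k <= n.+1%:R / k%:R) :
  is_critical_coupling W 1 /\ Ksharp W = 1 /\ continuous_transition W 1 /\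
  (forall K : R, 0 <= K -> K <= 2^-1 ->
     is_critical W K (@qu R) /\ forall q : R -> R, is_critical W K q -> dens_eq q (@qu R)).
Proof.
have [B B0 WB] := usc_bounded_above HWmeas HWper HWeven Husc.
have lW : L1 W by exact: HWint.
have aW : I W = 0 by exact: HWavg.
have d0 : (0 < n.+1)%N by [].
have unif := uniform_min HWmeas HWper lW HWeven aW B0 WB d0 Hper Hdecay.
split; [split; first exact: ler01|split; [|split]].
- split; last split.
  + by move=> K /andP[K0 K1]; apply: unif; rewrite K0 ltW.
  + by have [] := unif 1; rewrite ?ler01 ?lexx.
  + exact: (minimizer_exists HWmeas HWper lW HWeven aW Husc WB d0 Hn1).
- exact: (Ksharp1 HWmeas HWper lW HWeven d0 Hper Hdecay Hn1).
- exact: (continuous_at1 HWmeas HWper lW HWeven aW Husc B0 WB d0 Hper Hdecay).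
- move=> K K0 K1; split; first exact: (uniform_critical HWmeas HWper lW aW).
  move=> q; exact: (critical_uniform HWmeas HWper lW HWeven aW B0 WB d0 Hper Hdecay K0 K1).
Qed.
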